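(* Given $c>0$, there exist $\ell>1$ and $\varepsilon_0>0$ such that for every $\tilde I\subset\tilde\Delta_{\sigma,\theta}$, $\tilde J=\tilde\Delta_{\sigma,\theta}\setminus\tilde I$, every $k\in K$, $a\in\tilde A^+$, $h\in H$ with $\alpha(\log a)>c$ for all $\alpha\in\tilde J$, setting $g=kah$, and every $0<\varepsilon<\varepsilon_0$, $$\mathcal O_\varepsilon\cdot g\subset(K\cap\mathcal O_{\ell\varepsilon})k\cdot(M^{\sigma\theta}_{\tilde I}\cap\mathcal O_{\ell\varepsilon})\cdot(A_{\tilde I}\cap\mathcal O_{\ell\varepsilon})a\cdot(H\cap\mathcal O_{\ell\varepsilon})h.$$
   Context: $G$ connected noncompact semisimple real Lie group with finite center, $\sigma$ an involution, $H$ a closed subgroup whose identity component equals that of the fixed points of $\sigma$, $\theta$ a Cartan involution commuting with $\sigma$, $K$ its fixed points, $\mathfrak p,\mathfrak q$ the $(-1)$-eigenspaces of $\theta,\sigma$, $\mathfrak a$ maximal abelian in $\mathfrak p\cap\mathfrak q$, $A=\exp\mathfrak a$, $\mathfrak g^\alpha$ root spaces, $\Sigma_\sigma$ roots, $\Sigma_\sigma^+$ a positive system. A Riemannian metric on $G$ is fixed; $\mathcal O_\varepsilon$ is the $\varepsilon$-ball at $e$. $G^{\sigma\theta}$ is the fixed point group of $\sigma\theta$, $\mathfrak g^{\sigma\theta}$ its Lie algebra; $\tilde\Sigma_{\sigma,\theta}=\{\alpha\in\Sigma_\sigma:\mathfrak g^\alpha\cap\mathfrak g^{\sigma\theta}\ne0\}$,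 $\tilde\Sigma^+_{\sigma,\theta}=\Sigma_\sigma^+\cap\tilde\Sigma_{\sigma,\theta}$, $\tilde\Delta_{\sigma,\theta}$ its simple roots, $\tilde A^+$ the associated closed Weyl chamber in $A$. For $\tilde I\subset\tilde\Delta_{\sigma,\theta}$: $A_{\tilde I}=\exp\{X\in\mathfrak a:\alpha(X)=0\,\forall\alpha\in\tilde I\}$, and $M^{\sigma\theta}_{\tilde I}$ is the analytic semisimple subgroup of $G^{\sigma\theta}$ whose Lie algebra is generated by $\mathfrak g^{\pm\beta}\cap\mathfrak g^{\sigma\theta}$ for $\beta\in\tilde\Sigma^+_{\sigma,\theta}\cap\langle\tilde I\rangle$. *)

(* Defs.v *)
From HB Require Import structures.
From mathcomp Require Import all_boot all_order all_algebra.
From mathcomp Require Import all_classical all_reals all_analysis.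

Set Implicit Arguments.
Unset Strict Implicit.
Unset Printing Implicit Defensive.

Import Order.TTheory GRing.Theory Num.Theory.
Import numFieldNormedType.Exports.

Local Open Scope classical_set_scope.
Local Open Scope ring_scope.

HB.mixin Record isTopGroup G of Topological G & Group G := {
  mul_continuous : continuous (fun x : G * G => (x.1 * x.2)%g) ;
  inv_continuous : continuous (fun x : G => x^-1%g)
}.

#[short(type="topGroupType")]
HB.structure Definition TopGroup :=
  {G of isTopGroup G & Topological G & Group G}.

(* For finite-dimensional V and open U this is the usual C^k regularity:
   iterated directional derivatives are required to exist and be continuous. *)
Fixpoint Ck {R : realType} {V W : normedModType R} (k : nat)
    (U : set V) (f : V -> W) : Prop :=
  match k with
  | 0%N => forall x, U x -> {for x, continuous f}
  | k'.+1 => (forall x, U x -> differentiable f x) /\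
             (forall v, Ck k' U (fun x => 'd f x v))
  end.

Definition smooth_on {R : realType} {V W : normedModType R}
    (U : set V) (f : V -> W) := forall k, Ck k U f.

(* The values of [coord] outside [chart_dom] and of [point] outside
   [chart_img] are irrelevant. *)
Record chart (R : realType) (n : nat) (T : topologicalType) := Chart {
  chart_dom : set T ;
  coord : T -> 'rV[R]_n ;
  point : 'rV[R]_n -> T ;
  chart_img := coord @` chart_dom ;
  open_chart_dom : open chart_dom ;
  open_chart_img : open chart_img ;
  coordK : forall x, chart_dom x -> point (coord x) = x ;
  coord_continuous : forall x, chart_dom x -> {for x, continuous coord} ;
  point_continuous : forall u, chart_img u -> {for u, continuous point}
}.

(* An n-dimensional real Lie group. The atlas is presented by choosing a chart
   [chart_at x] around every point x; every manifold has such an atlas, and the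
   choice also provides an identification of each tangent space with R^n. *)
Record lieGroup (R : realType) (n : nat) := LieGroup {
  lie_sort :> topGroupType ;
  chart_at : lie_sort -> chart R n lie_sort ;
  mem_chart_at : forall x, chart_dom (chart_at x) x ;
  lie_hausdorff : hausdorff_space lie_sort ;
  lie_second_countable : @second_countable lie_sort ;
  chart_compat : forall p q,
    smooth_on
      (coord (chart_at p) @` (chart_dom (chart_at p) `&` chart_dom (chart_at q)))
      (coord (chart_at q) \o point (chart_at p)) ;
  mul_smooth : forall p q r,
    smooth_on
      [set u : 'rV[R]_n * 'rV[R]_n |
         [/\ chart_img (chart_at p) u.1, chart_img (chart_at q) u.2 &
             chart_dom (chart_at r)
               (point (chart_at p) u.1 * point (chart_at q) u.2)%g]]
      (fun u => coord (chart_at r)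
                  (point (chart_at p) u.1 * point (chart_at q) u.2)%g) ;
  inv_smooth : forall p q,
    smooth_on
      [set u | chart_img (chart_at p) u /\
               chart_dom (chart_at q) (point (chart_at p) u)^-1%g]
      (fun u => coord (chart_at q) (point (chart_at p) u)^-1%g)
}.

Section Group.
Context {R : realType} {n : nat} {G : lieGroup R n}.
Implicit Types (A B S : set G) (f : G -> G).

Definition setmulg A B : set G := [set (x * y)%g | x in A & y in B].

Definition is_subgroup S :=
  [/\ S 1%g, forall x y, S x -> S y -> S (x * y)%g & forall x, S x -> S x^-1%g].

Definition generated_subgroup B : set G :=
  [set x | forall S, is_subgroup S -> B `<=` S -> S x].

Definition fixed_points f : set G := [set x | f x = x].

Definition smooth_map f :=
  continuous f /\
  forall p q,
    smooth_on
      [set u | chart_img (chart_at p) u /\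
               chart_dom (chart_at q) (f (point (chart_at p) u))]
      (coord (chart_at q) \o f \o point (chart_at p)).

Definition lie_involution f :=
  [/\ smooth_map f, {morph f : x y / (x * y)%g} & involutive f].

End Group.

Notation "A ** B" := (setmulg A B) (at level 40, left associativity).

Definition group_center {R : realType} {n : nat} (G : lieGroup R n) : set G :=
  [set z | forall x, (z * x = x * z)%g].
Arguments group_center {R n} G.

(* The Lie algebra of G is its tangent space at 1, identified with R^n by the
   chart [chart_at 1]. *)
Section LieAlgebra.
Context {R : realType} {n : nat} {G : lieGroup R n}.
Let g := 'rV[R]_n.
Implicit Types (X Y : g) (f : G -> G).

Definition chart1 : chart R n G := chart_at 1%g.

(* the differential at 1 of a smooth map f such that f 1 = 1 *)
Definition tangent_map f : g -> g :=
  'd (coord chart1 \o f \o point chart1) (coord chart1 1%g).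

Definition Ad (x : G) : g -> g := tangent_map (fun y => x * y * x^-1)%g.

(* [X, Y] = ad(X) Y, where ad is the differential of Ad at 1 *)
Definition bracket X Y : g :=
  'd (fun u => Ad (point chart1 u) Y) (coord chart1 1%g) X.

Definition killing X Y : R :=
  \tr (lin1_mx (fun Z : g => bracket X (bracket Y Z))).

(* exp X is the value at 1 of the one-parameter subgroup with velocity X *)
Definition expG X : G :=
  xget 1%g [set x | exists gamma : R -> G,
    [/\ continuous gamma,
        forall s t, gamma (s + t) = (gamma s * gamma t)%g,
        is_derive (0 : R) (1 : R) (coord chart1 \o gamma) X &
        gamma 1 = x]].

(* S is meant to be a closed subgroup. *)
Definition lie_algebra_of (S : set G) : set g :=
  [set X | forall t : R, S (expG (t *: X))].

Definition eigen_minus f : set g := [set X | tangent_map f X = - X].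

Definition cartan_involution (theta : G -> G) :=
  lie_involution theta /\
  forall X, X != 0 -> 0 < - killing X (tangent_map theta X).

Definition abelian_subspace_in (S : set g) (b : {vspace g}) :=
  (forall X, X \in b -> S X) /\
  (forall X Y, X \in b -> Y \in b -> bracket X Y = 0).

Definition maximal_abelian_in (S : set g) (b : {vspace g}) :=
  abelian_subspace_in S b /\
  forall b' : {vspace g},
    abelian_subspace_in S b' -> (b <= b')%VS -> b' = b.

Definition lie_subalgebra (V : {vspace g}) :=
  forall X Y, X \in V -> Y \in V -> bracket X Y \in V.

Definition generated_subalgebra (B : set g) : set g :=
  [set X | forall V : {vspace g}, lie_subalgebra V ->
             (forall Y, B Y -> Y \in V) -> X \in V].

(* m is meant to be a Lie subalgebra: the analytic (connected Lie) subgroup with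
   Lie algebra m is the subgroup generated by exp m. *)
Definition analytic_subgroup (m : set g) : set G :=
  generated_subgroup (expG @` m).

End LieAlgebra.

Definition semisimple {R : realType} {n : nat} (G : lieGroup R n) :=
  forall X : 'rV[R]_n, (forall Y, killing (G := G) X Y = 0) -> X = 0.

Section Roots.
Context {R : realType} {n : nat} (G : lieGroup R n) (a : {vspace 'rV[R]_n}).
Let dual := 'Hom(subvs_of a, R^o).
Implicit Types (alpha beta : dual) (P I : set dual).

Definition root_space alpha : set 'rV[R]_n :=
  [set X | forall Y : subvs_of a,
             bracket (G := G) (vsval Y) X = (alpha Y : R) *: X].

Definition roots : set dual :=
  [set alpha | alpha != 0 /\ exists2 X, root_space alpha X & X != 0].

(* the roots that are positive on the Weyl chamber of a regular element *)
Definition positive_system P :=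
  exists2 X0 : subvs_of a,
    (forall alpha, roots alpha -> (alpha X0 : R) != 0) &
    P = [set alpha | roots alpha /\ 0 < (alpha X0 : R)].

Definition fixed_roots (tau : G -> G) : set dual :=
  [set alpha | roots alpha /\
    exists X, [/\ root_space alpha X,
                  lie_algebra_of (fixed_points tau) X & X != 0]].

Definition simple_roots P : set dual :=
  [set alpha | P alpha /\
    ~ exists beta gamma, [/\ P beta, P gamma & alpha = beta + gamma]].

Definition in_span I beta :=
  forall V : {vspace dual}, (forall alpha, I alpha -> alpha \in V) ->
    beta \in V.

Definition closed_chamber P : set (subvs_of a) :=
  [set X | forall alpha, P alpha -> 0 <= (alpha X : R)].

Definition A_sub I : set G :=
  [set expG (vsval X) | X in [set X : subvs_of a |
                                 forall alpha, I alpha -> alpha X = 0]].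

(* P is a positive system of [fixed_roots tau], I a set of simple roots of P *)
Definition M_sub (tau : G -> G) P I : set G :=
  analytic_subgroup (generated_subalgebra (G := G)
    [set X | lie_algebra_of (fixed_points tau) X /\
       exists beta, [/\ P beta, in_span I beta &
                        root_space beta X \/ root_space (- beta) X]]).

End Roots.
Arguments root_space {R n} G {a} alpha.
Arguments roots {R n} G a.
Arguments positive_system {R n} G {a} P.
Arguments fixed_roots {R n G} a tau.
Arguments A_sub {R n} G {a} I.
Arguments M_sub {R n G a} tau P I.

Section Riemannian.
Context {R : realType} {n : nat} (G : lieGroup R n).

Definition inner (M : 'M[R]_n) (v w : 'rV[R]_n) : R := (v *m M *m w^T) 0 0.

(* [gram x] is the Gram matrix of the scalar product on the tangent space at x,
   in the coordinates given by [chart_at x]; smoothness is expressed by pulling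
   the scalar products back to each fixed chart [chart_at p]. *)
Record riemannian_metric := RiemannianMetric {
  gram : G -> 'M[R]_n ;
  gram_sym : forall x, (gram x)^T = gram x ;
  gram_pos : forall x v, v != 0 -> 0 < inner (gram x) v v ;
  gram_smooth : forall p v w,
    smooth_on (chart_img (chart_at p))
      (fun u => let x := point (chart_at p) u in
         let dtau := 'd (coord (chart_at x) \o point (chart_at p)) u in
         inner (gram x) (dtau v) (dtau w) : R^o)
}.

(* c is C^1 on an open neighbourhood of [0, 1] *)
Definition C1_curve (c : R -> G) :=
  forall t : R, 0 <= t <= 1 ->
    let f := coord (chart_at (c t)) \o c in
    [/\ {for t, continuous c},
        \forall s \near t, derivable f s 1 &
        {for t, continuous (derive1 f)}].

Variable m : riemannian_metric.

Definition speed (c : R -> G) (t : R) : R :=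
  let v := derive1 (coord (chart_at (c t)) \o c) t in
  Num.sqrt (inner (gram m (c t)) v v).

Definition curve_length (c : R -> G) : \bar R :=
  (\int[lebesgue_measure]_(t in `[0%R, 1%R]) (speed c t)%:E)%E.

(* piecewise_C1_path x y L: a concatenation of finitely many C^1 curves, of
   total length L, leads from x to y *)
Inductive piecewise_C1_path : G -> G -> \bar R -> Prop :=
| path_nil x : piecewise_C1_path x x 0%E
| path_cons c y L : C1_curve c -> piecewise_C1_path (c 1) y L ->
    piecewise_C1_path (c 0) y (curve_length c + L)%E.

Definition riemannian_dist (x y : G) : \bar R :=
  ereal_inf [set L | piecewise_C1_path x y L].

Definition ball1 (e : R) : set G :=
  [set x | (riemannian_dist 1%g x < e%:E)%E].

End Riemannian.

(* Main.v *)
From HB Require Import structures.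
From mathcomp Require Import all_boot all_order all_algebra.
From mathcomp Require Import all_classical all_reals all_analysis.
From mathcomp Require Import measurable_realfun lra ring.
Require Import Defs.
Set Implicit Arguments.
Unset Strict Implicit.
Unset Printing Implicit Defensive.

Import Order.TTheory GRing.Theory Num.Theory.
Import numFieldNormedType.Exports.

Local Open Scope classical_set_scope.
Local Open Scope ring_scope.

(** Write x in the ball of radius eps as exp Z and put b = exp X. Since Ad(K) is
    bounded (it preserves the positive form - B(X, theta Y)), y = k^-1 x k is
    still eps-close to 1, and it is enough to solve
      y = exp(k') exp(m) exp(a') (b exp(h') b^-1)
    with k' in Lie K, m in Lie M_I, a' in Lie A_I, h' in Lie H of size O(eps).

    The linearised equation w = k' + m + a' + Ad(b) h' is solved with bounds
    independent of X. For a root vector r of weight alpha with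
    sigma (theta r) = e r, e = 1 or -1, the vector h = r + e theta r is fixed by
    sigma, r + theta r is fixed by theta, and, with t = alpha(X),
      Ad(b) h - e exp(-t) (r + theta r) = (exp t - e exp(-t)) r.
    For e = -1 the factor is 2 cosh t. For e = 1 the root alpha belongs to the
    system of sigma theta: either it lies in the span of I, and then r is in
    Lie M_I, or alpha(X) is in absolute value more than c, which bounds 2 sinh t
    from below. The zero weight space splits into Lie K, Lie H and a, and a is
    the sum of Lie A_I and the coroots [r, theta r], which are in Lie M_I.

    The nonlinear equation then follows from a fixed point argument in a chart
    in which the exponential map and the multiplication are quantitatively close
    to the identity and to the addition. *)

(** * Normed spaces and differential calculus *)

Section Norms.
Context {R : realType}.

(** The obstacle is uniformity: X ranges over an unbounded chamber, so Ad(b) has no uniform norm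
    bound and no estimate may depend on the size of b. The way out is to bound h' and Ad(b) h'
    separately. Since b exp(h') b^-1 = exp(Ad(b) h'), the nonlinear equation only involves Ad(b) h',
    while h' itself matters at the end, for the ball around the identity. The linear problem is
    solved on a basis of the Lie algebra and extended linearly, so its size bound is also a
    Lipschitz bound, and the radius of the contraction depends on that bound alone. The chamber only
    controls the roots of sigma theta. For e = -1 the number alpha(X) may have any sign or vanish,
    and the evenness and positivity of cosh save the estimate; for e = 1 and alpha in the span of I,
    sinh may vanish and M_I absorbs the root vector. The exponential, given by one-parameter
    subgroups, is rebuilt by dyadic squaring in the chart at 1. The single analytic input is that
    the product, being C^2, differs from the addition by a map whose Lipschitz constant on a ball is
    O(radius). *)

Lemma nbhs_normE (V : normedModType R) (x : V) (P : set V) :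
  nbhs x P <-> exists2 r : R, 0 < r & forall y, `|y - x| < r -> P y.
Proof.
split=> [/nbhs_normP[r r0 h]|[r r0 h]].
  by exists r => // y yx; apply: h; rewrite /= distrC.
by apply/nbhs_normP; exists r => // y; rewrite /= distrC; exact: h.
Qed.

Lemma coord_le_norm m n (v : 'M[R]_(m, n)) i j : `|v i j| <= `|v|.
Proof.
by rewrite [leRHS]/Num.Def.normr/= mx_normrE; exact: (le_bigmax _ _ (i, j)).
Qed.

Lemma mx_norm_le m n (v : 'M[R]_(m, n)) c :
  0 <= c -> (forall i j, `|v i j| <= c) -> `|v| <= c.
Proof.
by move=> c0 h; rewrite [leLHS]/Num.Def.normr/= mx_normrE bigmax_le.
Qed.

(** Each coordinate is a telescoping series dominated by a geometric one. *)
Lemma geometric_cvg n (u : nat -> 'rV[R]_n) (C q : R) : 0 <= C -> 0 <= q < 1 ->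
  (forall k, `|u k.+1 - u k| <= C * q ^+ k) ->
  exists l : 'rV[R]_n, u @ \oo --> l.
Proof.
move=> C0 /andP[q0 q1] h.
have cv : cvgn (fun k => u k).
  have scv j : cvgn (fun k => u k ord0 j).
    pose d k : R := u k.+1 ord0 j - u k ord0 j.
    have ds : cvgn (series d).
      apply: normed_cvg.
      apply: (@series_le_cvg _ _ (geometric C q)).
      - by move=> k; exact: normr_ge0.
      - by move=> k; rewrite /= mulr_ge0// exprn_ge0.
      - move=> k /=; apply: le_trans (h k).
        have -> : d k = (u k.+1 - u k) ord0 j by rewrite !mxE.
        exact: coord_le_norm.
      - by apply: is_cvg_geometric_series; rewrite ger0_norm.
    have E : (fun k => u k ord0 j) = (fun k => u 0%N ord0 j + series d k).
      apply/funext => k; rewrite /series/= telescope_sumr// addrC.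
      by rewrite subrK.
    rewrite E; apply: is_cvgD => //; exact: is_cvg_cst.
  apply/cvg_ex; exists (\row_j lim (u k ord0 j @[k --> \oo])).
  apply/cvgrPdist_le => e e0; near=> k.
  apply: mx_norm_le => [|i j]; first exact: ltW.
  rewrite !mxE (ord1 i).
  move: j {i}; near: k; apply: filter_forall => j.
  by move/cvgrPdist_le: (scv j); exact.
by exists (lim (u k @[k --> \oo])).
Unshelve. all: by end_near. Qed.

Lemma cvg_norm_le (V : normedModType R) (u : nat -> V) l c :
  u @ \oo --> l -> (forall k, `|u k| <= c) -> `|l| <= c.
Proof.
move=> ul h; apply/ler_addgt0Pl => e e0.
move/cvgrPdist_lt : ul => /(_ _ e0) [N _ /(_ N (leqnn N)) /= HN].
rewrite -(subrK (u N) l); apply: (le_trans (ler_normD _ _)).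
by rewrite lerD// ltW.
Qed.

(** Quantitative inverse function theorem: [w] is the fixed point of [w - g w + z], a contraction of
    ratio 1/2, obtained by iteration from 0. *)
Lemma near_id_surj n (g : 'rV[R]_n -> 'rV[R]_n) (r : R) :
  (forall x y, `|x| <= r -> `|y| <= r -> `|g x - g y - (x - y)| <= 2^-1 * `|x - y|) ->
  g 0 = 0 -> forall z, 2 * `|z| <= r -> exists2 w, `|w| <= 2 * `|z| & g w = z.
Proof.
move=> gr g0 z zr.
pose T w := w - g w + z.
pose u k := iter k T 0.
have uS k : u k.+1 = T (u k) by [].
have bd k : `|u k| <= 2 * `|z| /\ `|u k.+1 - u k| <= `|z| * 2^-1 ^+ k.
  (* The two bounds must be carried together: the increments sum to the partial geometric sum
     [2 * |z| * (1 - 2^-k)], which keeps the iterates in the ball of radius [r] where the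
     contraction estimate is valid. *)
  have /(_ k k (leqnn k)) [H1 H2] : forall m k, (k <= m)%N ->
      `|u k| <= 2 * `|z| * (1 - 2^-1 ^+ k) /\ `|u k.+1 - u k| <= `|z| * 2^-1 ^+ k.
    elim=> [|m IH] {}k.
      rewrite leqn0 => /eqP ->; rewrite uS /u /= /T g0 !subr0 add0r expr0.
      by rewrite subrr mulr0 mulr1 normr0.
    rewrite leq_eqVlt => /orP[/eqP ->|]; last by rewrite ltnS; exact: IH.
    have [H1 H2] := IH m (leqnn m).
    have B1 : `|u m.+1| <= 2 * `|z| * (1 - 2^-1 ^+ m.+1).
      have -> : u m.+1 = u m + (u m.+1 - u m) by rewrite addrC subrK.
      apply: (le_trans (ler_normD _ _)); apply: (le_trans (lerD H1 H2)).
      rewrite exprS; set q := _ ^+ m.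
      by have -> : 2 * `|z| * (1 - q) + `|z| * q = 2 * `|z| * (1 - 2^-1 * q) by field.
    split => //.
    have le2 k' : 2 * `|z| * (1 - 2^-1 ^+ k') <= 2 * `|z| :> R.
      by rewrite ler_piMr ?gerBl ?exprn_ge0 ?mulr_ge0.
    have := gr (u m.+1) (u m) (le_trans B1 (le_trans (le2 _) zr))
       (le_trans H1 (le_trans (le2 _) zr)).
    have -> : u m.+2 - u m.+1 = - (g (u m.+1) - g (u m) - (u m.+1 - u m)).
      rewrite [in LHS]uS [in X in _ - X]uS /T.
      by apply/rowP => i; rewrite !mxE; ring.
    rewrite normrN => /le_trans; apply.
    by rewrite exprS mulrCA ler_wpM2l.
  split=> //; apply: (le_trans H1).
  by rewrite ler_piMr ?gerBl ?exprn_ge0 ?mulr_ge0.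
have [l ul] := @geometric_cvg n u `|z| 2^-1 (normr_ge0 _) ltac:(apply/andP; split; lra) (fun k => (bd k).2).
have lz : `|l| <= 2 * `|z| by apply: cvg_norm_le ul _ => k; exact: (bd k).1.
exists l => //; apply/eqP; rewrite -subr_eq0 -normr_le0.
apply/ler_addgt0Pl => e e0; rewrite addr0.
have e8 : 0 < e / 4 by rewrite divr_gt0.
move/cvgrPdist_lt : ul => /(_ _ e8) [N _ HN].
have h1 := HN N (leqnn N); have h2 := HN N.+1 (leqnSn N).
rewrite /= in h1 h2.
have h3 := gr l (u N) (le_trans lz zr) (le_trans (bd N).1 zr).
have -> : g l - z = (g l - g (u N) - (l - u N)) + (l - u N.+1).
  by rewrite uS /T; apply/rowP => i; rewrite !mxE; ring.
apply: (le_trans (ler_normD _ _)).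
have := normr_ge0 (l - u N); lra.
Qed.

End Norms.

(** * Differentials along curves and the mean value inequality *)

Section Calculus.
Context {R : realType}.
Implicit Types (U V W : normedModType R).

Lemma diff_approx V W (f : V -> W) x : differentiable f x ->
  forall e : R, 0 < e -> \forall y \near x, `|f y - f x - 'd f x (y - x)| <= e * `|y - x|.
Proof.
move=> /diff_locally /eqaddoP df e e0.
move/nbhs_normE : (df _ e0) => -[r r0 h]; apply/nbhs_normE; exists r => // y yx.
have := h (y - x); rewrite subr0 => /(_ yx) /=.
by rewrite !fctE /= subrK opprD addrA.
Qed.

Lemma diff_lipschitz V W (f : V -> W) x : differentiable f x ->
  exists2 A : R, 0 < A & \forall y \near x, `|f y - f x| <= A * `|y - x|.
Proof.
move=> df; have [k k0 hk] := linear_lipschitz (diff_continuous df).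
exists (k + 1); first by rewrite ltr_wpDr.
have := diff_approx df ltr01; apply: filterS => y hy.
rewrite -(subrK ('d f x (y - x)) (f y - f x)) mulrDl addrC.
by apply: (le_trans (ler_normD _ _)); rewrite lerD.
Qed.

Lemma is_derive_comp_diff U V (f : U -> V) (c : R -> U) (t : R) c' :
  is_derive t (1 : R) c c' -> differentiable f (c t) ->
  is_derive t (1 : R) (f \o c) ('d f (c t) c').
Proof.
move=> dc df.
have dc1 : differentiable c t by apply/derivable1_diffP; exact: ex_derive.
apply: DeriveDef.
  by apply/derivable1_diffP; exact: differentiable_comp.
rewrite deriveE; last exact: differentiable_comp.
rewrite diff_comp//=; congr ('d f _ _).
by rewrite -[LHS](deriveE _ dc1) derive_val.
Qed.

Lemma is_derive_line V (x v : V) (t : R) : is_derive t (1 : R) (fun s => x + s *: v) v.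
Proof.
have dl : differentiable ( *:%R ^~ v : R -> V) t by [].
have D : is_derive t (1 : R) ( *:%R ^~ v : R -> V) v.
  apply: DeriveDef; first exact/derivable1_diffP.
  by rewrite deriveE// diff_val scale1r.
have := @is_deriveD _ _ _ _ _ _ _ _ _ (is_derive_cst x t (1 : R)) D.
by rewrite add0r.
Qed.

Lemma is_derive_coord m n (F : R -> 'M[R]_(m, n)) (t : R) F' i j :
  is_derive t (1 : R) F F' -> is_derive t (1 : R) (fun s => F s i j) (F' i j).
Proof.
move=> dF; apply: DeriveDef.
  by move/derivable_mxP : (@ex_derive _ _ _ _ _ _ _ dF); exact.
have := @derive_val _ _ _ _ _ _ _ dF; rewrite derive_mx// => /matrixP/(_ i j).
by rewrite !mxE.
Qed.

(** The scalar mean value theorem is applied to each coordinate; with the sup norm this costs no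
    dimensional factor. The vector [w] stands for a linear prediction of the increment. *)
Lemma mean_value_le U m (f : U -> 'rV[R]_m) x y w (K : R) : 0 <= K ->
  (forall t : R, 0 <= t <= 1 -> differentiable f (y + t *: (x - y)) /\
     `|'d f (y + t *: (x - y)) (x - y) - w| <= K) ->
  `|f x - f y - w| <= K.
Proof.
move=> K0 h; apply: mx_norm_le => // i j.
pose F t := f (y + t *: (x - y)).
have dF (t : R) : 0 <= t <= 1 -> is_derive t (1 : R) (fun s => F s i j)
    ('d f (y + t *: (x - y)) (x - y) i j).
  move=> /h[df _]; apply: is_derive_coord.
  exact: (is_derive_comp_diff (is_derive_line _ _ _)).
have [c c01 Ec] : exists2 c : R, c \in `]0, 1[%R &
    F 1 i j - F 0 i j = 'd f (y + c *: (x - y)) (x - y) i j * (1 - 0).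
  apply: (@MVT _ (fun s => F s i j) (fun t => 'd f (y + t *: (x - y)) (x - y) i j)) => //.
    by move=> t; rewrite in_itv /= => /andP[t0 t1]; apply: dF; rewrite !ltW.
  apply: continuous_in_subspaceT => t; rewrite inE /= in_itv /= => t01.
  apply: differentiable_continuous; apply/derivable1_diffP.
  by have /dF d := t01; exact: ex_derive.
have -> : (f x - f y - w) i j = F 1 i j - F 0 i j - w i j.
  by rewrite /F scale1r scale0r addr0 [y + _]addrC subrK !mxE.
rewrite Ec subr0 mulr1.
have Ev (v : 'rV[R]_m) : v i j - w i j = (v - w) i j by rewrite !mxE.
rewrite Ev.
apply: le_trans (coord_le_norm _ _ _) _.
by apply: (h c _).2; move: c01; rewrite in_itv /= => /andP[? ?]; rewrite !ltW.
Qed.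

End Calculus.

(** * Strict differentiability of C^2 maps *)

Section Strict.
Context {R : realType}.

Lemma row_norm_sum n (v : 'rV[R]_n) : v = \sum_j v ord0 j *: delta_mx ord0 j.
Proof. exact: row_sum_delta. Qed.

(** By monotonicity in the constant, the sum of the individual constants serves all indices of a
    finite type at once. *)
Lemma near_exists_sum (T : topologicalType) (x : T) (I : finType) (P : I -> R -> T -> Prop) :
  (forall i A B y, A <= B -> P i A y -> P i B y) ->
  (forall i, exists2 A : R, 0 < A & \forall y \near x, P i A y) ->
  exists2 A : R, 0 < A & \forall y \near x, forall i, P i A y.
Proof.
move=> mono h; pose A i := s2val (cid2 (h i)).
have A0 i : 0 < A i by rewrite /A; case: cid2.
exists (1 + \sum_i A i); first by rewrite ltr_wpDr// sumr_ge0// => i _; exact: ltW.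
apply: filter_forall => i; have : \forall y \near x, P i (A i) y by rewrite /A; case: cid2.
apply: filterS => y; apply: mono.
rewrite (bigD1 i)//= addrCA ler_wpDr// addr_ge0// sumr_ge0// => j _; exact: ltW.
Qed.

Lemma linear_prod_expand n (W : lmodType R) (f : {linear ('rV[R]_n * 'rV[R]_n)%type -> W}) v :
  f v = \sum_j v.1 ord0 j *: f (delta_mx ord0 j, 0) + \sum_j v.2 ord0 j *: f (0, delta_mx ord0 j).
Proof.
have E : v = \sum_j v.1 ord0 j *: (delta_mx ord0 j, 0) + \sum_j v.2 ord0 j *: (0, delta_mx ord0 j).
  have F1 (g : 'I_n -> 'rV[R]_n * 'rV[R]_n) : (\sum_j g j).1 = \sum_j (g j).1.
    exact: (big_morph (@fst _ _) (fun _ _ => erefl) erefl).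
  have F2 (g : 'I_n -> 'rV[R]_n * 'rV[R]_n) : (\sum_j g j).2 = \sum_j (g j).2.
    exact: (big_morph (@snd _ _) (fun _ _ => erefl) erefl).
  rewrite [LHS]surjective_pairing [RHS]surjective_pairing; congr (_, _).
    rewrite [RHS]/= F1 F1 /= [X in _ + X]big1 ?addr0; last by move=> j _; rewrite scaler0.
    exact: row_norm_sum.
  rewrite [RHS]/= F2 F2 /= [X in X + _]big1 ?add0r; last by move=> j _; rewrite scaler0.
  exact: row_norm_sum.
rewrite {1}E linearD !linear_sum; congr (_ + _).
  by apply: eq_bigr => j _; rewrite linearZ.
by apply: eq_bigr => j _; rewrite linearZ.
Qed.

Lemma linear_prod_bound n m (f g : {linear ('rV[R]_n * 'rV[R]_n)%type -> 'rV[R]_m}) (c : R) v :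
  (forall j, `|f (delta_mx ord0 j, 0) - g (delta_mx ord0 j, 0)| <= c) ->
  (forall j, `|f (0, delta_mx ord0 j) - g (0, delta_mx ord0 j)| <= c) ->
  `|f v - g v| <= (n + n)%:R * c * `|v|.
Proof.
move=> h1 h2.
have nv1 j : `|v.1 ord0 j| <= `|v|.
  by apply: le_trans (coord_le_norm _ _ _) _; rewrite prod_normE le_max lexx.
have nv2 j : `|v.2 ord0 j| <= `|v|.
  by apply: le_trans (coord_le_norm _ _ _) _; rewrite prod_normE le_max lexx orbT.
rewrite (linear_prod_expand f) (linear_prod_expand g) opprD addrACA -!sumrB natrD !mulrDl.
have S : n%:R * c * `|v| = \sum_(j < n) c * `|v|.
  by rewrite sumr_const card_ord -mulrA mulr_natl.
apply: (le_trans (ler_normD _ _)); rewrite S; apply: lerD.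
  apply: le_trans (ler_norm_sum _ _ _) _; apply: ler_sum => j _.
  by rewrite -scalerBr normrZ mulrC ler_pM.
apply: le_trans (ler_norm_sum _ _ _) _; apply: ler_sum => j _.
by rewrite -scalerBr normrZ mulrC ler_pM.
Qed.

(** The differential, evaluated on each basis vector, is differentiable at [p0] and so differs from
    its value there by O(distance); the mean value inequality on the segment turns this into a
    Lipschitz constant for the remainder that shrinks linearly with the ball. *)
Lemma C2_strict n m (D : set ('rV[R]_n * 'rV[R]_n)) (f : 'rV[R]_n * 'rV[R]_n -> 'rV[R]_m) p0 :
  open D -> D p0 -> Ck 2 D f ->
  exists r A : R, [/\ 0 < r, 0 < A & forall p p', `|p - p0| < r -> `|p' - p0| < r ->
    D p /\
    `|f p - f p' - 'd f p0 (p - p')| <= A * Num.max `|p - p0| `|p' - p0| * `|p - p'|].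
Proof.
move=> oD Dp0 [df1 df2].
pose e (b : bool) j : 'rV[R]_n * 'rV[R]_n := if b then (delta_mx ord0 j, 0) else (0, delta_mx ord0 j).
have h : exists2 A : R, 0 < A & \forall y \near p0, forall bj : bool * 'I_n,
    `|'d f y (e bj.1 bj.2) - 'd f p0 (e bj.1 bj.2)| <= A * `|y - p0|.
  apply: (near_exists_sum (P := fun bj A y => `|'d f y (e bj.1 bj.2) - 'd f p0 (e bj.1 bj.2)| <= A * `|y - p0|)).
    by move=> bj A B y AB /le_trans; apply; rewrite ler_wpM2r.
  by move=> bj; apply: diff_lipschitz; exact: (df2 (e bj.1 bj.2)).1.
have [A A0 hA] := h.
have /nbhs_normE[r r0 hr] : \forall y \near p0, D y /\ forall bj : bool * 'I_n,
    `|'d f y (e bj.1 bj.2) - 'd f p0 (e bj.1 bj.2)| <= A * `|y - p0|.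
  by apply: filterI => //; apply: open_nbhs_nbhs.
exists r, ((n + n)%:R * A + 1); split => //.
  by rewrite ltr_wpDl// mulr_ge0// ltW.
move=> p p' pr p'r; split; first exact: (hr _ pr).1.
pose M := Num.max `|p - p0| `|p' - p0|.
have M0 : 0 <= M by rewrite /M le_max normr_ge0.
apply: mean_value_le; first by rewrite !mulr_ge0// addr_ge0// mulr_ge0// ltW.
move=> t /andP[t0 t1]; set q := p' + t *: (p - p').
have qM : `|q - p0| <= M.
  (* Convexity: a point of the segment is no farther from [p0] than the farther end. *)
  have -> : q - p0 = t *: (p - p0) + (1 - t) *: (p' - p0).
    rewrite /q; have -> : p - p' = (p - p0) - (p' - p0) by rewrite opprB subrKA.
    by rewrite addrAC [t *: (_ - _ - _)]scalerBr scalerBl scale1r addrCA.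
  apply: (le_trans (ler_normD _ _)); rewrite !normrZ ger0_norm// ger0_norm ?subr_ge0//.
  have -> : M = t * M + (1 - t) * M by ring.
  by rewrite lerD// ler_wpM2l ?subr_ge0// /M le_max lexx ?orbT.
have qr : `|q - p0| < r by apply: le_lt_trans qM _; rewrite /M gt_max pr p'r.
have [Dq hq] := hr q qr.
split; first exact: df1.
apply: le_trans (@linear_prod_bound _ _ _ _ (A * M) _ _ _) _.
- by move=> j; apply: le_trans (hq (true, j)) _; rewrite ler_wpM2l// ltW.
- by move=> j; apply: le_trans (hq (false, j)) _; rewrite ler_wpM2l// ltW.
rewrite ler_wpM2r// mulrA ler_wpM2r// lerDl//.
Qed.
End Strict.

(** * Local groups and the exponential map *)

Section LocalExp.
Context {R : realType} {n : nat}.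
Let V := 'rV[R]_n.
Variables (mu : V -> V -> V) (r0 A : R).
Hypothesis A0 : 0 < A.
Hypothesis r00 : 0 < r0.
Hypothesis mu0 : mu 0 0 = 0.
Hypothesis mu_strict : forall x y x' y' M D, `|x| <= M -> `|y| <= M -> `|x'| <= M -> `|y'| <= M ->
  M < r0 -> `|x - x'| <= D -> `|y - y'| <= D ->
  `|mu x y - mu x' y' - ((x + y) - (x' + y'))| <= A * M * D.

(** The constant 2A is the one preserved by [phi -> mu (phi (x/2)) (phi (x/2))]: a constant C
    becomes A + C/2, because halving the arguments gains a factor 4 and squaring loses a factor
    2. *)
Definition near_id (rho : R) (phi : V -> V) := phi 0 = 0 /\
  forall x y M, `|x| <= M -> `|y| <= M -> M <= rho ->
    `|phi x - phi y - (x - y)| <= 2 * A * M * `|x - y|.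

Lemma mu_double (a b : V) M : `|a| <= M -> `|b| <= M -> M < r0 ->
  `|mu a a - mu b b - 2 *: (a - b)| <= A * M * `|a - b|.
Proof.
move=> aM bM Mr; have := mu_strict aM aM bM bM Mr (lexx _) (lexx _).
by congr (`| _ - _ | <= _); apply/rowP => i; rewrite !mxE; ring.
Qed.

(* [E] is the limit of the maps [x |-> sq^k (2^-k x)], where [sq u = mu u u]. *)
Lemma local_exp_exists : exists rho (E : V -> V),
  [/\ 0 < rho, rho * 4 * A <= 1, rho < r0, near_id rho E &
      forall x, `|x| <= rho -> E x = mu (E (2^-1 *: x)) (E (2^-1 *: x))].
Proof.
(* The first bound keeps the arguments of [mu] in its domain; the second makes the Lipschitz
   constant [2 * A * rho] of the deviation from the identity at most 1/2. *)
pose rho := Num.min (r0 / 2) (4 * A)^-1.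
have rho0 : 0 < rho by rewrite lt_min divr_gt0//= invr_gt0 mulr_gt0.
have rhoA : rho * 4 * A <= 1.
  by rewrite -mulrA -ler_pdivlMr ?mulr_gt0// div1r ge_min lexx orbT.
have rhor : rho < r0.
  apply: (@le_lt_trans _ _ (r0 / 2)); first by rewrite ge_min lexx.
  by move: r00; lra.
pose T (phi : V -> V) x := mu (phi (2^-1 *: x)) (phi (2^-1 *: x)).
pose Ek k := iter k T id.
have half (x : V) : `|2^-1 *: x| = `|x| / 2.
  by rewrite normrZ ger0_norm ?invr_ge0// mulrC.
have small phi x : near_id rho phi -> `|x| <= rho -> `|phi (2^-1 *: x)| <= `|x|.
  move=> [phi0 h] xr; have x0 := normr_ge0 x.
  have := h (2^-1 *: x) 0 (`|x| / 2); rewrite half normr0 lexx phi0 !subr0.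
  move=> /(_ isT ltac:(lra) ltac:(lra)); set y := phi _ => hy.
  rewrite -(subrK (2^-1 *: x) y); apply: (le_trans (ler_normD _ _)); rewrite half in hy *.
  have : A * `|x| <= 4^-1 by nra.
  by set z := `|y - _| in hy *; nra.
have idk k : near_id rho (Ek k).
  elim: k => [|k [IH0 IH]].
    split=> // x y M xM yM Mr; rewrite subrr normr0 !mulr_ge0//; first exact: ltW.
    exact: le_trans (normr_ge0 x) xM.
  split; first by rewrite /Ek /= /T scaler0 -/(Ek k) IH0.
  move=> x y M xM yM Mr.
  have M0 : 0 <= M by apply: le_trans xM.
  have Mr0 : M < r0 by apply: le_lt_trans rhor.
  have AM : A * M <= 4^-1 by nra.
  rewrite /Ek /= /T -/(Ek k).
  have xr := le_trans xM Mr; have yr := le_trans yM Mr.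
  have sx := le_trans (small _ _ (conj IH0 IH) xr) xM.
  have sy := le_trans (small _ _ (conj IH0 IH) yr) yM.
  have h1 := mu_double sx sy Mr0.
  have := IH (2^-1 *: x) (2^-1 *: y) (M / 2).
  rewrite !half -scalerBr half => /(_ ltac:(lra) ltac:(lra) ltac:(lra)).
  move: h1; set a := Ek k _; set b := Ek k _ => h1 h2.
  have h3 : `|a - b| <= `|x - y|.
    rewrite -(subrK (2^-1 *: (x - y)) (a - b)).
    apply: (le_trans (ler_normD _ _)); rewrite half.
    have := normr_ge0 (x - y); set z := `|x - y| in h2 *.
    set w := `|a - b - _| in h2 *; nra.
  have -> : mu a a - mu b b - (x - y) =
     (mu a a - mu b b - 2 *: (a - b)) + 2 *: (a - b - 2^-1 *: (x - y)).
    by apply/rowP => i; rewrite !mxE; field.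
  apply: (le_trans (ler_normD _ _)); rewrite normrZ ger0_norm//.
  have := normr_ge0 (a - b); set z := `|x - y| in h2 h3 *.
  set w := `|a - b - _| in h2 *; set v := `|a - b| in h1 h3 * => v0.
  have : A * M * v <= A * M * z by rewrite ler_wpM2l// mulr_ge0// ltW.
  lra.
(* Source of the ratio 3/4: the bound is quadratic in x, so halving the argument divides it by 4,
   while squaring multiplies a difference by at most 2 + A|x| <= 3. *)
have ck k x : `|x| <= rho -> `|Ek k.+1 x - Ek k x| <= A * `|x| ^+ 2 * (3 / 4) ^+ k.
  elim: k x => [|k IH] x xr; have x0 := normr_ge0 x; have Ax : A * `|x| <= 4^-1 by nra.
    rewrite expr0 mulr1 /Ek /= /T.
    have := @mu_double (2^-1 *: x) 0 `|x|; rewrite half normr0 mu0 !subr0 half.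
    move=> /(_ ltac:(lra) ltac:(lra) ltac:(lra)).
    rewrite scalerA divff// scale1r => /le_trans; apply.
    by rewrite expr2 [leRHS]mulrA ler_wpM2l ?mulr_ge0 ?(ltW A0)//; lra.
  have -> : Ek k.+2 x = T (Ek k.+1) x by []. 
  have -> : Ek k.+1 x = T (Ek k) x by [].
  rewrite /T.
  have := IH (2^-1 *: x); rewrite half => /(_ ltac:(lra)).
  have sx := small _ _ (idk k.+1) xr; have sy := small _ _ (idk k) xr.
  have := mu_double sx sy ltac:(lra).
  set a := Ek k.+1 _; set b := Ek k _ => h1 h2.
  rewrite -(subrK (2 *: (a - b)) (mu a a - mu b b)).
  apply: (le_trans (ler_normD _ _)); rewrite normrZ ger0_norm//.
  rewrite [_ ^+ k.+1]exprS; set q := (3 / 4) ^+ k in h2 *.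
  have -> : A * `|x| ^+ 2 * (3 / 4 * q) = 3 * (A * (`|x| / 2) ^+ 2 * q) by field.
  have v0 := normr_ge0 (a - b); set v := `|a - b| in h1 h2 v0 *.
  have : A * `|x| * v <= v by rewrite ler_piMl//; lra.
  lra.
have cv x : `|x| <= rho -> exists l : V, Ek k x @[k --> \oo] --> l.
  move=> xr; apply: (@geometric_cvg _ _ (fun k => Ek k x) (A * `|x| ^+ 2) (3 / 4)).
  - by rewrite mulr_ge0// ltW.
  - by apply/andP; split; lra.
  - by move=> k; exact: ck.
pose E x : V := lim (Ek k x @[k --> \oo]).
have cvE x : `|x| <= rho -> Ek k x @[k --> \oo] --> E x.
  by move=> /cv h; apply/cvg_ex.
exists rho, E; split => //.
  split.
    rewrite /E; have -> : (fun k => Ek k 0) = cst 0 by apply/funext => k; exact: (idk k).1.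
    exact: lim_cst.
  move=> x y M xM yM Mr.
  apply: (cvg_norm_le (u := fun k => Ek k x - Ek k y - (x - y))) => [|k].
    by apply: cvgB; [apply: cvgB; apply: cvE; lra|exact: cvg_cst].
  exact: (idk k).2.
move=> x xr; set h := 2^-1 *: x.
have hr : `|h| <= rho by rewrite half; have := normr_ge0 x; lra.
have Eh : `|E h| <= `|x|.
  by apply: cvg_norm_le (cvE _ hr) _ => k; apply: small.
have cT : Ek k.+1 x @[k --> \oo] --> E x by have := cvE _ xr; rewrite -cvg_shiftS.
(* The functional equation holds between consecutive iterates and passes to the limit by continuity
   of squaring. *)
have cT2 : Ek k.+1 x @[k --> \oo] --> mu (E h) (E h).
  apply/cvgrPdist_le => e e0.
  move/cvgrPdist_le : (cvE _ hr) => /(_ (e / 3) ltac:(lra)).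
  apply: filterS => k hk.
  have -> : Ek k.+1 x = mu (Ek k h) (Ek k h) by [].
  have := mu_double Eh (small _ _ (idk k) xr) ltac:(lra).
  have x0 := normr_ge0 x; have Ax : A * `|x| <= 4^-1 by nra.
  rewrite -/h; set a := E h; set b := Ek k h => h1.
  rewrite -(subrK (2 *: (a - b)) (mu a a - mu b b)).
  apply: (le_trans (ler_normD _ _)); rewrite normrZ ger0_norm//.
  have v0 := normr_ge0 (a - b).
  rewrite -/a -/b in hk; set v := `|a - b| in h1 hk v0 *.
  have : A * `|x| * v <= v by rewrite ler_piMl//; lra.
  lra.
exact: cvg_unique cT cT2.
Qed.

Lemma near_id_dist rho E : near_id rho E -> rho * 4 * A <= 1 ->
  forall x y, `|x| <= rho -> `|y| <= rho -> `|E x - E y - (x - y)| <= 2^-1 * `|x - y|.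
Proof.
move=> [E0 h] rA x y xr yr; apply: le_trans (h _ _ _ xr yr (lexx _)) _.
by rewrite ler_wpM2r//; lra.
Qed.

Lemma near_id_inj rho E : near_id rho E -> rho * 4 * A <= 1 ->
  forall x y, `|x| <= rho -> `|y| <= rho -> E x = E y -> x = y.
Proof.
move=> hE rA x y xr yr Exy; have := near_id_dist hE rA xr yr.
rewrite Exy subrr sub0r normrN => h.
apply/eqP; rewrite -subr_eq0 -normr_le0; have := normr_ge0 (x - y); lra.
Qed.

End LocalExp.

(** * The group law in the chart at 1 *)

Section LocalGroup.
Context {R : realType} {n : nat} (G : lieGroup R n).
Let V := 'rV[R]_n.
Local Notation phi := (@chart1 R n G).

Definition base : V := coord phi 1%g.
(** Only the coordinate recentred at 1, not the logarithm: the exponential is a further map [E]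
    composed with its inverse [pt]. *)
Definition lg (x : G) : V := coord phi x - base.
Definition pt (v : V) : G := point phi (base + v).
Definition lmul (x y : V) : V := lg (pt x * pt y)%g.

Lemma coord_point p (u : V) : chart_img (chart_at p : chart R n G) u ->
  chart_dom (chart_at p) (point (chart_at p) u) /\ coord (chart_at p) (point (chart_at p) u) = u.
Proof. by move=> [x dx <-]; rewrite coordK. Qed.

Lemma dom1 : chart_dom phi 1%g. Proof. exact: mem_chart_at. Qed.

Lemma img_base : chart_img phi base. Proof. by exists 1%g => //; exact: dom1. Qed.

Lemma pt0 : pt 0 = 1%g.
Proof. by rewrite /pt addr0 /base coordK//; exact: dom1. Qed.

Lemma lg1 : lg 1%g = 0. Proof. by rewrite /lg subrr. Qed.

Lemma lgK x : chart_dom phi x -> pt (lg x) = x.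
Proof. by move=> dx; rewrite /pt /lg addrC subrK coordK. Qed.

Lemma near_base (P : set V) : nbhs base P -> \forall v \near (0 : V), P (base + v).
Proof.
move=> /nbhs_normE[r r0 h]; apply/nbhs_normE; exists r => // y; rewrite subr0 => yr.
by apply: h; rewrite addrC addKr.
Qed.

Lemma ptK : \forall v \near (0 : V), chart_dom phi (pt v) /\ lg (pt v) = v.
Proof.
have : \forall v \near (0 : V), chart_img phi (base + v).
  apply: near_base; apply: open_nbhs_nbhs; split; [exact: open_chart_img|exact: img_base].
apply: filterS => v /coord_point [d e]; split => //.
by rewrite /lg /pt e addrC addKr.
Qed.

Lemma pt_continuous0 : {for 0, continuous pt}.
Proof.
move=> B; rewrite pt0 => B1; apply: (near_base (P := fun u => B (point phi u))).
have := @point_continuous _ _ _ phi base img_base.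
have e : point phi base = 1%g by rewrite /base coordK//; exact: dom1.
by move=> h; apply: h; rewrite e.
Qed.

Lemma mulg_near (x y : G) (B : set G) : nbhs (x * y)%g B ->
  exists2 U : set G * set G, nbhs x U.1 /\ nbhs y U.2 &
    forall x' y', U.1 x' -> U.2 y' -> B (x' * y')%g.
Proof.
move=> hB; have := @mul_continuous G (x, y) B hB.
move=> [[U1 U2] /= [h1 h2] h]; exists (U1, U2) => // x' y' hx hy.
exact: (h (x', y')).
Qed.

Lemma cvg_mulg (T : Type) (F : set_system T) (FF : Filter F) (f g : T -> G) (x y : G) :
  f @ F --> x -> g @ F --> y -> (fun t => f t * g t)%g @ F --> (x * y)%g.
Proof.
move=> fx gy B /mulg_near[[U1 U2] /= [h1 h2] h].
have F1 : F [set t | U1 (f t)] := fx _ h1; have F2 : F [set t | U2 (g t)] := gy _ h2.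
by apply: (@filterS _ F _ _ [set t | B (f t * g t)%g] _ (filterI F1 F2)) => t [a b]; exact: h.
Qed.

Let m (p : V * V) : V := coord phi (point phi p.1 * point phi p.2)%g.
Let D := [set u : V * V | [/\ chart_img phi u.1, chart_img phi u.2 &
             chart_dom phi (point phi u.1 * point phi u.2)%g]].

Lemma open_mul_dom : open D.
Proof.
rewrite openE => -[u v] /= [hu hv huv].
have hn : nbhs (u, v) [set q : V * V | chart_img phi q.1 /\ chart_img phi q.2].
  apply: filterI.
    apply: (cvg_fst (F := nbhs u) (G := nbhs v)).
    by apply: open_nbhs_nbhs; split => //; exact: open_chart_img.
  apply: (cvg_snd (F := nbhs u) (G := nbhs v)).
  by apply: open_nbhs_nbhs; split => //; exact: open_chart_img.
have hm : nbhs (u, v) [set q : V * V | chart_dom phi (point phi q.1 * point phi q.2)%g].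
  apply: (@cvg_mulg _ (nbhs (u, v)) _ (fun q => point phi q.1) (fun q => point phi q.2)
     (point phi u) (point phi v)).
  - apply: (cvg_comp _ _ (@cvg_fst _ _ (nbhs u) (nbhs v) _)); exact: point_continuous.
  - apply: (cvg_comp _ _ (@cvg_snd _ _ (nbhs u) (nbhs v) _)); exact: point_continuous.
  - by apply: open_nbhs_nbhs; split => //; exact: open_chart_dom.
by apply: (@filterS _ (nbhs (u, v)) _ _ D _ (filterI hn hm)) => q [[? ?] ?]; split.
Qed.

Lemma mul_dom_base : D (base, base).
Proof.
have e : point phi base = 1%g by rewrite /base coordK//; exact: dom1.
by split; rewrite /= ?e ?mulg1; [exact: img_base|exact: img_base|exact: dom1].
Qed.

Lemma is_derive_near (W : normedModType R) (f g : R -> W) (t : R) f' g' :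
  is_derive t (1 : R) f f' -> is_derive t (1 : R) g g' -> (\forall s \near t, f s = g s) -> f' = g'.
Proof.
move=> df dg fg; rewrite -(derive_val (f := f) (df := f')) -(derive_val (f := g) (df := g')).
apply: near_eq_derive => //; exact: oner_neq0.
Qed.

(** Multiplication by 1 on either side is the identity, so both partial differentials at (1, 1) are
    the identity. *)
Lemma diff_mul_base x y : 'd m (base, base) (x, y) = x + y.
Proof.
have e : point phi base = 1%g by rewrite /base coordK//; exact: dom1.
have dm : differentiable m (base, base).
  by have [] := @mul_smooth _ _ G 1%g 1%g 1%g 1%N; move=> h _; apply: h; exact: mul_dom_base.
have imgn (z : V) : \forall t \near (0 : R), chart_img phi (base + t *: z).
  have c : {for 0, continuous (fun t : R => base + t *: z)}.
    apply: differentiable_continuous; apply/derivable1_diffP.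
    exact: (@ex_derive _ _ _ _ _ _ _ (is_derive_line base z 0)).
  apply: c; rewrite scale0r addr0.
  by apply: open_nbhs_nbhs; split; [exact: open_chart_img|exact: img_base].
have line (v : V * V) : is_derive (0 : R) (1 : R) (m \o (fun t => (base, base) + t *: v)) ('d m (base, base) v).
  have := is_derive_comp_diff (is_derive_line (base, base) v 0) (f := m).
  by rewrite scale0r addr0; apply.
have -> : (x, y) = (x, 0) + (0, y) :> V * V.
  by rewrite [RHS]surjective_pairing /=; congr pair; rewrite ?addr0 ?add0r.
rewrite linearD; congr (_ + _).
  apply: (is_derive_near (line _) (is_derive_line base x 0)).
  have := imgn x; apply: filterS => t ht.
  by rewrite /m /= scaler0 addr0 e mulg1; apply: (coord_point ht).2.
apply: (is_derive_near (line _) (is_derive_line base y 0)).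
have := imgn y; apply: filterS => t ht.
by rewrite /m /= scaler0 addr0 e mul1g; apply: (coord_point ht).2.
Qed.

(** [C2_strict] for the product at (1, 1), where the linear part is the addition. A free bound [M]
    in place of the exact maximum makes the estimate easier to iterate. *)
Lemma local_group : exists r0 A : R, [/\ 0 < r0, 0 < A,
  forall v, `|v| < r0 -> chart_dom phi (pt v) /\ lg (pt v) = v,
  forall x y, `|x| < r0 -> `|y| < r0 -> pt (lmul x y) = (pt x * pt y)%g &
  forall x y x' y' M D, `|x| <= M -> `|y| <= M -> `|x'| <= M -> `|y'| <= M ->
  M < r0 -> `|x - x'| <= D -> `|y - y'| <= D ->
  `|lmul x y - lmul x' y' - ((x + y) - (x' + y'))| <= A * M * D].
Proof.
have [r [A [r00 A0 h]]] := C2_strict open_mul_dom mul_dom_base (@mul_smooth _ _ G 1%g 1%g 1%g 2%N).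
have /nbhs_normE[r1 r10 h1] := ptK.
exists (Num.min r r1), A; split => //.
- by rewrite lt_min r00.
- by move=> v; rewrite lt_min => /andP[_ v1]; apply: h1; rewrite subr0.
- move=> x y; rewrite !lt_min => /andP[xr _] /andP[yr _].
  apply: lgK; have := h (base + x, base + y) (base + x, base + y).
  have -> : (base + x, base + y) - (base, base) = (x, y) :> V * V.
    by rewrite [LHS]surjective_pairing /= /pt; congr pair; rewrite addrC addKr.
  by rewrite prod_normE gt_max xr yr => /(_ isT isT)[[]].
move=> x y x' y' M D0 xM yM x'M y'M Mr xx' yy'.
have D00 : 0 <= D0 by apply: le_trans xx'.
have M0 : 0 <= M by apply: le_trans xM.
have sub (a b : V) : (base + a, base + b) - (base, base) = (a, b) :> V * V.
  by rewrite [LHS]surjective_pairing /=; congr pair; rewrite addrC addKr.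
have sub2 : (base + x, base + y) - (base + x', base + y') = (x - x', y - y') :> V * V.
  by rewrite [LHS]surjective_pairing /=; congr pair; rewrite opprD addrACA subrr add0r.
have := h (base + x, base + y) (base + x', base + y').
rewrite !sub sub2 !prod_normE /= diff_mul_base.
have Mr' : M < r by apply: lt_le_trans Mr _; rewrite ge_min lexx.
have lr z : `|z : V| <= M -> `|z| < r by move=> zM; apply: le_lt_trans Mr'.
rewrite !gt_max !lr// => /(_ isT isT)[_].
have -> : m (base + x, base + y) - m (base + x', base + y') = lmul x y - lmul x' y'.
  by rewrite /lmul /lg opprB addrA subrK.
have -> : x + y - (x' + y') = x - x' + (y - y') by rewrite opprD addrACA.
move=> /le_trans; apply.
apply: ler_pM => //; rewrite ?mulr_ge0 ?(ltW A0)//.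
- by rewrite ler_wpM2l ?(ltW A0)// !ge_max xM yM x'M y'M.
- by rewrite ge_max xx' yy'.
Qed.

Lemma lmul00 : lmul 0 0 = 0.
Proof. by rewrite /lmul pt0 mulg1 lg1. Qed.

End LocalGroup.

(** * The exponential map by dyadic scaling *)

Section Exponential.
Context {R : realType} {n : nat} (G : lieGroup R n).
Let V := 'rV[R]_n.
Local Notation phi := (@chart1 R n G).
Local Notation lg := (@lg R n G).
Local Notation pt := (@pt R n G).

(* [E] is the exponential map read in the chart around 1. *)
Record local_exp (rho A : R) (E : V -> V) : Prop := LocalExp {
  le_rho : 0 < rho ;
  le_A : 0 < A ;
  le_rhoA : rho * 4 * A <= 1 ;
  le_ptK : forall v, `|v| <= 2 * rho -> chart_dom phi (pt v) /\ lg (pt v) = v ;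
  le_mul : forall x y, `|x| <= 2 * rho -> `|y| <= 2 * rho -> pt (lmul G x y) = (pt x * pt y)%g ;
  le_strict : forall x y x' y' M D, `|x| <= M -> `|y| <= M -> `|x'| <= M -> `|y'| <= M ->
    M <= 2 * rho -> `|x - x'| <= D -> `|y - y'| <= D ->
    `|lmul G x y - lmul G x' y' - ((x + y) - (x' + y'))| <= A * M * D ;
  le_near_id : near_id A rho E ;
  le_square : forall x, `|x| <= rho -> E x = lmul G (E (2^-1 *: x)) (E (2^-1 *: x)) }.

Lemma exists_local_exp : exists rho A E, local_exp rho A E.
Proof.
have [r0 [A [r00 A0 h1 h2 h3]]] := local_group G.
have r20 : 0 < r0 / 2 by rewrite divr_gt0.
(* Starting from [r0 / 2] leaves room for norms up to [2 * rho], the bound for the values of [E] on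
   the ball of radius [rho]. *)
have [||rho [E [rho0 rhoA rhor hE1 hE2]]] := @local_exp_exists R n (lmul G) (r0 / 2) A A0 r20.
- exact: lmul00.
- move=> x y x' y' M D ? ? ? ? Mr; apply: h3 => //; lra.
exists rho, A, E; split => //.
- by move=> v vr; apply: h1; lra.
- by move=> x y xr yr; apply: h2; lra.
- by move=> x y x' y' M D ? ? ? ? Mr; apply: h3 => //; lra.
Qed.

Context {rho A : R} {E : V -> V} (L : local_exp rho A E).

Definition lexp (x : V) : G := pt (E x).
Definition gsq (g : G) : G := (g * g)%g.

Lemma le_dist x y : `|x| <= rho -> `|y| <= rho -> `|E x - E y - (x - y)| <= 2^-1 * `|x - y|.
Proof. exact: (near_id_dist (le_near_id L) (le_rhoA L)). Qed.

Lemma E0 : E 0 = 0. Proof. exact: (le_near_id L).1. Qed.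

Lemma E_norm x : `|x| <= rho -> `|E x| <= 2 * `|x|.
Proof.
move=> xr; have := le_dist xr (y := 0); rewrite normr0 E0 !subr0 => /(_ (ltW (le_rho L))) h.
rewrite -(subrK x (E x)); apply: (le_trans (ler_normD _ _)); have := normr_ge0 x; lra.
Qed.

Lemma lexp_dom x : `|x| <= rho -> chart_dom phi (lexp x) /\ lg (lexp x) = E x.
Proof. by move=> xr; apply: (le_ptK L); have := E_norm xr; lra. Qed.

Lemma lexp_inj x y : `|x| <= rho -> `|y| <= rho -> lexp x = lexp y -> x = y.
Proof.
move=> xr yr h; apply: (near_id_inj (le_near_id L) (le_rhoA L)) => //.
by rewrite -(lexp_dom xr).2 -(lexp_dom yr).2 h.
Qed.

Lemma half_norm (x : V) : `|2^-1 *: x| = `|x| / 2.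
Proof. by rewrite normrZ ger0_norm ?invr_ge0// mulrC. Qed.

Lemma lexp_half x : `|x| <= rho -> lexp x = gsq (lexp (2^-1 *: x)).
Proof.
move=> xr; have x0 := normr_ge0 x.
rewrite /lexp (le_square L xr) (le_mul L)//; have := @E_norm (2^-1 *: x); rewrite half_norm => h;
 have := h ltac:(lra); lra.
Qed.

Lemma E_surj z : 2 * `|z| <= rho -> exists2 y, `|y| <= 2 * `|z| & E y = z.
Proof. by move=> zr; apply: (near_id_surj _ E0 zr) => x y; exact: le_dist. Qed.

Lemma lexp_surj g : chart_dom phi g -> 2 * `|lg g| <= rho ->
  exists2 y, `|y| <= 2 * `|lg g| & lexp y = g.
Proof. by move=> dg /E_surj[y yr Ey]; exists y => //; rewrite /lexp Ey lgK. Qed.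

(** Velocity at 0 of a curve through 1, as an explicit estimate: it contains the passage through 1
    and continuity at 0, and asks nothing of the curve away from 0. *)
Definition tangent (c : R -> G) (X : V) := forall e : R, 0 < e ->
  \forall t \near (0 : R), chart_dom phi (c t) /\ `|lg (c t) - t *: X| <= e * `|t|.

Definition scale_pow k (X : V) := (2^-1 : R) ^+ k *: X.

Lemma scale_powS k X : scale_pow k.+1 X = 2^-1 *: scale_pow k X.
Proof. by rewrite /scale_pow exprS scalerA. Qed.

Lemma scale_pow_norm k X : `|scale_pow k X| = 2^-1 ^+ k * `|X|.
Proof. by rewrite normrZ normrX ger0_norm// invr_ge0. Qed.

Lemma iter_lexp j x : `|x| <= rho -> iter j gsq (lexp (scale_pow j x)) = lexp x.
Proof.
move=> xr; elim: j => [|j IH]; first by rewrite /scale_pow expr0 scale1r.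
rewrite iterSr scale_powS -lexp_half// scale_pow_norm.
by apply: le_trans xr; rewrite ler_piMl// exprn_ile1// ?invr_ge0//; lra.
Qed.

(** The local exponential extended by squaring N times from [2^-N X]. Any N that brings the argument
    into the small ball gives the same value, see [expoE]. *)
Definition expo (X : V) : G :=
  let N := Num.bound (`|X| / rho) in iter N gsq (lexp (scale_pow N X)).

Lemma expo_bound X : `|scale_pow (Num.bound (`|X| / rho)) X| <= rho.
Proof.
rewrite scale_pow_norm; set N := Num.bound _.
have := @archi_boundP R (`|X| / rho) ltac:(by rewrite divr_ge0// ltW// (le_rho L)).
rewrite -/N ltr_pdivrMr ?(le_rho L)// => h.
have h2 : N%:R <= 2 ^+ N :> R by rewrite -natrX ler_nat ltnW// ltn_expl.
rewrite exprVn mulrC ler_pdivrMr ?exprn_gt0// mulrC.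
by apply: le_trans (ltW h) _; rewrite ler_wpM2r// ltW// (le_rho L).
Qed.

Lemma expoE N X : `|scale_pow N X| <= rho -> expo X = iter N gsq (lexp (scale_pow N X)).
Proof.
have key (M K : nat) : (M <= K)%N -> `|scale_pow M X| <= rho ->
   iter M gsq (lexp (scale_pow M X)) = iter K gsq (lexp (scale_pow K X)).
  move=> MK hM; rewrite -(subnKC MK) iterD; congr (iter _ _ _).
  rewrite -[LHS](iter_lexp (K - M) hM); congr (iter _ _ (lexp _)).
  by rewrite /scale_pow scalerA addnC exprD.
move=> hN; rewrite /expo; set M := Num.bound _.
have hM : `|scale_pow M X| <= rho by exact: expo_bound.
by case/orP: (leq_total M N) => h; [rewrite (key _ _ h)|rewrite (key _ _ h hN)].
Qed.

Lemma expo_lexp x : `|x| <= rho -> expo x = lexp x.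
Proof.
by move=> xr; rewrite (@expoE 0) /scale_pow expr0 scale1r.
Qed.

Lemma expo_half X : expo X = gsq (expo (2^-1 *: X)).
Proof.
have h := expo_bound X; set N := Num.bound _ in h.
rewrite (expoE h) (@expoE N) /scale_pow; last first.
  rewrite -/(scale_pow _ _) scale_pow_norm half_norm; rewrite scale_pow_norm in h.
  have : 0 <= 2^-1 ^+ N * `|X| by rewrite mulr_ge0// exprn_ge0// invr_ge0.
  lra.
rewrite -iterS iterSr; congr (iter _ _ _).
rewrite lexp_half//; congr gsq; congr lexp.
by rewrite /scale_pow !scalerA mulrC.
Qed.

Lemma near_pow2 (P : R -> Prop) : (\forall t \near (0 : R), P t) ->
  exists K, forall k, (K <= k)%N -> P (2^-1 ^+ k).
Proof.
move=> h; have := @cvg_expr R 2^-1; rewrite ger0_norm ?invr_ge0// => /(_ ltac:(lra)) cv.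
by have [K _ hK] := cv _ h; exists K => k kK; exact: hK.
Qed.

Lemma pow2_gt0 k : 0 < (2^-1 : R) ^+ k. Proof. by rewrite exprn_gt0. Qed.

(* In the logarithmic coordinate [y] squaring is exact doubling, so the
   rescaled logarithm is constant along the sequence and equals the velocity. *)
Lemma expo_unique c X : tangent c X -> (forall k, c (2^-1 ^+ k) = gsq (c (2^-1 ^+ k.+1))) ->
  c 1 = expo X.
Proof.
move=> tc sc; have A0 := le_A L; have r0 := le_rho L.
pose B := `|X| + 1; have B0 : 0 < B by rewrite ltr_wpDl.
have near_small (e : R) : 0 < e -> \forall t \near (0 : R), `|t| <= e.
  by move=> e0; apply/nbhs_normE; exists e => // y; rewrite subr0 => /ltW.
have [K hK] : exists K, forall k, (K <= k)%N -> exists y, [/\ lexp y = c (2^-1 ^+ k),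
    `|y| <= rho / 2 & `|y| <= 2 * B * 2^-1 ^+ k].
  have := near_pow2 (filterI (tc _ ltr01) (near_small (rho / (4 * B)) ltac:(by rewrite divr_gt0// mulr_gt0))).
  move=> [K hK]; exists K => k /hK[[dc h1] h2].
  have t0 := pow2_gt0 k; set t := _ ^+ k in t0 h1 h2 dc *.
  rewrite (ger0_norm (ltW t0)) in h1 h2; rewrite ler_pdivlMr ?mulr_gt0// in h2.
  have lB : `|lg (c t)| <= B * t.
    rewrite -(subrK (t *: X) (lg _)); apply: (le_trans (ler_normD _ _)).
    by rewrite normrZ (ger0_norm (ltW t0)) /B mulrDl addrC [t * _]mulrC lerD.
  have [|y hy1 hy2] := lexp_surj dc; first by lra.
  by exists y; split => //; lra.
pose y k := xget 0 [set y | [/\ lexp y = c (2^-1 ^+ k), `|y| <= rho / 2 & `|y| <= 2 * B * 2^-1 ^+ k]].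
have hy k : (K <= k)%N -> [/\ lexp (y k) = c (2^-1 ^+ k), `|y k| <= rho / 2 & `|y k| <= 2 * B * 2^-1 ^+ k].
  by move=> /hK ex; exact: (xgetPex 0 ex).
(* Both [2 *: y k.+1] and [y k] are logarithms of [c (2^-k)]; the bound [rho / 2] keeps the doubled
   vector within the injectivity radius. *)
have y2 k : (K <= k)%N -> y k.+1 = 2^-1 *: y k.
  move=> kK; have [h1 h2 _] := hy _ kK; have [h3 h4 _] := hy _ (leqW kK).
  have n2 : `|2 *: y k.+1| = 2 * `|y k.+1| by rewrite normrZ ger0_norm.
  have : lexp (2 *: y k.+1) = lexp (y k).
    rewrite lexp_half; last by rewrite n2; lra.
    by rewrite scalerA mulVf ?pnatr_eq0// scale1r h3 h1 -sc.
  move=> h; have <- : 2 *: y k.+1 = y k.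
    by apply: lexp_inj h; [rewrite n2; lra|have := normr_ge0 (y k); lra].
  by rewrite scalerA mulVf ?pnatr_eq0// scale1r.
have yj j : y (K + j)%N = scale_pow j (y K).
  elim: j => [|j IH]; first by rewrite addn0 /scale_pow expr0 scale1r.
  by rewrite addnS y2 ?leq_addr// IH scale_powS.
(* At time t = 2^-(K+j) the logarithm differs from tX by at most e t. This difference is exactly
   2^-j times [y K - scale_pow K X], so scaling back leaves a bound e 2^-K <= e. *)
have yK : y K = scale_pow K X.
  apply/eqP; rewrite -subr_eq0 -normr_le0; apply/ler_addgt0Pl => e e0; rewrite addr0.
  have e2 : 0 < e / 2 by lra.
  (* For t below this value the quadratic error 2A(2Bt)^2 = 8AB^2 t^2 of [E] is at most e t / 2, the
     other half being the error of the velocity. *)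
  have C0 : 0 < e / (16 * A * B ^+ 2) by rewrite divr_gt0// !mulr_gt0// exprn_gt0.
  have [K' hK'] := near_pow2 (filterI (tc _ e2) (near_small _ C0)).
  have [j jK] : exists j, (K' <= K + j)%N by exists K'; rewrite leq_addl.
  have [[dc h1] h2] := hK' _ jK.
  have t0 := pow2_gt0 (K + j); set t := _ ^+ (K + j) in t0 h1 h2 dc *.
  have [h3 h4 h5] := hy (K + j)%N (leq_addr _ _); rewrite -/t in h3 h5.
  set z := y (K + j)%N in h3 h4 h5.
  rewrite (ger0_norm (ltW t0)) in h1 h2.
  have zr : `|z| <= rho by have := normr_ge0 z; lra.
  have h6 : `|E z - z| <= 2 * A * `|z| ^+ 2.
    have := (le_near_id L).2 z 0 `|z|; rewrite normr0 E0 !subr0.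
    by rewrite expr2 mulrA; apply.
  rewrite -h3 (lexp_dom zr).2 in h1.
  have zt : `|z - t *: X| <= e * t.
    have -> : z - t *: X = (E z - t *: X) - (E z - z) by apply/rowP => i; rewrite !mxE; ring.
    apply: (le_trans (ler_normB _ _)).
    have : `|z| ^+ 2 <= (2 * B * t) ^+ 2 by rewrite lerXn2r// nnegrE// !mulr_ge0// ltW.
    rewrite ler_pdivlMr in h2; last by rewrite !mulr_gt0// exprn_gt0.
    move=> h7; have h8 : 2 * A * `|z| ^+ 2 <= 2 * A * (2 * B * t) ^+ 2.
      by rewrite ler_wpM2l// mulr_ge0// ltW.
    have : t * (t * (16 * A * B ^+ 2)) <= t * e by rewrite ler_wpM2l// ltW.
    have -> : t * (t * (16 * A * B ^+ 2)) = 2 * (2 * A * (2 * B * t) ^+ 2) by ring.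
    lra.
  have Ez : z - t *: X = 2^-1 ^+ j *: (y K - scale_pow K X).
    by rewrite /z yj scalerBr /scale_pow scalerA -exprD addnC.
  have Et : t = 2^-1 ^+ K * 2^-1 ^+ j by rewrite -exprD.
  rewrite Ez normrZ (ger0_norm (ltW (pow2_gt0 j))) Et in zt.
  have k1 : (2^-1 : R) ^+ K <= 1 by rewrite exprn_ile1// ?invr_ge0//; lra.
  have : 2^-1 ^+ j * `|y K - scale_pow K X| <= 2^-1 ^+ j * e.
    apply: (le_trans zt); rewrite mulrCA -[leRHS]mul1r [_ * e]mulrC ler_wpM2r//.
    by rewrite ltW// mulr_gt0// pow2_gt0.
  by rewrite ler_pM2l// pow2_gt0.
have [h1 h2 _] := hy K (leqnn K).
have Kr : `|scale_pow K X| <= rho by rewrite -yK; have := normr_ge0 (y K); lra.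
rewrite (expoE Kr) -yK h1.
have it j : c 1 = iter j gsq (c (2^-1 ^+ j)).
  by elim: j => [|j IH]; [rewrite expr0|rewrite iterSr -sc].
exact: it.
Qed.

End Exponential.

(** * Differentials of maps of the group *)

Section DiffNear.
Context {R : realType}.
Lemma diff_near_eq (V W : normedModType R) (f g : V -> W) x :
  (\forall y \near x, f y = g y) -> differentiable g x ->
  differentiable f x /\ 'd f x = 'd g x :> (V -> W).
Proof.
move=> fg dg; have fgx : f x = g x by exact: nbhs_singleton fg.
have h : f \o shift x = cst (f x) + 'd g x +o_ 0 id.
  apply/eqaddoP => e e0; have /eqaddoP /(_ e e0) := diff_locally dg.
  have fg0 : \forall y \near (0 : V), f (y + x) = g (y + x).
    move/nbhs_normE : fg => [r r0 hr]; apply/nbhs_normE; exists r => // y.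
    by rewrite subr0 => yr; apply: hr; rewrite addrK.
  apply: filterS2 fg0 => y Ey.
  by rewrite !fctE /= Ey fgx.
have cg := diff_continuous dg.
have E : 'd f x = 'd g x :> (V -> W) by apply: diff_unique.
by split => //; apply/diff_locallyP; rewrite E.
Qed.
End DiffNear.

Section GroupCalculus.
Context {R : realType} {n : nat} (G : lieGroup R n).
Let V := 'rV[R]_n.
Local Notation phi := (@chart1 R n G).
Local Notation lg := (@lg R n G).
Local Notation pt := (@pt R n G).
Local Notation base := (base G).

Lemma point_base : point phi base = 1%g.
Proof. by rewrite /base coordK//; exact: dom1. Qed.

Definition gdiff (f : G -> G) (p : G) := {for p, continuous f} /\
  differentiable (coord (chart_at (f p)) \o f \o point (chart_at p)) (coord (chart_at p) p).

Lemma img_coord (p : G) : chart_img (chart_at p) (coord (chart_at p) p).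
Proof. by exists p => //; exact: mem_chart_at. Qed.

Lemma point_coord (p : G) : point (chart_at p) (coord (chart_at p) p) = p.
Proof. by rewrite coordK//; exact: mem_chart_at. Qed.

Lemma near_img (p : G) : \forall u \near coord (chart_at p) p, chart_img (chart_at p) u.
Proof.
by apply: open_nbhs_nbhs; split; [exact: open_chart_img|exact: img_coord].
Qed.

Lemma near_point (p : G) (P : set G) : nbhs p P ->
  \forall u \near coord (chart_at p) p, P (point (chart_at p) u).
Proof.
by move=> hP; apply: (point_continuous (img_coord p)); rewrite point_coord.
Qed.

Lemma near_dom (p : G) : nbhs p (chart_dom (chart_at p)).
Proof. by apply: open_nbhs_nbhs; split; [exact: open_chart_dom|exact: mem_chart_at]. Qed.

Lemma gdiff_comp (f g : G -> G) p : gdiff f p -> gdiff g (f p) ->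
  gdiff (g \o f) p /\
  'd (coord (chart_at (g (f p))) \o (g \o f) \o point (chart_at p)) (coord (chart_at p) p) =
  'd (coord (chart_at (g (f p))) \o g \o point (chart_at (f p))) (coord (chart_at (f p)) (f p)) \o
  'd (coord (chart_at (f p)) \o f \o point (chart_at p)) (coord (chart_at p) p) :> (V -> V).
Proof.
move=> [cf df] [cg dg].
set F := _ \o f \o _ in df; set H := _ \o g \o _ in dg.
have Fp : F (coord (chart_at p) p) = coord (chart_at (f p)) (f p).
  by rewrite /F /= point_coord.
have dgF : differentiable H (F (coord (chart_at p) p)) by rewrite Fp.
have [] := @diff_near_eq R V V (coord (chart_at (g (f p))) \o (g \o f) \o point (chart_at p)) (H \o F) (coord (chart_at p) p).
- have : nbhs p [set x | chart_dom (chart_at (f p)) (f x)] by apply: cf; exact: near_dom.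
  move/near_point; apply: filterS => u hu.
  by rewrite /F /H /= coordK.
- exact: (differentiable_comp df dgF).
move=> d1 d2; split.
  by split; [exact: (continuous_comp cf cg)|exact: d1].
apply: (etrans d2); apply: (etrans (diff_comp df dgF)).
by rewrite Fp.
Qed.

Lemma gdiff_lmul (x p : G) : gdiff (fun y => x * y)%g p.
Proof.
split.
  by apply: cvg_mulg; [exact: cvg_cst|exact: cvg_id].
have [] := @mul_smooth _ _ G x p (x * p)%g 1%N.
move=> /(_ (coord (chart_at x) x, coord (chart_at p) p)) h _.
have {}h := h ltac:(by split => /=; [exact: img_coord|exact: img_coord|rewrite !point_coord; exact: mem_chart_at]).
have dp : differentiable (fun u : V => (coord (chart_at x) x, u)) (coord (chart_at p) p).
  by apply: differentiable_pair.
have -> : coord (chart_at (x * p)%g) \o (fun y => x * y)%g \o point (chart_at p) =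
  (fun u : V * V => coord (chart_at (x * p)%g) (point (chart_at x) u.1 * point (chart_at p) u.2)%g) \o
  (fun u => (coord (chart_at x) x, u)).
  by apply/funext => u /=; rewrite point_coord.
exact: (differentiable_comp dp h).
Qed.

Lemma gdiff_rmul (x p : G) : gdiff (fun y => y * x)%g p.
Proof.
split.
  by apply: cvg_mulg; [exact: cvg_id|exact: cvg_cst].
have [] := @mul_smooth _ _ G p x (p * x)%g 1%N.
move=> /(_ (coord (chart_at p) p, coord (chart_at x) x)) h _.
have {}h := h ltac:(by split => /=; [exact: img_coord|exact: img_coord|rewrite !point_coord; exact: mem_chart_at]).
have dp : differentiable (fun u : V => (u, coord (chart_at x) x)) (coord (chart_at p) p).
  by apply: differentiable_pair.
have -> : coord (chart_at (p * x)%g) \o (fun y => y * x)%g \o point (chart_at p) =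
  (fun u : V * V => coord (chart_at (p * x)%g) (point (chart_at p) u.1 * point (chart_at x) u.2)%g) \o
  (fun u => (u, coord (chart_at x) x)).
  by apply/funext => u /=; rewrite point_coord.
exact: (differentiable_comp dp h).
Qed.

Definition diff1 (f : G -> G) := f 1%g = 1%g /\ gdiff f 1%g.

Lemma diff1E f : diff1 f -> differentiable (coord phi \o f \o point phi) base.
Proof. by move=> [f1 [_]]; rewrite f1. Qed.

Lemma tangent_map_comp f g : diff1 f -> diff1 g ->
  diff1 (f \o g) /\ tangent_map (f \o g) = tangent_map f \o tangent_map g :> (V -> V).
Proof.
move=> [f1 df] [g1 dg]; have dfg : gdiff f (g 1%g) by rewrite g1.
have [h1 h2] := gdiff_comp dg dfg.
split; first by split; rewrite /= ?g1.
by move: h2; rewrite g1 f1.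
Qed.

Lemma tangent_map_linear (f : G -> G) : linear (tangent_map f : V -> V).
Proof. by move=> a u v; rewrite /tangent_map linearP. Qed.

Lemma tangent_mapZ (f : G -> G) a (u : V) : tangent_map f (a *: u) = a *: tangent_map f u.
Proof. by rewrite /tangent_map linearZ. Qed.

Lemma tangent_mapD (f : G -> G) (u v : V) : tangent_map f (u + v) = tangent_map f u + tangent_map f v.
Proof. by rewrite /tangent_map linearD. Qed.

Lemma diff1_conj (x : G) : diff1 (fun y => x * y * x^-1)%g.
Proof.
split; first by rewrite mulg1 mulgV.
exact: (gdiff_comp (gdiff_lmul x 1%g) (gdiff_rmul x^-1%g _)).1.
Qed.

Lemma smooth_diff1 f : smooth_map f -> f 1%g = 1%g -> diff1 f.
Proof.
move=> [cf sf] f1; split => //; split; first exact: cf.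
have [h _] := sf 1%g (f 1%g) 1%N; apply: h; split; first exact: img_coord.
by rewrite point_coord; exact: mem_chart_at.
Qed.

Lemma tangent_map_id : tangent_map (@id G) = idfun :> (V -> V).
Proof.
have [] := @diff_near_eq R V V (coord phi \o id \o point phi) idfun base.
- by have := near_img 1%g; apply: filterS => u /coord_point[].
- by apply: ex_diff.
move=> _ h; rewrite /tangent_map -/base [LHS]h; by rewrite diff_val.
Qed.

End GroupCalculus.

(** * One-parameter subgroups *)

Section OneParameter.
Context {R : realType} {n : nat} (G : lieGroup R n).
Let V := 'rV[R]_n.
Local Notation phi := (@chart1 R n G).
Local Notation lg := (@lg R n G).
Local Notation pt := (@pt R n G).
Local Notation base := (base G).
Local Notation tangent := (@tangent R n G).

Lemma tangent0 c X : tangent c X -> c 0 = 1%g.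
Proof.
move=> /(_ 1 ltr01) /nbhs_singleton [d]; rewrite normr0 mulr0 scale0r subr0 normr_le0.
by move/eqP => h; rewrite -(lgK d) h pt0.
Qed.

Lemma tangent_bound c X : tangent c X ->
  \forall t \near (0 : R), chart_dom phi (c t) /\ `|lg (c t)| <= (`|X| + 1) * `|t|.
Proof.
move=> /(_ 1 ltr01); apply: filterS => t [d h]; split => //.
rewrite -(subrK (t *: X) (lg _)); apply: (le_trans (ler_normD _ _)).
by rewrite normrZ mulrDl addrC [`|t| * _]mulrC lerD.
Qed.

Lemma near_and (T : topologicalType) (x : T) (P Q : T -> Prop) :
  (\forall y \near x, P y) -> (\forall y \near x, Q y) -> \forall y \near x, P y /\ Q y.
Proof. by move=> hP hQ; apply: filterS2 hP hQ. Qed.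

Lemma near_norm_le (e : R) : 0 < e -> \forall t \near (0 : R), `|t| <= e.
Proof. by move=> e0; apply/nbhs_normE; exists e => // y; rewrite subr0 => /ltW. Qed.

Lemma tangent_continuous c X : tangent c X -> {for 0, continuous c}.
Proof.
move=> tc; have c0 := tangent0 tc; move=> B; rewrite c0 => hB.
have := @pt_continuous0 _ _ G B; rewrite pt0 => /(_ hB) /nbhs_normE[r r0 hr].
have B0 : 0 < `|X| + 1 by rewrite ltr_wpDl.
suff : \forall t \near (0 : R), B (c t) by [].
have := near_and (tangent_bound tc) (@near_norm_le (r / (2 * (`|X| + 1))) ltac:(by rewrite divr_gt0// mulr_gt0)).
apply: filterS => t [[d h1] h2]; have := hr (lg (c t)); rewrite /= lgK// subr0; apply.
rewrite ler_pdivlMr ?mulr_gt0// in h2; lra.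
Qed.

Lemma tangent_uniq c X Y : tangent c X -> tangent c Y -> X = Y.
Proof.
move=> t1 t2; apply/eqP; rewrite -subr_eq0 -normr_le0; apply/ler_addgt0Pl => e e0; rewrite addr0.
have e2 : 0 < e / 2 by lra.
have [K hK] := near_pow2 (near_and (t1 _ e2) (t2 _ e2)).
have [[_ h1] [_ h2]] := hK K (leqnn K).
have p0 := @pow2_gt0 R K; set t := _ ^+ K in h1 h2 p0.
rewrite (ger0_norm (ltW p0)) in h1 h2.
rewrite -(ler_pM2l p0) -{1}(ger0_norm (ltW p0)) -normrZ scalerBr.
have -> : t *: X - t *: Y = (lg (c t) - t *: Y) - (lg (c t) - t *: X).
  by rewrite opprB [RHS]addrC subrKA.
apply: (le_trans (ler_normB _ _)); lra.
Qed.

Lemma tangent_comp f c X : diff1 f -> tangent c X -> tangent (f \o c) (tangent_map f X).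
Proof.
move=> df tc e e0; have [f1 [cf _]] := df; have dd := diff1E df.
have B0 : 0 < `|X| + 1 by rewrite ltr_wpDl.
have cc := tangent_continuous tc; have c0 := tangent0 tc.
have [k k0 hk] := linear_lipschitz (diff_continuous dd).
have ek : 0 < e / (2 * (`|X| + 1)) by rewrite divr_gt0// mulr_gt0.
have ek2 : 0 < e / (2 * k) by rewrite divr_gt0// mulr_gt0.
have h1 := diff_approx dd ek.
have h2 : \forall t \near (0 : R), chart_dom phi (f (c t)).
  apply: (continuous_comp cc); first by rewrite c0; exact: cf.
  by rewrite /= c0 f1; exact: near_dom.
have h3 : \forall t \near (0 : R), `|coord phi (f (point phi (coord phi (c t)))) - coord phi 1%g -
    'd (coord phi \o f \o point phi) base (coord phi (c t) - base)| <= e / (2 * (`|X| + 1)) * `|coord phi (c t) - base|.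
  have cg : {for 0, continuous (coord phi \o c)}.
    by apply: continuous_comp => //; rewrite c0; apply: coord_continuous; exact: dom1.
  have h1' : \forall u \near base, `|coord phi (f (point phi u)) - coord phi 1%g -
      'd (coord phi \o f \o point phi) base (u - base)| <= e / (2 * (`|X| + 1)) * `|u - base|.
    by move: h1; rewrite /= point_base f1.
  by have := cg _; rewrite /continuous_at /= c0 => /(_ _ h1').
have h4 := tc _ ek2; have h5 := tangent_bound tc.
have := near_and (near_and h2 h3) (near_and h4 h5); apply: filterS => t [[d1 a1] [[d2 a2] [_ a3]]].
split => //; rewrite /= coordK// -/base in a1.
rewrite -[coord phi (c t) - base]/(lg (c t)) in a1.
rewrite -[coord phi (f (c t)) - base]/(lg (f (c t))) in a1.
set T := 'd _ _ in a1 hk.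
have -> : lg ((f \o c) t) - t *: tangent_map f X = (lg (f (c t)) - T (lg (c t))) + T (lg (c t) - t *: X).
  have Tl (a b : V) s : T (a - s *: b) = T a - s *: T b by rewrite /T linearB linearZ.
  by rewrite Tl subrKA.
apply: (le_trans (ler_normD _ _)).
have b2 := hk (lg (c t) - t *: X).
have b1 : e / (2 * (`|X| + 1)) * `|lg (c t)| <= e / 2 * `|t|.
  have -> : e / 2 * `|t| = e / (2 * (`|X| + 1)) * ((`|X| + 1) * `|t|) by field; rewrite gt_eqF.
  by rewrite ler_wpM2l// ltW.
have b3 : k * `|lg (c t) - t *: X| <= e / 2 * `|t|.
  have -> : e / 2 * `|t| = k * (e / (2 * k) * `|t|) by field; rewrite gt_eqF.
  by rewrite ler_wpM2l// ltW.
have -> : e * `|t| = e / 2 * `|t| + e / 2 * `|t| by field.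
by apply: lerD; [exact: le_trans a1 b1|exact: le_trans b2 b3].
Qed.

Section Local.
Context {rho A : R} {E : V -> V} (L : local_exp G rho A E).
Local Notation expo := (@expo R n G rho E).
Local Notation lexp := (@lexp R n G E).
Local Notation gsq := (@gsq R n G).

(** Comparison with the pair (0, 0) in [le_strict] bounds [lmul a b - (a + b)] by A(B|t|)^2, which
    is o(t). *)
Lemma tangent_mul c d X Y : tangent c X -> tangent d Y -> tangent (fun t => c t * d t)%g (X + Y).
Proof.
move=> tc td e e0; have r0 := le_rho L; have A0 := le_A L.
pose B := `|X| + `|Y| + 1; have B0 : 0 < B by rewrite ltr_wpDl// addr_ge0.
have e4 : 0 < e / 4 by lra.
have s0 : 0 < Num.min (rho / (4 * B)) (e / (4 * A * B ^+ 2)).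
  by rewrite lt_min !divr_gt0// ?mulr_gt0// ?exprn_gt0//.
have s1 : 0 < rho / (A * rho + 1).
  by rewrite divr_gt0// ltr_wpDl// mulr_ge0// ltW.
have := near_and (near_and (tc _ e4) (td _ e4)) (near_and (near_and (tangent_bound tc) (tangent_bound td)) (near_norm_le s0)).
apply: filterS => t [[[d1 h1] [d2 h2]] [[[_ b1] [_ b2]]]].
rewrite le_min => /andP[s2 s3].
have t0 := normr_ge0 t.
have M1 : `|lg (c t)| <= B * `|t|.
  by apply: (le_trans b1); rewrite ler_wpM2r// /B; have := normr_ge0 Y; lra.
have M2 : `|lg (d t)| <= B * `|t|.
  by apply: (le_trans b2); rewrite ler_wpM2r// /B; have := normr_ge0 X; lra.
rewrite ler_pdivlMr ?mulr_gt0// in s2.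
rewrite ler_pdivlMr ?mulr_gt0 ?exprn_gt0// in s3.
set a := lg (c t) in M1 h1; set b := lg (d t) in M2 h2.
have BM : B * `|t| <= rho / 4 by lra.
have Em : (c t * d t)%g = pt (lmul G a b).
  by rewrite (le_mul L) ?lgK//; lra.
have := le_strict L M1 M2 (x' := 0) (y' := 0) (D := B * `|t|).
rewrite !normr0 !subr0 lmul00 addr0 !subr0 => /(_ _ _ _ M1 M2).
have Bt0 : 0 <= B * `|t| by rewrite mulr_ge0// ltW.
move=> /(_ Bt0 Bt0 ltac:(lra)) h.
have AB : A * (B * `|t|) * (B * `|t|) <= e / 4 * `|t|.
  have -> : A * (B * `|t|) * (B * `|t|) = (`|t| * (4 * A * B ^+ 2)) * `|t| / 4 by field.
  have := ler_wpM2r t0 s3; lra.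
have AM : A * (B * `|t|) <= 1.
  apply: (@le_trans _ _ (A * (rho / 4))); first by rewrite ler_wpM2l// ltW.
  have := le_rhoA L; nra.
have sz : `|lmul G a b| <= 2 * rho.
  rewrite -(subrK (a + b) (lmul G a b)); apply: (le_trans (ler_normD _ _)).
  have n1 := ler_normD a b.
  have h' : A * (B * `|t|) * (B * `|t|) <= B * `|t| by rewrite ler_piMl.
  lra.
have [dm lm] := le_ptK L sz.
rewrite Em; split => //; rewrite lm.
have -> : lmul G a b - t *: (X + Y) = (lmul G a b - (a + b)) + ((a - t *: X) + (b - t *: Y)).
  by rewrite scalerDr [(a - _) + _]addrACA -opprD addrA subrK.
apply: (le_trans (ler_normD _ _)).
have := ler_normD (a - t *: X) (b - t *: Y).
have et : 0 <= e * `|t| by rewrite mulr_ge0// ltW.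
lra.
Qed.

Lemma tangent_expo X : tangent (fun t => expo (t *: X)) X.
Proof.
move=> e e0; have r0 := le_rho L; have A0 := le_A L.
have B0 : 0 < `|X| + 1 by rewrite ltr_wpDl.
have s0 : 0 < Num.min (rho / (`|X| + 1)) (e / (2 * A * (`|X| + 1) ^+ 2)).
  by rewrite lt_min !divr_gt0// !mulr_gt0// exprn_gt0.
have := near_norm_le s0; apply: filterS => t; rewrite le_min => /andP[s1 s2].
have t0 := normr_ge0 t.
rewrite ler_pdivlMr// in s1; rewrite ler_pdivlMr ?mulr_gt0 ?exprn_gt0// in s2.
have x0 := normr_ge0 X.
have tX : `|t *: X| <= rho.
  by rewrite normrZ; apply: le_trans s1; rewrite ler_wpM2l//; lra.
have [d l] := lexp_dom L tX.
rewrite (expo_lexp L)//; split => //; rewrite l.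
have := (le_near_id L).2 (t *: X) 0 `|t *: X|; rewrite normr0 (E0 L) !subr0.
move=> /(_ (lexx _) (normr_ge0 _) tX) /le_trans; apply.
rewrite normrZ.
have -> : 2 * A * (`|t| * `|X|) * (`|t| * `|X|) = `|t| * (2 * A * `|X| ^+ 2) * `|t| by ring.
rewrite ler_wpM2r//; apply: le_trans s2; rewrite ler_wpM2l// ler_wpM2l ?mulr_ge0 ?(ltW A0)//.
by rewrite lerXn2r ?nnegrE//; lra.
Qed.

Lemma gsq_morph (f : G -> G) : {morph f : x y / (x * y)%g} -> forall x, f (gsq x) = gsq (f x).
Proof. by move=> fM x; rewrite /gsq fM. Qed.

Lemma expo_pow2 k X : expo ((2^-1 : R) ^+ k *: X) = gsq (expo ((2^-1 : R) ^+ k.+1 *: X)).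
Proof. by rewrite (expo_half L) scalerA -exprS. Qed.

(** The image of the curve [expo (t X)] still satisfies the dyadic squaring relation and its
    velocity is the image of X, so [expo_unique] identifies its endpoint. *)
Lemma expo_hom f X : diff1 f -> {morph f : x y / (x * y)%g} ->
  f (expo X) = expo (tangent_map f X).
Proof.
move=> df fM; rewrite -(expo_unique L (tangent_comp df (tangent_expo X))) /= ?scale1r//.
by move=> k; rewrite expo_pow2 gsq_morph.
Qed.

Lemma conj_morph (x : G) : {morph (fun y => x * y * x^-1)%g : y z / (y * z)%g}.
Proof. by move=> y z; rewrite !mulgA mulgVK. Qed.

Lemma iter_gsq_comm k (s : G) : (iter k gsq s * s = s * iter k gsq s)%g.
Proof.
elim: k => [//|k IH] /=.
by rewrite /gsq -mulgA IH !mulgA IH.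
Qed.

(** [g] is a power of [lexp (t X)] for t = 2^-k, hence commutes with it; conjugation also sends it
    to [lexp (t Ad(g) X)], and local injectivity gives Ad(g) X = X once t is small for both
    vectors. *)
Lemma Ad_expo_fix X : Ad (expo X) X = X.
Proof.
set g := expo X; set Y := Ad g X.
have r0 := le_rho L.
have B0 : 0 < `|X| + `|Y| + 1 by rewrite ltr_wpDl// addr_ge0.
have [k hk] := near_pow2 (near_norm_le (divr_gt0 r0 B0)).
have := hk k (leqnn k); set t := _ ^+ k; have t0 := @pow2_gt0 R k; rewrite -/t in t0 *.
rewrite (ger0_norm (ltW t0)) ler_pdivlMr// => ht.
have x0 := normr_ge0 X; have y0 := normr_ge0 Y.
have tX : `|t *: X| <= rho.
  by rewrite normrZ (ger0_norm (ltW t0)); apply: le_trans ht; rewrite ler_wpM2l ?(ltW t0)//; lra.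
have tY : `|t *: Y| <= rho.
  by rewrite normrZ (ger0_norm (ltW t0)); apply: le_trans ht; rewrite ler_wpM2l ?(ltW t0)//; lra.
have ge : g = iter k gsq (lexp (t *: X)) by rewrite /g (@expoE _ _ _ _ _ _ L k).
have cj : (g * lexp (t *: X) * g^-1)%g = lexp (t *: X).
  by rewrite ge iter_gsq_comm mulgK.
have := expo_hom (t *: X) (diff1_conj g) (@conj_morph g).
rewrite (expo_lexp L tX) cj tangent_mapZ -/(Ad g) -/Y (expo_lexp L tY).
move=> /(lexp_inj L tX tY) /eqP; rewrite eq_sym -subr_eq0 -scalerBr scaler_eq0 gt_eqF//=.
by rewrite subr_eq0 => /eqP.
Qed.

(** Additivity is not yet available; commutation comes from the fact that Ad(exp(sX)) fixes X, so
    conjugation by exp(sX) fixes exp(tX). *)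
Lemma expo_comm X s t : (expo (s *: X) * expo (t *: X) = expo (t *: X) * expo (s *: X))%g.
Proof.
have e0 : expo 0 = 1%g by have := tangent0 (tangent_expo X); rewrite scale0r.
have [->|s0] := eqVneq s 0; first by rewrite scale0r e0 mulg1 mul1g.
have AX : Ad (expo (s *: X)) X = X.
  have := Ad_expo_fix (s *: X); rewrite /Ad tangent_mapZ => /eqP.
  by rewrite -subr_eq0 -scalerBr scaler_eq0 (negbTE s0)/= subr_eq0 => /eqP.
have := expo_hom (t *: X) (diff1_conj (expo (s *: X))) (@conj_morph _).
rewrite tangent_mapZ -/(Ad _) AX => h.
by rewrite -{2}h mulgVK.
Qed.

Lemma gsq_mul (a b : G) : (a * b = b * a)%g -> (gsq a * gsq b = gsq (a * b))%g.
Proof. by move=> ab; rewrite /gsq -!mulgA; congr (_ * _)%g; rewrite !mulgA ab. Qed.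

(** The product curve u -> exp(u s X) exp(u t X) has velocity (s + t) X, and commutation of its
    factors yields the squaring relation required by [expo_unique]. *)
Lemma expo_add X s t : expo ((s + t) *: X) = (expo (s *: X) * expo (t *: X))%g.
Proof.
have T := tangent_mul (tangent_expo (s *: X)) (tangent_expo (t *: X)).
rewrite scalerDl -(expo_unique L T) ?scale1r//.
move=> k; rewrite (expo_pow2 k (s *: X)) (expo_pow2 k (t *: X)).
by apply: gsq_mul; rewrite !scalerA; exact: expo_comm.
Qed.

Lemma expo_continuous X : continuous (fun t : R => expo (t *: X)).
Proof.
move=> t; have h := tangent_continuous (tangent_expo X).
have -> : (fun t : R => expo (t *: X)) = (fun s : R => expo (t *: X) * expo ((s - t) *: X))%g.
  by apply/funext => s; rewrite -expo_add addrC subrK.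
have e0 : expo 0 = 1%g by have := tangent0 (tangent_expo X); rewrite scale0r.
apply: cvg_mulg; first exact: cvg_cst.
rewrite subrr; apply: (cvg_comp (fun s => s - t) (fun s => expo (s *: X)) _ h).
have : (fun s : R => s - t) @ t --> t - t.
  by apply: cvgB; [exact: cvg_id|exact: cvg_cst].
by rewrite subrr.
Qed.

Lemma tangent_is_derive (c : R -> G) X : tangent c X -> is_derive (0 : R) (1 : R) (coord phi \o c) X.
Proof.
move=> tc; have c0 := tangent0 tc.
have cv : h^-1 *: ((coord phi \o c) (h *: (1 : R) + 0) - (coord phi \o c) 0) @[h --> (0 : R)^'] --> X.
  apply/cvgrPdist_le => e e0; move/nbhs_normE : (tc e e0) => -[r r0 hr].
  apply/nbhs_normE; exists r => // h hr0 hn0.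
  have [_ h1] := hr h hr0.
  rewrite /= addr0 c0 -[coord phi (c _) - _]/(lg (c (h *: 1))) -[h *: 1]/(h * 1) mulr1.
  have -> (l : V) : X - h^-1 *: l = - (h^-1 *: (l - h *: X)).
    by rewrite scalerBr scalerA mulVf// scale1r opprB.
  by rewrite normrN normrZ normfV ler_pdivrMl ?normr_gt0// mulrC.
apply: DeriveDef; first by apply/cvg_ex; exists X.
by rewrite /derive; apply: cvg_lim.
Qed.

Lemma is_derive_tangent (c : R -> G) X : continuous c -> c 0 = 1%g ->
  is_derive (0 : R) (1 : R) (coord phi \o c) X -> tangent c X.
Proof.
move=> cc c0 dc e e0.
have dd : differentiable (coord phi \o c) 0 by apply/derivable1_diffP; exact: (@ex_derive _ _ _ _ _ _ _ dc).
have h1 := diff_approx dd e0.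
have h2 : \forall t \near (0 : R), chart_dom phi (c t) by apply: cc; rewrite c0; exact: near_dom.
apply: filterS2 h2 h1 => t d1; rewrite /= c0 subr0 => h; split => //.
suff <- : 'd (coord phi \o c) 0 t = t *: X by [].
have -> : X = 'd (coord phi \o c) 0 1.
  by rewrite -(@derive_val _ _ _ _ _ _ _ dc) deriveE.
by rewrite -linearZ /= -[t *: 1]/(t * 1) mulr1.
Qed.

(** [expG] is a choice with default value 1. The curve [expo (t X)] is a witness, so the default
    never occurs, and [expo_unique] makes all witnesses agree. *)
Lemma expG_expo X : @expG R n G X = expo X.
Proof.
rewrite /expG; case: xgetP => [_ ->|].
  move=> [c [cc cM dc <-]].
  have c0 : c 0 = 1%g.
    have := cM 0 0; rewrite addr0 => h; apply: (mulgI (c 0)); by rewrite -h mulg1.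
  apply: (expo_unique L (is_derive_tangent cc c0 dc)) => k.
  by rewrite /gsq -cM exprS -mulrDl; congr c; field.
move=> /(_ (expo X)) []; exists (fun t => expo (t *: X)); split.
- exact: expo_continuous.
- by move=> s t; rewrite expo_add.
- by apply: tangent_is_derive; exact: tangent_expo.
- by rewrite scale1r.
Qed.
End Local.

Lemma expG0 : @expG R n G 0 = 1%g.
Proof.
have [rho [A [E L]]] := exists_local_exp G.
by rewrite (expG_expo L); have := tangent0 (tangent_expo L 0); rewrite scale0r.
Qed.

Lemma expG_add X s t : @expG R n G ((s + t) *: X) = (expG (s *: X) * expG (t *: X))%g.
Proof.
have [rho [A [E L]]] := exists_local_exp G.
by rewrite !(expG_expo L) (expo_add L).
Qed.

Lemma expG_hom f X : diff1 f -> {morph f : x y / (x * y)%g} ->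
  f (expG X) = @expG R n G (tangent_map f X).
Proof.
have [rho [A [E L]]] := exists_local_exp G => df fM.
by rewrite !(expG_expo L) (expo_hom L).
Qed.

Lemma tangent_expG X : tangent (fun t => expG (t *: X)) X.
Proof.
have [rho [A [E L]]] := exists_local_exp G => e e0.
by have := tangent_expo L X e0; apply: filterS => t; rewrite (expG_expo L).
Qed.

Lemma expG_continuous X : continuous (fun t : R => @expG R n G (t *: X)).
Proof.
have [rho [A [E L]]] := exists_local_exp G.
have -> : (fun t : R => @expG R n G (t *: X)) = (fun t => expo G (rho := rho) (E := E) (t *: X)).
  by apply/funext => t; rewrite (expG_expo L).
exact: (expo_continuous L).
Qed.

Lemma Ad_expG_fix X : Ad (expG X : G) X = X.
Proof.
have [rho [A [E L]]] := exists_local_exp G.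
by rewrite (expG_expo L) (Ad_expo_fix L).
Qed.

End OneParameter.

(** * The adjoint representation and the bracket *)

Lemma diff_pair_cstl {R : realType} (V W : normedModType R) (u : V) (b y : W) :
  'd (fun v : W => (u, v)) b y = (0, y).
Proof.
have h : 'd (fun v : W => (u, v)) b = (fun y => ('d (cst u) b y, 'd id b y)) :> (W -> V * W).
  by apply: diff_pair.
by rewrite h !diff_val.
Qed.

Lemma diff_pair_cstr {R : realType} (V W : normedModType R) (u : V) (b y : W) :
  'd (fun v : W => (v, u)) b y = (y, 0).
Proof.
have h : 'd (fun v : W => (v, u)) b = (fun y => ('d id b y, 'd (cst u) b y)) :> (W -> W * V).
  by apply: diff_pair.
by rewrite h !diff_val.
Qed.

Section AdjointRegularity.
Context {R : realType} {n : nat} (G : lieGroup R n).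
Let V := 'rV[R]_n.
Local Notation phi := (@chart1 R n G).
Local Notation base := (base G).
Implicit Types (X Y Z : V) (x y : G).

Lemma AdD x Y Z : Ad x (Y + Z) = Ad x Y + Ad x Z. Proof. exact: tangent_mapD. Qed.
Lemma AdZ x a Y : Ad x (a *: Y) = a *: Ad x Y. Proof. exact: tangent_mapZ. Qed.

Lemma AdM x y Y : Ad (x * y)%g Y = Ad x (Ad y Y).
Proof.
have [_ h] := tangent_map_comp (diff1_conj x) (diff1_conj y).
rewrite -[Ad x _]/((tangent_map (fun z => x * z * x^-1)%g \o tangent_map (fun z => y * z * y^-1)%g) Y) -h.
by rewrite /Ad; congr (tangent_map _ Y); apply/funext => z /=; rewrite invgM !mulgA.
Qed.

Lemma Ad1 Y : Ad (1 : G)%g Y = Y.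
Proof.
rewrite /Ad; have -> : (fun y : G => 1 * y * 1^-1)%g = @id G.
  by apply/funext => y /=; rewrite mul1g invg1 mulg1.
by rewrite tangent_map_id.
Qed.

Let m (p : V * V) : V := coord phi (point phi p.1 * point phi p.2)%g.
Let D := [set u : V * V | [/\ chart_img phi u.1, chart_img phi u.2 &
             chart_dom phi (point phi u.1 * point phi u.2)%g]].

Let openD : open D. Proof. exact: open_mul_dom. Qed.
Let m2 : Ck 2 D m. Proof. exact: (@mul_smooth _ _ G 1%g 1%g 1%g 2%N). Qed.

Definition icoord (u : V) : V := coord phi (point phi u)^-1%g.

Lemma gdiff_inv : {for 1%g, continuous (fun x : G => x^-1%g)} /\ differentiable icoord base.
Proof.
split; first exact: inv_continuous.
have [h _] := @inv_smooth _ _ G 1%g 1%g 1%N; apply: h; split; first exact: img_base.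
by rewrite point_base invg1; exact: dom1.
Qed.

Lemma icoord_base : icoord base = base.
Proof. by rewrite /icoord point_base invg1. Qed.

(** Conjugation is a left translation followed by a right one, so Ad is a composite of two partial
    differentials of the product read in the single chart at 1. Its dependence on the point is
    thereby reduced to that of ['d m]. *)
Lemma Ad_formula Y : \forall u \near base,
  Ad (point phi u) Y = 'd m (u, icoord u) ('d m (u, base) (0, Y), 0).
Proof.
have c1 : {for base, continuous (fun u => (point phi u)^-1%g)}.
  apply: continuous_comp; first exact: point_continuous (img_base G).
  by rewrite point_base; exact: gdiff_inv.1.
have n1 : \forall u \near base, chart_img phi u by exact: near_img.
have n2 : \forall u \near base, chart_dom phi (point phi u)^-1%g.
  by apply: c1; rewrite point_base invg1; exact: near_dom.
apply: filterS2 n1 n2 => u iu du.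
have [dpu cpu] := coord_point iu.
set x := point phi u.
have D1 : D (u, base).
  by split => //=; [exact: img_base|rewrite point_base mulg1].
have ii : chart_img phi (icoord u) by exists x^-1%g.
have pi : point phi (icoord u) = x^-1%g by rewrite /icoord coordK.
have D2 : D (u, icoord u).
  by split => //=; rewrite pi mulgV; exact: dom1.
have mu0 : m (u, base) = u by rewrite /m /= point_base mulg1.
have d1 : differentiable (fun v : V => m (u, v)) base /\ 'd (fun v : V => m (u, v)) base Y = 'd m (u, base) (0, Y).
  have dp : differentiable (fun v : V => (u, v)) base by exact: differentiable_pair.
  have dm : differentiable m (u, base) by exact: m2.1.
  split; first exact: (differentiable_comp dp dm).
  have E := congr1 (fun F : V -> V => F Y) (diff_comp dp dm).
  apply: (etrans E); congr ('d m _ _).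
  exact: diff_pair_cstl.
have d2 w : differentiable (fun v : V => m (v, icoord u)) u /\ 'd (fun v : V => m (v, icoord u)) u w = 'd m (u, icoord u) (w, 0).
  have dp : differentiable (fun v : V => (v, icoord u)) u by exact: differentiable_pair.
  have dm : differentiable m (u, icoord u) by exact: m2.1.
  split; first exact: (differentiable_comp dp dm).
  have E := congr1 (fun F : V -> V => F w) (diff_comp dp dm).
  apply: (etrans E); congr ('d m _ _).
  exact: diff_pair_cstr.
have d2' : differentiable (fun v : V => m (v, icoord u)) (m (u, base)) by rewrite mu0; exact: (d2 0).1.
have G1 := etrans (congr1 (fun z => 'd m (u, icoord u) (z, 0)) (esym d1.2)) (esym (d2 _).2).
apply: (etrans _ (esym G1)) => {G1}.
have nd : \forall v \near base, D (u, v).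
  have : nbhs (u, base) D by apply: open_nbhs_nbhs.
  by move=> [[A1 A2] /= [h1 h2] h]; apply: filterS h2 => v hv; apply: (h (u, v)); split => //=; exact: nbhs_singleton h1.
have [_ E] : differentiable (coord phi \o (fun y => x * y * x^-1)%g \o point phi) base /\
  'd (coord phi \o (fun y => x * y * x^-1)%g \o point phi) base = 'd ((fun v : V => m (v, icoord u)) \o (fun v : V => m (u, v))) base :> (V -> V).
  apply: diff_near_eq; last exact: differentiable_comp d1.1 d2'.
  by move: nd; apply: filterS => v [_ _ /= hd]; rewrite /m /= pi coordK.
apply: (etrans (congr1 (fun F : V -> V => F Y) E)).
have E2 := congr1 (fun F : V -> V => F Y) (diff_comp d1.1 d2').
apply: (etrans E2).
exact: (congr1 (fun z => 'd (fun v : V => m (v, icoord u)) z ('d (fun v : V => m (u, v)) base Y)) mu0).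
Qed.

(** The bracket is a differential of this map, so its existence has to be established before any
    computation. C^2 regularity controls ['d m p v] for fixed v only; the moving vector of
    [Ad_formula] is therefore expanded in the basis, leaving products of differentiable scalar
    functions. *)
Lemma Ad_differentiable Y : differentiable (fun u : V => Ad (point phi u) Y) base.
Proof.
pose w (u : V) : V := 'd m (u, base) (0, Y).
pose f j (u : V) : V := 'd m (u, icoord u) (delta_mx ord0 j, 0).
pose F (u : V) : V := \sum_j \sum_l (w u ord0 j * f j u ord0 l) *: delta_mx ord0 l.
have dmb : D (base, base) by exact: mul_dom_base.
have nF : \forall u \near base, Ad (point phi u) Y = F u.
  have := Ad_formula Y; apply: filterS => u Eu; apply: (etrans Eu) => {Eu}.
  apply: (etrans (linear_prod_expand ('d m (u, icoord u)) (w u, 0))).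
  rewrite [X in _ + X]big1 ?addr0; last by move=> j _; rewrite mxE scale0r.
  apply: eq_bigr => j _; rewrite [X in _ *: X](_ : _ = f j u)// [f j u in LHS]row_sum_delta scaler_sumr.
  by apply: eq_bigr => l _; rewrite scalerA.
have dw : differentiable w base.
  have dp : differentiable (fun u : V => (u, base)) base by exact: differentiable_pair.
  exact: (differentiable_comp dp ((m2.2 (0, Y)).1 (base, base) dmb)).
have df j : differentiable (f j) base.
  have dp : differentiable (fun u : V => (u, icoord u)) base.
    by apply: differentiable_pair => //; exact: gdiff_inv.2.
  have h : differentiable (fun p => 'd m p (delta_mx ord0 j, 0)) (base, icoord base).
    by rewrite icoord_base; exact: ((m2.2 (delta_mx ord0 j, 0)).1 (base, base) dmb).
  exact: (differentiable_comp dp h).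
have dc (g : V -> V) l : differentiable g base -> differentiable (fun u => g u ord0 l) base.
  move=> dg; apply: (differentiable_comp dg (g := fun N : V => N ord0 l)).
  exact: differentiable_coord.
have dF : differentiable F base.
  have -> : F = \sum_j \sum_l (fun u : V => (w u ord0 j * f j u ord0 l) *: (delta_mx ord0 l : V)).
    by apply/funext => u; rewrite /F fct_sumE; apply: eq_bigr => j _; rewrite fct_sumE.
  apply: differentiable_sum => j; apply: differentiable_sum => l.
  apply: differentiableZl; apply: differentiableM; exact: dc.
exact: (diff_near_eq nF dF).1.
Qed.

End AdjointRegularity.

(** * Leibniz rule and a linear differential equation *)

Section CurveCalculus.
Context {R : realType}.

Lemma is_derive_scalel (W : normedModType R) (k : R -> R) (t : R) k' (w : W) :
  is_derive t (1 : R) k k' -> is_derive t (1 : R) (fun s => k s *: w) (k' *: w).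
Proof.
move=> dk; have dl : differentiable ( *:%R ^~ w : R -> W) (k t) by [].
have := is_derive_comp_diff dk dl.
by rewrite diff_val.
Qed.

Lemma is_derive_sum_fun (W : normedModType R) m (h : 'I_m -> R -> W) (t : R) (h' : 'I_m -> W) :
  (forall i, is_derive t (1 : R) (h i) (h' i)) -> is_derive t (1 : R) (fun s => \sum_i h i s) (\sum_i h' i).
Proof.
move=> dh; have -> : (fun s => \sum_i h i s) = \sum_i h i by apply/funext => s; rewrite fct_sumE.
exact: is_derive_sum.
Qed.

Lemma is_derive_bilin n (W : normedModType R) (b : 'rV[R]_n -> 'rV[R]_n -> W)
    (F H : R -> 'rV[R]_n) (t : R) F' H' :
  (forall y, linear (b^~ y)) -> (forall x, linear (b x)) ->
  is_derive t (1 : R) F F' -> is_derive t (1 : R) H H' ->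
  is_derive t (1 : R) (fun s => b (F s) (H s)) (b F' (H t) + b (F t) H').
Proof.
move=> bl br dF dH.
have ex x y : b x y = \sum_j \sum_l (x ord0 j * y ord0 l) *: b (delta_mx ord0 j) (delta_mx ord0 l).
  pose Ll := GRing.isLinear.Build _ _ _ _ _ (bl y). pose fl : {linear _ -> _} := HB.pack (b^~ y) Ll.
  rewrite [x in LHS]row_sum_delta -[b _ y]/(fl _) linear_sum; apply: eq_bigr => j _.
  rewrite linearZ /=.
  pose Lr := GRing.isLinear.Build _ _ _ _ _ (br (delta_mx ord0 j)). pose fr : {linear _ -> _} := HB.pack (b (delta_mx ord0 j)) Lr.
  rewrite [y in LHS]row_sum_delta -[b _ (\sum__ _)]/(fr _) linear_sum scaler_sumr; apply: eq_bigr => l _.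
  by rewrite linearZ /= scalerA.
have -> : (fun s => b (F s) (H s)) = (fun s => \sum_j \sum_l (F s ord0 j * H s ord0 l) *: b (delta_mx ord0 j) (delta_mx ord0 l)).
  by apply/funext => s; rewrite ex.
have -> : b F' (H t) + b (F t) H' = \sum_j \sum_l (F t ord0 j * H' ord0 l + H t ord0 l * F' ord0 j) *: b (delta_mx ord0 j) (delta_mx ord0 l).
  rewrite (ex F') (ex (F t)) -big_split; apply: eq_bigr => j _.
  rewrite -big_split; apply: eq_bigr => l _ /=.
  by rewrite -scalerDl addrC [F' _ _ * _]mulrC.
apply: is_derive_sum_fun => j; apply: is_derive_sum_fun => l; apply: is_derive_scalel.
have d1 := is_derive_coord ord0 j dF; have d2 := is_derive_coord ord0 l dH.
exact: is_deriveM.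
Qed.

Lemma is_derive_lin n m (T : 'rV[R]_n -> 'rV[R]_m) (F : R -> 'rV[R]_n) (t : R) F' :
  linear T -> is_derive t (1 : R) F F' -> is_derive t (1 : R) (T \o F) (T F').
Proof.
move=> lT dF.
pose L := GRing.isLinear.Build _ _ _ _ _ lT. pose f : {linear _ -> _} := HB.pack T L.
have ex x : T x = \sum_j x ord0 j *: T (delta_mx ord0 j).
  rewrite [x in LHS]row_sum_delta -[T _]/(f _) linear_sum; apply: eq_bigr => j _.
  by rewrite linearZ.
have -> : T \o F = (fun s => \sum_j F s ord0 j *: T (delta_mx ord0 j)).
  by apply/funext => s; rewrite /= ex.
rewrite ex; apply: is_derive_sum_fun => j; apply: is_derive_scalel.
exact: is_derive_coord.
Qed.

Lemma is_derive_ext (W : normedModType R) (f g : R -> W) (t : R) v :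
  f =1 g -> is_derive t (1 : R) g v -> is_derive t (1 : R) f v.
Proof. by move=> /funext ->. Qed.

Lemma is_derive_unique (W : normedModType R) (f : R -> W) (t : R) a b :
  is_derive t (1 : R) f a -> is_derive t (1 : R) f b -> a = b.
Proof. by move=> [_ <-] [_ <-]. Qed.

(** Integrating factor: each coordinate of [expR (- (lam * s)) *: f s] has zero derivative and is
    constant. *)
Lemma exp_ode n (f : R -> 'rV[R]_n) (lam : R) :
  (forall t, is_derive t (1 : R) f (lam *: f t)) -> forall t, f t = expR (lam * t) *: f 0.
Proof.
move=> df t; apply/rowP => j; rewrite mxE.
pose g (s : R) := expR (- (lam * s)) * f s ord0 j.
have dg s : is_derive s (1 : R) g 0.
  have d1 := is_derive_coord ord0 j (df s); rewrite mxE in d1.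
  have dl : is_derive s (1 : R) (fun s => - (lam * s)) (- lam).
    have -> : (fun s => - (lam * s)) = (fun s => 0 + s *: (- lam)).
      by apply/funext => x; rewrite add0r -[x *: _]/(x * _) mulrN mulrC.
    exact: is_derive_line.
  have de : is_derive s (1 : R) (fun s => expR (- (lam * s))) (expR (- (lam * s)) * - lam).
    have h := is_derive_comp_diff dl (f := expR) _.
    have dex : differentiable expR (- (lam * s)) by apply/derivable1_diffP; exact: derivable_expR.
    have Ed y v : differentiable expR y -> 'd expR y v = expR y * v :> R.
      move=> dy; have -> : v = v *: (1 : R) by rewrite -[RHS]/(v * 1) mulr1.
      rewrite linearZ /= -deriveE// derive_val.
      by rewrite -![_ *: _]/(_ * _) mulr1 mulrC.
    by have := h dex; rewrite Ed.
  have [d e] := is_deriveM de d1; apply: DeriveDef => //; rewrite e.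
  by rewrite -![_ *: _]/(_ * _); ring.
have E : g t = g 0.
  have dd s : derivable g s 1 by exact: (@ex_derive _ _ _ _ _ _ _ (dg s)).
  have le01 : Num.min 0 t <= Num.max 0 t by rewrite ge_min !le_max lexx.
  have cg : {within `[Num.min 0 t, Num.max 0 t], continuous g}.
    apply: continuous_subspaceT => x; apply: differentiable_continuous.
    by apply/derivable1_diffP.
  have [c _] := MVT_segment le01 (fun x _ => dg x) cg.
  rewrite mul0r => /eqP; rewrite subr_eq0 => /eqP.
  by case: (leP 0 t).
move: E; rewrite /g mulr0 oppr0 expR0 mul1r expRN => <-.
by rewrite mulrA divff ?mul1r// gt_eqF// expR_gt0.
Qed.
End CurveCalculus.

(** * The Lie bracket *)

Section LieBracket.
Context {R : realType} {n : nat} (G : lieGroup R n).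
Let V := 'rV[R]_n.
Local Notation phi := (@chart1 R n G).
Local Notation base := (base G).
Implicit Types (X Y Z : V) (x y : G).
Local Notation "'[Lie' X , Y ]" := (bracket (G := G) X Y).
Local Notation exp := (@expG R n G).

(** Replaces the chart line of the definition of the bracket by the one-parameter group, which has
    the same velocity and along which Ad is multiplicative. *)
Lemma is_derive_Ad X Y : is_derive (0 : R) (1 : R) (fun t => Ad (exp (t *: X)) Y) ([Lie X, Y]).
Proof.
have T := tangent_expG G X.
have dc := tangent_is_derive T.
have c0 : (coord phi \o (fun t : R => exp (t *: X))) 0 = base by rewrite /= scale0r expG0.
have := is_derive_comp_diff dc (f := fun u : V => Ad (point phi u) Y).
rewrite c0 => /(_ (Ad_differentiable G Y)); apply: near_eq_is_derive.
have := T 1 ltr01; apply: filterS => t [d _].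
by rewrite /= coordK.
Qed.

Lemma bracketDl X Y Z : [Lie X + Y, Z] = [Lie X, Z] + [Lie Y, Z].
Proof. by rewrite /bracket linearD. Qed.
Lemma bracketZl a X Z : [Lie a *: X, Z] = a *: [Lie X, Z].
Proof. by rewrite /bracket linearZ. Qed.

Lemma Ad_linear x : linear (Ad x : V -> V).
Proof. by move=> a u v; rewrite AdD AdZ. Qed.

Lemma bracketZr a X Z : [Lie X, a *: Z] = a *: [Lie X, Z].
Proof.
apply: (is_derive_unique (is_derive_Ad X (a *: Z))).
have lT : linear ( *:%R a : V -> V) by move=> b u v; rewrite scalerDr !scalerA mulrC.
have := is_derive_lin lT (is_derive_Ad X Z).
by congr is_derive; apply/funext => t; rewrite /= AdZ.
Qed.

Lemma bracketDr X Y Z : [Lie X, Y + Z] = [Lie X, Y] + [Lie X, Z].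
Proof.
apply: (is_derive_unique (is_derive_Ad X (Y + Z))).
have := is_deriveD (is_derive_Ad X Y) (is_derive_Ad X Z).
by congr is_derive; apply/funext => t; rewrite /= AdD.
Qed.

Lemma bracket_linl Y : linear (fun X : V => [Lie X, Y]).
Proof. by move=> a u v; rewrite bracketDl bracketZl. Qed.
Lemma bracket_linr X : linear (fun Y : V => [Lie X, Y]).
Proof. by move=> a u v; rewrite bracketDr bracketZr. Qed.

(** The curve Ad(exp(tX)) X is constant; antisymmetry follows by polarisation. *)
Lemma bracketXX X : [Lie X, X] = 0.
Proof.
apply: (is_derive_unique (is_derive_Ad X X)).
have h (t : R) : Ad (exp (t *: X)) X = X.
  have [->|t0] := eqVneq t 0; first by rewrite scale0r expG0 Ad1.
  have := Ad_expG_fix G (t *: X); rewrite AdZ => /eqP.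
  by rewrite -subr_eq0 -scalerBr scaler_eq0 (negbTE t0)/= subr_eq0 => /eqP.
have -> : (fun t => Ad (exp (t *: X)) X) = cst X by apply/funext => t; rewrite h.
exact: is_derive_cst.
Qed.

Lemma bracketC X Y : [Lie X, Y] = - [Lie Y, X].
Proof.
apply/eqP; rewrite -addr_eq0; apply/eqP.
by have := bracketXX (X + Y); rewrite bracketDl !bracketDr !bracketXX addr0 add0r.
Qed.

Section Automorphism.
Variable f : G -> G.
Hypothesis (df : diff1 f) (fM : {morph f : x y / (x * y)%g}).

Lemma morphV x : f x^-1%g = (f x)^-1%g.
Proof. by apply: (mulgI (f x)); rewrite -fM !mulgV df.1. Qed.

Lemma tangent_map_Ad x Y : tangent_map f (Ad x Y) = Ad (f x) (tangent_map f Y).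
Proof.
have [_ h1] := tangent_map_comp df (diff1_conj x).
have [_ h2] := tangent_map_comp (diff1_conj (f x)) df.
have E : f \o (fun y => x * y * x^-1)%g = (fun y => f x * y * (f x)^-1)%g \o f.
  by apply/funext => y /=; rewrite !fM morphV.
have := congr1 (fun F : V -> V => F Y) h1; rewrite /= -[tangent_map _ Y in X in _ = X -> _]/(Ad x Y) => <-.
rewrite E; exact: (congr1 (fun F : V -> V => F Y) h2).
Qed.

Lemma tangent_map_bracket X Y : tangent_map f ([Lie X, Y]) = [Lie tangent_map f X, tangent_map f Y].
Proof.
have h1 := is_derive_lin (tangent_map_linear f) (is_derive_Ad X Y).
have h2 := is_derive_Ad (tangent_map f X) (tangent_map f Y).
have E : (fun t : R => Ad (exp (t *: tangent_map f X)) (tangent_map f Y)) =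
   tangent_map f \o (fun t : R => Ad (exp (t *: X)) Y).
  by apply/funext => t; rewrite /= tangent_map_Ad (expG_hom _ df fM) tangent_mapZ.
by rewrite E in h2; exact: (is_derive_unique h1 h2).
Qed.
End Automorphism.

Lemma Ad_bracket x X Y : Ad x ([Lie X, Y]) = [Lie Ad x X, Ad x Y].
Proof. apply: tangent_map_bracket; [exact: diff1_conj|exact: conj_morph]. Qed.

Lemma conj_expG x X : (x * exp X * x^-1)%g = exp (Ad x X).
Proof. apply: (expG_hom X (diff1_conj x)); exact: conj_morph. Qed.

(** Derivative at t = 0 of the identity expressing that Ad(exp(tZ)) is an automorphism of the
    bracket, by the Leibniz rule. *)
Lemma jacobi X Y Z : [Lie Z, [Lie X, Y]] = [Lie [Lie Z, X], Y] + [Lie X, [Lie Z, Y]].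
Proof.
apply: (is_derive_unique (is_derive_Ad Z _)).
have h := is_derive_bilin bracket_linl bracket_linr (is_derive_Ad Z X) (is_derive_Ad Z Y).
rewrite scale0r expG0 !Ad1 in h.
by apply: (is_derive_ext _ h) => t; rewrite Ad_bracket.
Qed.

Lemma is_derive_Ad_at X Y (t : R) :
  is_derive t (1 : R) (fun t => Ad (exp (t *: X)) Y) (Ad (exp (t *: X)) ([Lie X, Y])).
Proof.
have h := is_derive_lin (Ad_linear (exp (t *: X))) (is_derive_Ad X Y).
have sh : is_derive t (1 : R) (fun s : R => s - t) 1.
  have -> : (fun s : R => s - t) = (fun s => - t + s *: (1 : R)).
    by apply/funext => s; rewrite addrC -[s *: _]/(s * _) mulr1.
  exact: is_derive_line.
set F := _ \o _ in h.
have dF : differentiable F (t - t).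
  by rewrite subrr; apply/derivable1_diffP; exact: (@ex_derive _ _ _ _ _ _ _ h).
have h2 := is_derive_comp_diff sh dF.
have E : 'd F (t - t) 1 = Ad (exp (t *: X)) ([Lie X, Y]).
  rewrite -(@derive_val _ _ _ _ _ _ _ h) deriveE ?subrr//.
  by rewrite -(subrr t).
rewrite E in h2; apply: (is_derive_ext _ h2) => s.
by rewrite /F /= -AdM -expG_add addrC subrK.
Qed.

(** Ad(exp X) = e^(ad X) on eigenvectors: the curve Ad(exp(tX)) Y solves f' = lam f. *)
Lemma Ad_expG_eigen X Y (lam : R) : [Lie X, Y] = lam *: Y -> Ad (exp X) Y = expR lam *: Y.
Proof.
move=> h; have := @exp_ode R n (fun t => Ad (exp (t *: X)) Y) lam.
move=> /(_ _ 1); rewrite scale1r scale0r expG0 Ad1 mulr1; apply => t.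
by have := is_derive_Ad_at X Y t; rewrite h AdZ.
Qed.

Lemma lie_algebra_of_fixed f X : diff1 f -> {morph f : x y / (x * y)%g} ->
  lie_algebra_of (G := G) (fixed_points f) X <-> tangent_map f X = X.
Proof.
move=> df fM; split=> h.
  apply: (tangent_uniq (c := fun t => exp (t *: X))); last exact: tangent_expG.
  have -> : (fun t : R => exp (t *: X)) = (fun t : R => exp (t *: tangent_map f X)).
    by apply/funext => t; rewrite -tangent_mapZ -(expG_hom _ df fM); exact: esym (h t).
  exact: tangent_expG.
by move=> t; rewrite /fixed_points /= (expG_hom _ df fM) tangent_mapZ h.
Qed.

End LieBracket.

(** * Symmetric endomorphisms and the Killing form *)

Section InnerProduct.
Context {R : realType} {n : nat}.
Let V := 'rV[R]_n.
Implicit Types (M A : 'M[R]_n) (u v w : V).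

Lemma innerDl M u v w : inner M (u + v) w = inner M u w + inner M v w.
Proof. by rewrite /inner !mulmxDl mxE. Qed.
Lemma innerDr M u v w : inner M w (u + v) = inner M w u + inner M w v.
Proof. by rewrite /inner linearD mulmxDr mxE. Qed.
Lemma innerZl M a u w : inner M (a *: u) w = a * inner M u w.
Proof. by rewrite /inner -!scalemxAl mxE. Qed.
Lemma innerZr M a u w : inner M w (a *: u) = a * inner M w u.
Proof. by rewrite /inner linearZ -scalemxAr mxE. Qed.
Lemma innerC M u v : M^T = M -> inner M u v = inner M v u.
Proof.
move=> sM; rewrite /inner -[in LHS](trmxK (u *m M *m v^T)) mxE.
by rewrite !trmx_mul trmxK sM mulmxA.
Qed.
(** Matrices act on row vectors from the right, so [A *m M = M *m A^T] is selfadjointness of A for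
    the form M. *)
Lemma inner_mulr M A u v : A *m M = M *m A^T -> inner M (u *m A) v = inner M u (v *m A).
Proof. by move=> h; rewrite /inner -[u *m A *m M]mulmxA h trmx_mul !mulmxA. Qed.

Lemma inner_continuous M A : continuous (fun v : V => inner M (v *m A) v).
Proof.
move=> v; apply: differentiable_continuous.
have -> : (fun v : V => inner M (v *m A) v) = \sum_i \sum_j (fun v : V => (A *m M) i j *: (v ord0 i * v ord0 j)).
  apply/funext => w; rewrite fct_sumE /inner -[w *m A *m M]mulmxA mxE.
  rewrite [LHS](eq_bigr (fun j => \sum_i (A *m M) i j * (w ord0 i * w ord0 j))); last first.
    move=> j _; rewrite mxE mulr_suml; apply: eq_bigr => i _; rewrite [w^T _ _]mxE.
    by rewrite mulrA [_ * (A *m M) i j]mulrC.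
  by rewrite exchange_big; apply: eq_bigr => i _; rewrite fct_sumE.
apply: differentiable_sum => i; apply: differentiable_sum => j.
apply: differentiableZ; apply: differentiableM; exact: differentiable_coord.
Qed.

Variable M : 'M[R]_n.
Hypothesis sM : M^T = M.
Hypothesis pM : forall v, v != 0 -> 0 < inner M v v.

Lemma inner_ge0 v : 0 <= inner M v v.
Proof. by have [->|/pM/ltW//] := eqVneq v 0; rewrite /inner !mul0mx mxE. Qed.

Lemma inner_eq0 v : inner M v v = 0 -> v = 0.
Proof. by move=> h; apply/eqP; apply: contraT => /pM; rewrite h ltxx. Qed.

(** With k = |c| + 1, the value at s = -b/k is (b/k)^2 (c - k), negative unless b = 0. *)
Lemma quadratic_ge0_linear (b c : R) : (forall s, 0 <= s * b + s ^+ 2 * c) -> b = 0.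
Proof.
move=> h; apply/eqP; rewrite eq_le; apply/andP; split.
  rewrite leNgt; apply/negP => b0.
  have k0 : 0 < `|c| + 1 by rewrite ltr_wpDl.
  have := h (- (b / (`|c| + 1))); have := ler_norm c.
  set k := `|c| + 1 in k0 *; move=> ck.
  have -> : - (b / k) * b + (- (b / k)) ^+ 2 * c = (b / k) ^+ 2 * (c - k) by field; rewrite gt_eqF.
  by rewrite pmulr_rge0 ?exprn_gt0 ?divr_gt0// /k; lra.
rewrite leNgt; apply/negP => b0.
have k0 : 0 < `|c| + 1 by rewrite ltr_wpDl.
have := h (- (b / (`|c| + 1))); have := ler_norm c.
set k := `|c| + 1 in k0 *; move=> ck.
have -> : - (b / k) * b + (- (b / k)) ^+ 2 * c = (b / k) ^+ 2 * (c - k) by field; rewrite gt_eqF.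
rewrite pmulr_rge0; first by rewrite /k; lra.
have bk : b / k < 0 by rewrite ltr_pdivrMr// mul0r.
by rewrite exprn_even_gt0//= lt_eqF.
Qed.

(* The maximum of the Rayleigh quotient over the row space of W is attained at
   an eigenvector. *)
Lemma selfadjoint_eigen (A W : 'M[R]_n) : A *m M = M *m A^T -> W != 0 -> stablemx W A ->
  exists v (lam : R), [/\ v != 0, (v <= W)%MS & v *m A = lam *: v].
Proof.
move=> sA W0 stA.
pose S := [set v : V | (v <= W)%MS /\ `|v| = 1].
have S0 : S !=set0.
  have /rowV0Pn[v vW v0] := W0.
  have nv : `|v| != 0 by rewrite normr_eq0.
  exists (`|v|^-1 *: v); split; first exact: scalemx_sub.
  by rewrite normrZ normfV normr_id mulVf.
have subE (v : V) : (v <= W)%MS = (v *m cokermx W == 0) by rewrite submxE.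
have cm : continuous (fun v : V => v *m cokermx W).
  move=> v.
  have -> : (fun v : V => v *m cokermx W) = \sum_i (fun v : V => v ord0 i *: row i (cokermx W)).
    by apply/funext => w; rewrite fct_sumE mulmx_sum_row.
  apply: differentiable_continuous; apply: differentiable_sum => i; apply: differentiableZl.
  exact: differentiable_coord.
have cS : compact S.
  apply: bounded_closed_compact.
    exists 1; split; first exact: num_real.
    move=> x x1 v [_ v1]; have : `|v| <= x by rewrite v1 ltW.
    exact.
  have -> : S = (fun v : V => `|v *m cokermx W|) @^-1` [set 0] `&` (fun v : V => `|v|) @^-1` [set 1].
    apply/seteqP; split=> v /=.
      by move=> [vW v1]; split => //; apply/eqP; rewrite normr_eq0 -subE.
    by move=> [/eqP]; rewrite normr_eq0 -subE.
  apply: closedI.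
    apply: closed_comp; last exact: closed_eq.
    by move=> v _; apply: (cvg_norm (F := nbhs v)); exact: cm.
  apply: closed_comp; last exact: closed_eq.
  by move=> v _; exact: norm_continuous.
have q0 v : S v -> inner M v v != 0.
  by move=> [_ v1]; rewrite gt_eqF// pM// -normr_eq0 v1 oner_neq0.
pose f v := inner M (v *m A) v / inner M v v.
have cf : {within S, continuous f}.
  apply: continuous_in_subspaceT => v; rewrite inE => Sv.
  have c1 := @inner_continuous M A v.
  have c2 : {for v, continuous (fun w : V => inner M w w)}.
    have := @inner_continuous M 1%:M v.
    have -> : (fun w : V => inner M (w *m 1%:M) w) = (fun w : V => inner M w w).
      by apply/funext => w; rewrite mulmx1.
    exact.
  exact: (cvgM c1 (cvgV (q0 _ Sv) c2)).
have [v] := EVT_max_rV S0 cS cf; rewrite inE => -[vW v1] maxv.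
have v0 : v != 0 by rewrite -normr_eq0 v1 oner_neq0.
have lam_max w : (w <= W)%MS -> inner M (w *m A) w <= f v * inner M w w.
  have [-> _|w0 wW] := eqVneq w 0; first by rewrite /inner !mul0mx mxE mulr0.
  have nw : 0 < `|w| by rewrite normr_gt0.
  have Sw : S (`|w|^-1 *: w).
    by split; [exact: scalemx_sub|rewrite normrZ normfV normr_id mulVf// gt_eqF].
  have := maxv (`|w|^-1 *: w); rewrite inE => /(_ Sw).
  move=> hm; rewrite -[f v in leRHS]/(idfun (f v)) -ler_pdivrMr; last exact: pM.
  move: hm; rewrite {1}/f -scalemxAl !innerZl !innerZr.
  suff -> : `|w|^-1 * (`|w|^-1 * inner M (w *m A) w) / (`|w|^-1 * (`|w|^-1 * inner M w w)) =
    inner M (w *m A) w / inner M w w by [].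
  by field; rewrite !gt_eqF// pM.
exists v, (f v); split => //.
set lam := f v in lam_max *.
have vAW : (v *m A <= W)%MS by apply: submx_trans stA; exact: submxMr.
(* On W the form Q is nonnegative, by maximality, and vanishes at v, so v is Q-orthogonal to W.
   Applied to the defect [lam *: v - v *m A], which lies in W, this says that the defect has norm
   0. *)
pose Q x y := lam * inner M x y - inner M (x *m A) y.
have Qvv : Q v v = 0.
  by rewrite /Q /lam /f divfK ?subrr// gt_eqF// pM.
have Qvw w : (w <= W)%MS -> Q v w = 0.
  move=> wW; have : 2 * Q v w = 0.
    apply: (quadratic_ge0_linear (c := Q w w)) => s.
    have := lam_max (v + s *: w) (addmx_sub vW (scalemx_sub s wW)).
    rewrite mulmxDl -scalemxAl !innerDl !innerDr !innerZl !innerZr.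
    move: Qvv; rewrite /Q [inner M w v]innerC// (inner_mulr w v sA) [inner M w (v *m A)]innerC//.
    move=> h; lra.
  by move/eqP; rewrite mulf_eq0 pnatr_eq0/= => /eqP.
have dW : (lam *: v - v *m A <= W)%MS.
  by rewrite addmx_sub// ?scalemx_sub// eqmx_opp.
have Qd := Qvw _ dW.
set d := lam *: v - v *m A in dW Qd.
have Ed : inner M d d = Q v d.
  by rewrite {1}/d innerDl innerZl -[- (v *m A)]scaleN1r innerZl mulN1r.
have /inner_eq0/eqP : inner M d d = 0 by rewrite Ed.
by rewrite subr_eq0 eq_sym => /eqP.
Qed.

(** Induction on the rank of W. Either every member of F is scalar on W and any vector will do, or a
    non-scalar one has an eigenspace meeting W in a proper nonzero subspace, stable under F by
    commutation. *)
Lemma common_eigen (F : set 'M[R]_n) (W : 'M[R]_n) :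
  (forall A, F A -> A *m M = M *m A^T) -> (forall A B, F A -> F B -> A *m B = B *m A) ->
  W != 0 -> (forall A, F A -> stablemx W A) ->
  exists v, [/\ v != 0, (v <= W)%MS & forall A, F A -> exists lam : R, v *m A = lam *: v].
Proof.
move=> sF cF; have [k] := ubnP (\rank W); elim: k W => // k IH W rW W0 stW.
have [[A [FA nA]]|h] := pselect (exists A, F A /\ ~ exists lam : R, W *m A = lam *: W); last first.
  have /rowV0Pn[v vW v0] := W0.
  exists v; split => // A FA.
  have [lam E] : exists lam : R, W *m A = lam *: W.
    by apply: contrapT => nA; apply: h; exists A.
  exists lam; have /submxP[d ->] := vW.
  by rewrite -mulmxA E scalemxAr.
have [v [lam [v0 vW vA]]] := selfadjoint_eigen (sF _ FA) W0 (stW _ FA).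
pose W' := (W :&: kermx (A - lam%:M))%MS.
have vW' : (v <= W')%MS.
  by rewrite sub_capmx vW; apply/sub_kermxP; rewrite mulmxBr vA mul_mx_scalar subrr.
have W'0 : W' != 0 by apply/rowV0Pn; exists v.
have W'lt : (\rank W' < k)%N.
  have le : (W' <= W)%MS by exact: capmxSl.
  have lt : (\rank W' < \rank W)%N.
    rewrite ltn_neqAle mxrankS// andbT; apply/negP => e.
    apply: nA; exists lam; have : (W <= kermx (A - lam%:M))%MS.
      apply: submx_trans (capmxSr W _).
      by move: e; rewrite (mxrank_leqif_sup le).
    by move/sub_kermxP/eqP; rewrite mulmxBr mul_mx_scalar subr_eq0 => /eqP.
  exact: leq_trans lt _.
have [|u [u0 uW uF]] := IH W' W'lt W'0.
  move=> B FB; rewrite sub_capmx; apply/andP; split.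
    by apply: submx_trans (stW _ FB); apply: submxMr; exact: capmxSl.
  apply/sub_kermxP; rewrite -mulmxA.
  have -> : B *m (A - lam%:M) = (A - lam%:M) *m B.
    by rewrite mulmxBr mulmxBl (cF _ _ FA FB) scalar_mxC.
  by rewrite mulmxA (sub_kermxP (capmxSr W _)) mul0mx.
exists u; split => //; exact: submx_trans uW (capmxSl _ _).
Qed.

(** Eigenvectors are added one at a time, each taken in the orthogonal complement of the previous
    ones; selfadjointness makes that complement stable. *)
Lemma joint_eigenbasis (F : set 'M[R]_n) :
  (forall A, F A -> A *m M = M *m A^T) -> (forall A B, F A -> F B -> A *m B = B *m A) ->
  exists2 S : 'M[R]_n, S \in unitmx & forall i A, F A -> exists lam : R, row i S *m A = lam *: row i S.
Proof.
move=> sF cF.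
have : forall k, (k <= n)%N -> exists2 S : 'M[R]_(k, n), row_free S &
    forall i A, F A -> exists lam : R, row i S *m A = lam *: row i S.
  elim=> [_|k IH kn].
    by exists 0; [rewrite /row_free mxrank0|case].
  have [S fS hS] := IH (ltnW kn).
  (* The orthogonal complement of the rows of [S], nonzero as long as k < n. *)
  pose W := kermx (M *m S^T).
  have W0 : W != 0.
    rewrite -mxrank_eq0 mxrank_ker subn_eq0 -ltnNge.
    apply: leq_ltn_trans (mxrankM_maxr _ _) _.
    by rewrite mxrank_tr (eqP fS).
  have inW (w : V) : (w <= W)%MS -> forall i, inner M w (row i S) = 0.
    move=> /sub_kermxP h i; rewrite /inner.
    have := congr1 (fun X : 'rV[R]_k => X ord0 i) h; rewrite mulmxA mxE [RHS]mxE => h'.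
    by rewrite mxE -[RHS]h'; apply: eq_bigr => j _; rewrite [(row i S)^T _ _]mxE [row i S _ _]mxE [S^T _ _]mxE.
  have Win (w : V) : (forall i, inner M w (row i S) = 0) -> (w <= W)%MS.
    move=> h; apply/sub_kermxP; apply/rowP => i; rewrite [RHS]mxE -(h i) /inner mulmxA mxE [RHS]mxE.
    by apply: eq_bigr => j _; rewrite [(row i S)^T _ _]mxE [row i S _ _]mxE [S^T _ _]mxE.
  have stW A : F A -> stablemx W A.
    move=> FA; apply/row_subP => i; rewrite row_mul; apply: Win => j.
    rewrite (inner_mulr _ _ (sF _ FA)); have [lam ->] := hS j _ FA.
    by rewrite innerZr inW ?mulr0// row_sub.
  have [v [v0 vW hv]] := common_eigen sF cF W0 stW.
  have fr : row_free (col_mx v S).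
    rewrite -kermx_eq0; apply/rowV0P => u /sub_kermxP.
    rewrite -[u]hsubmxK mul_row_col => E.
    set a := lsubmx u in E *; set b := rsubmx u in E *.
    have av : a *m v = a ord0 ord0 *: v by rewrite [a in LHS]mx11_scalar mul_scalar_mx.
    have Sv : inner M (b *m S) v = 0.
      rewrite innerC// mulmx_sum_row; elim/big_ind : _ => [||i _].
      - by rewrite /inner trmx0 mulmx0 mxE.
      - by move=> x y hx hy; rewrite innerDr hx hy addr0.
      - by rewrite innerZr inW ?mulr0.
    have a0 : a ord0 ord0 = 0.
      have : inner M (a *m v + b *m S) v = 0 by rewrite E /inner !mul0mx mxE.
      rewrite innerDl Sv addr0 av innerZl => /eqP.
      by rewrite mulf_eq0 [inner M v v == 0]gt_eqF ?pM// orbF => /eqP.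
    move: E; rewrite av a0 scale0r add0r => bS.
    have b0 : b = 0.
      have : (b <= kermx S)%MS by apply/sub_kermxP.
      by move: fS; rewrite -kermx_eq0 => /eqP ->; rewrite submx0 => /eqP.
    by rewrite b0 [a]mx11_scalar a0 raddf0 row_mx0.
  exists (col_mx v S) => // i A FA.
  case: (@splitP 1 k i) => j ij.
    have -> : i = @lshift 1 k j by apply: val_inj.
    have [lam E] := hv _ FA; exists lam.
    have -> : row (@lshift 1 k j) (col_mx v S) = v.
      by apply: (etrans (rowKu j v S)); rewrite (ord1 j) row_id.
    exact: E.
  have -> : i = @rshift 1 k j by apply: val_inj.
  have -> : row (@rshift 1 k j) (col_mx v S) = row j S by exact: rowKd.
  exact: hS.
move=> /(_ n (leqnn n))[S fS hS]; exists S => //.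
by rewrite -row_free_unit.
Qed.
End InnerProduct.

(** * Positive definite forms: comparison of norms and orthogonal splitting *)

Section PosDef.
Context {R : realType} {n : nat}.
Let V := 'rV[R]_n.
Variable M : 'M[R]_n.
Hypothesis sM : M^T = M.
Hypothesis pM : forall v : V, v != 0 -> 0 < inner M v v.

Lemma inner0 : inner M (0 : V) 0 = 0. Proof. by rewrite /inner !mul0mx mxE. Qed.

(** k is the minimum of the form on the compact unit sphere of the sup norm, extended by
    homogeneity; when V = 0 any k will do. *)
Lemma posdef_lower_bound : exists2 k : R, 0 < k & forall v : V, k * `|v| ^+ 2 <= inner M v v.
Proof.
have [[v0 hv0]|h] := pselect (exists v : V, v != 0); last first.
  exists 1 => // v; have -> : v = 0 by apply/eqP; apply: contrapT => /negP hv; apply: h; exists v.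
  by rewrite normr0 inner0 expr2 !mulr0.
pose S := [set v : V | `|v| = 1].
have nS (v : V) : v != 0 -> S (`|v|^-1 *: v).
  by move=> hv; rewrite /S /= normrZ normfV normr_id mulVf// normr_eq0.
have S0 : S !=set0 by exists (`|v0|^-1 *: v0); exact: nS.
have cS : compact S.
  apply: bounded_closed_compact.
    exists 1; split; first exact: num_real.
    move=> x x1 v v1; have : `|v| <= x by rewrite v1 ltW.
    exact.
  have -> : S = (fun v : V => `|v|) @^-1` [set 1] by [].
  apply: closed_comp; last exact: closed_eq.
  by move=> v _; exact: norm_continuous.
have cf : {within S, continuous (fun v : V => inner M v v)}.
  apply: continuous_subspaceT => v.
  have := @inner_continuous R n M 1%:M v.
  have -> : (fun w : V => inner M (w *m 1%:M) w) = (fun w : V => inner M w w).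
    by apply/funext => w; rewrite mulmx1.
  exact.
have [v] := EVT_min_rV S0 cS cf; rewrite inE => v1 minv.
have hv : v != 0 by rewrite -normr_eq0 v1 oner_neq0.
exists (inner M v v); first exact: pM.
move=> w; have [->|w0] := eqVneq w 0.
  by rewrite normr0 inner0 expr2 !mulr0.
have nw : 0 < `|w| by rewrite normr_gt0.
have := minv (`|w|^-1 *: w); rewrite inE => /(_ (nS _ w0)).
rewrite innerZl innerZr => h.
rewrite -ler_pdivlMr ?exprn_gt0//; apply: (le_trans h).
by rewrite le_eqVlt; apply/orP; left; apply/eqP; field; rewrite gt_eqF.
Qed.

(** Greedy extraction: a member of B outside the current row space raises the rank, which is at most
    n. The spanning rows thus belong to B itself. *)
Lemma span_rows (B : set V) : exists k (N : 'M[R]_(k, n)),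
  (forall i, B (row i N)) /\ (forall w, B w -> (w <= N)%MS).
Proof.
have : forall d k (N : 'M[R]_(k, n)), (n - \rank N <= d)%N -> (forall i, B (row i N)) ->
    exists k (N : 'M[R]_(k, n)), (forall i, B (row i N)) /\ (forall w, B w -> (w <= N)%MS).
  elim=> [|d IH] k N hd hN.
    exists k, N; split=> // w _; apply: submx_full.
    by rewrite /row_full eqn_leq rank_leq_col -subn_eq0 -leqn0.
  have [h|h] := pselect (forall w, B w -> (w <= N)%MS); first by exists k, N.
  have [w [Bw nw]] : exists w, B w /\ ~~ (w <= N)%MS.
    apply: contrapT => nh; apply: h => w Bw; apply: contrapT => /negP hw; apply: nh.
    by exists w.
  apply: (IH _ (col_mx w N)); last first.
    move=> i; case: (@splitP 1 k i) => j ij.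
      have -> : i = lshift k j by apply: val_inj.
      by rewrite rowKu (ord1 j) row_id.
    have -> : i = rshift 1 j by apply: val_inj.
    by rewrite rowKd.
  have lt : (\rank N < \rank (col_mx w N))%N.
    rewrite ltn_neqAle mxrankS ?andbT; last by rewrite -addsmxE addsmxSr.
    apply/negP => e; apply: (negP nw).
    have : (col_mx w N <= N)%MS.
      by move: e; rewrite (mxrank_leqif_sup _)// -addsmxE addsmxSr.
    by rewrite col_mx_sub => /andP[].
  move: hd; rewrite !leq_subLR => /leq_trans; apply.
  by rewrite addnS -addSn leq_add2r.
by move=> /(_ n 0%N 0); apply=> //; [exact: leq_subr|case].
Qed.

(** By Pythagoras both parts are bounded by Z whatever B is; this makes the estimate on the
    a-component uniform in the set of simple roots. *)
Lemma orthogonal_split (B : set V) (Z : V) : exists k (N : 'M[R]_(k, n)) (Z1 Z2 : V),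
  [/\ (forall i, B (row i N)), Z = Z1 + Z2, (Z2 <= N)%MS,
     inner M Z1 Z1 <= inner M Z Z /\ inner M Z2 Z2 <= inner M Z Z &
     forall w, B w -> inner M Z1 w = 0].
Proof.
have [k [N [hN hB]]] := span_rows B.
pose W := kermx (M *m N^T).
have inW (w u : V) : (w <= W)%MS -> (u <= N)%MS -> inner M w u = 0.
  move=> /sub_kermxP hw /submxP[d ->]; rewrite /inner trmx_mul mulmxA.
  by rewrite -[w *m M *m N^T]mulmxA hw mul0mx mxE.
have full : row_full (N + W)%MS.
  rewrite /row_full eqn_leq rank_leq_col.
  have cap0 : (N :&: W = 0)%MS.
    apply/eqP; apply/rowV0P => v; rewrite sub_capmx => /andP[vN vW].
    exact: (inner_eq0 pM (inW _ _ vW vN)).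
  rewrite mxrank_disjoint_sum// mxrank_ker.
  by rewrite -leq_subLR leq_sub2l// -[leqRHS]mxrank_tr mxrankM_maxr.
have /sub_addsmxP[[u1 u2] /= E] : (Z <= N + W)%MS by exact: submx_full.
exists k, N, (u2 *m W), (u1 *m N).
have o : inner M (u2 *m W) (u1 *m N) = 0 by apply: inW; exact: submxMl.
have EZ : inner M Z Z = inner M (u2 *m W) (u2 *m W) + inner M (u1 *m N) (u1 *m N).
  rewrite E innerDl !innerDr [inner M (u1 *m N) (u2 *m W)]innerC// o; ring.
split => //.
- by rewrite addrC.
- exact: submxMl.
- by rewrite EZ lerDl lerDr !(inner_ge0 pM).
- by move=> w Bw; apply: inW; [exact: submxMl|exact: hB].
Qed.

End PosDef.

(** * The Killing form *)

Section Killing.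
Context {R : realType} {n : nat} (G : lieGroup R n).
Let V := 'rV[R]_n.
Implicit Types (X Y Z : V) (x y : G).
Local Notation "'[Lie' X , Y ]" := (bracket (G := G) X Y).
Local Notation B := (killing (G := G)).

Lemma mul_lin1_mx (T : V -> V) v : linear T -> v *m lin1_mx T = T v.
Proof.
move=> lT; pose L := GRing.isLinear.Build _ _ _ _ _ lT. pose f : {linear _ -> _} := HB.pack T L.
exact: (mul_rV_lin1 f).
Qed.

Lemma lin1_mx_ext (T1 T2 : V -> V) (A : 'M[R]_n) : linear T1 -> (forall v, v *m A = T1 v) -> lin1_mx T1 = A.
Proof.
move=> l1 h; apply/row_matrixP => i; rewrite !rowE; by rewrite mul_lin1_mx.
Qed.

Definition admx X : 'M[R]_n := lin1_mx (fun Y : V => [Lie X, Y]).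

Lemma mul_admx X Y : Y *m admx X = [Lie X, Y].
Proof. by rewrite mul_lin1_mx//; exact: bracket_linr. Qed.

Lemma killingE X Y : B X Y = \tr (admx Y *m admx X).
Proof.
rewrite /killing; congr mxtrace; apply: lin1_mx_ext => //.
  by move=> a u v; rewrite !bracketDr !bracketZr.
by move=> v; rewrite mulmxA !mul_admx.
Qed.

#[local] Opaque admx.

Lemma killingC X Y : B X Y = B Y X.
Proof. by rewrite !killingE mxtrace_mulC. Qed.

Lemma admxD X Y : admx (X + Y) = admx X + admx Y.
Proof. by apply/row_matrixP => i; rewrite !rowE mulmxDr !mul_admx bracketDl. Qed.
Lemma admxZ a X : admx (a *: X) = a *: admx X.
Proof. by apply/row_matrixP => i; rewrite !rowE -scalemxAr !mul_admx bracketZl. Qed.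

Lemma killingDl X Y Z : B (X + Y) Z = B X Z + B Y Z.
Proof. by rewrite !killingE admxD mulmxDr mxtraceD. Qed.
Lemma killingZl a X Z : B (a *: X) Z = a * B X Z.
Proof. by rewrite !killingE admxZ -scalemxAr mxtraceZ. Qed.
Lemma killingDr X Y Z : B Z (X + Y) = B Z X + B Z Y.
Proof. by rewrite killingC killingDl !(killingC Z). Qed.
Lemma killingZr a X Z : B Z (a *: X) = a * B Z X.
Proof. by rewrite killingC killingZl (killingC Z). Qed.

(** The Jacobi identity; the commutator appears in reversed order because matrices act on the
    right. *)
Lemma admx_bracket X Y : admx ([Lie X, Y]) = admx Y *m admx X - admx X *m admx Y.
Proof.
apply/row_matrixP => i; rewrite !rowE mulmxBr !mulmxA !mul_admx.
by rewrite (jacobi G Y _ X) addrK.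
Qed.

Lemma killing_ad Z X Y : B ([Lie Z, X]) Y = - B X ([Lie Z, Y]).
Proof.
have trB (P Q : 'M[R]_n) : \tr (P - Q) = \tr P - \tr Q by rewrite linearB.
have tr W1 W2 (x y z : 'M[R]_n) : W1 = x *m z - z *m x -> W2 = y *m z - z *m y ->
    \tr (y *m W1) = - \tr (W2 *m x).
  move=> -> ->; rewrite mulmxBr mulmxBl !trB opprB.
  by rewrite !mulmxA; congr (_ - _); rewrite [LHS]mxtrace_mulC mulmxA.
rewrite !killingE; exact: (tr _ _ _ _ _ (admx_bracket Z X) (admx_bracket Z Y)).
Qed.

(** An automorphism conjugates the adjoint matrices, and the trace is invariant under
    conjugation. *)
Lemma killing_aut (f f' : V -> V) X Y : linear f -> linear f' -> cancel f f' -> cancel f' f ->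
  (forall X Y, f ([Lie X, Y]) = [Lie f X, f Y]) -> B (f X) (f Y) = B X Y.
Proof.
move=> lf lf' fK f'K fM.
have adf Z : admx (f Z) = lin1_mx f' *m admx Z *m lin1_mx f.
  apply/row_matrixP => i; rewrite !rowE mul_admx !mulmxA (mul_lin1_mx _ lf') mul_admx.
  by rewrite (mul_lin1_mx _ lf) fM f'K.
have ff' : lin1_mx f *m lin1_mx f' = 1%:M.
  by apply/row_matrixP => i; rewrite !rowE mulmx1 mulmxA !mul_lin1_mx// fK.
rewrite !killingE !adf mxtrace_mulC !mulmxA.
rewrite -[_ *m lin1_mx f *m lin1_mx f']mulmxA ff' mulmx1.
rewrite -!mulmxA mxtrace_mulC -!mulmxA ff' mulmx1.
by rewrite mxtrace_mulC.
Qed.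

Lemma Ad_invK x : cancel (Ad x : V -> V) (Ad x^-1%g).
Proof. by move=> X; rewrite -AdM mulVg Ad1. Qed.
Lemma Ad_invVK x : cancel (Ad x^-1%g : V -> V) (Ad x).
Proof. by move=> X; rewrite -AdM mulgV Ad1. Qed.

Lemma killing_Ad x X Y : B (Ad x X) (Ad x Y) = B X Y.
Proof.
apply: (@killing_aut _ (Ad x^-1%g)).
- exact: Ad_linear.
- exact: Ad_linear.
- exact: Ad_invK.
- exact: Ad_invVK.
- exact: Ad_bracket.
Qed.

End Killing.

(** * The linearised equation *)

Section RootDecomposition.
Context {R : realType} {n : nat}.
Let V := 'rV[R]_n.
Variables (br : V -> V -> V) (th sg : V -> V) (M : 'M[R]_n).
Hypothesis brl : forall Y, linear (br^~ Y).
Hypothesis brr : forall X, linear (br X).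
Hypothesis brC : forall X Y, br X Y = - br Y X.
Hypothesis jac : forall X Y Z, br Z (br X Y) = br (br Z X) Y + br X (br Z Y).
Hypotheses (thL : linear th) (sgL : linear sg).
Hypotheses (thK : involutive th) (sgK : involutive sg).
Hypothesis thsg : forall X, th (sg X) = sg (th X).
Hypothesis th_br : forall X Y, th (br X Y) = br (th X) (th Y).
Hypothesis sg_br : forall X Y, sg (br X Y) = br (sg X) (sg Y).
Hypothesis sM : M^T = M.
Hypothesis pM : forall v : V, v != 0 -> 0 < inner M v v.
Hypothesis ip_br : forall X Y Z, inner M (br Z X) Y = - inner M X (br (th Z) Y).

Variable a : {vspace V}.
Hypothesis a_th : forall Y, Y \in a -> th Y = - Y.
Hypothesis a_sg : forall Y, Y \in a -> sg Y = - Y.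
Hypothesis a_ab : forall X Y, X \in a -> Y \in a -> br X Y = 0.
Hypothesis a_max : forall Z, th Z = - Z -> sg Z = - Z -> (forall Y, Y \in a -> br Y Z = 0) -> Z \in a.

Local Notation dual := 'Hom(subvs_of a, R^o).
Definition weight_space (al : dual) (X : V) := forall Y : subvs_of a, br (vsval Y) X = (al Y : R) *: X.
Let tau X := sg (th X).

Lemma lin0 (f : V -> V) : linear f -> f 0 = 0.
Proof. by move=> h; have := h (-1) 0 0; rewrite scaler0 addr0 scaleN1r addNr. Qed.
Lemma linD (f : V -> V) x y : linear f -> f (x + y) = f x + f y.
Proof. by move=> h; have := h 1 x y; rewrite !scale1r. Qed.
Lemma linZ (f : V -> V) k x : linear f -> f (k *: x) = k *: f x.
Proof. by move=> h; have := h k x 0; rewrite !addr0 lin0// addr0. Qed.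
Lemma linN (f : V -> V) x : linear f -> f (- x) = - f x.
Proof. by move=> h; rewrite -scaleN1r linZ// scaleN1r. Qed.

Lemma innerNr u v : inner M u (- v) = - inner M u v.
Proof. by rewrite -scaleN1r innerZr mulN1r. Qed.

Let tauL : linear tau.
Proof. by move=> k u v; rewrite /tau thL sgL. Qed.

Let tauK : involutive tau.
Proof. by move=> X; rewrite /tau -thsg sgK thK. Qed.

Let a_tau Y : Y \in a -> tau Y = Y.
Proof. by move=> Ya; rewrite /tau a_th// linN// a_sg// opprK. Qed.

Lemma weight_th al X : weight_space al X -> weight_space (- al) (th X).
Proof.
move=> h Y; have Ya := subvsP Y.
have E : vsval Y = - th (vsval Y) by rewrite a_th// opprK.
rewrite {1}E (linN _ (brl _)) -th_br h linZ// lfunE /= scaleNr//.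
Qed.

(** [tau] is the identity on a, hence commutes with ad(a); this splits every weight space into its
    parts e = 1 and e = -1. *)
Lemma weight_tau al X : weight_space al X -> weight_space al (tau X).
Proof.
move=> h Y; have Ya := subvsP Y.
rewrite -{1}(a_tau Ya) /tau -sg_br -th_br h [th _]linZ// linZ//.
Qed.

Lemma weightD al X Y : weight_space al X -> weight_space al Y -> weight_space al (X + Y).
Proof. by move=> h1 h2 Z; rewrite linD// h1 h2 scalerDr. Qed.
Lemma weightZ al k X : weight_space al X -> weight_space al (k *: X).
Proof. by move=> h1 Z; rewrite linZ// h1 !scalerA mulrC. Qed.
Lemma weightB al X Y : weight_space al X -> weight_space al Y -> weight_space al (X - Y).
Proof. by move=> h1 h2; rewrite -scaleN1r; apply: weightD => //; exact: weightZ. Qed.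

(** For Y in a, theta Y = -Y makes ad(Y) selfadjoint for M, and these maps commute by the Jacobi
    identity, so they have a joint eigenbasis. *)
Lemma weight_basis : exists S : 'M[R]_n, exists2 w : 'I_n -> dual,
  S \in unitmx & forall i, weight_space (w i) (row i S).
Proof.
pose ad X : 'M[R]_n := lin1_mx (br X).
have mul_ad X Y : Y *m ad X = br X Y by exact: mul_lin1_mx (brr X).
have [|| S uS hS] := @joint_eigenbasis R n M sM pM [set ad X | X in [set X | X \in a]].
- move=> _ [X /= Xa <-].
  apply/matrixP => i j.
  have E (N : 'M[R]_n) : N i j = ((delta_mx ord0 i : V) *m N *m (delta_mx ord0 j : V)^T) ord0 ord0.
    have e : (delta_mx ord0 i : V) *m N = row i N by exact: esym (rowE i N).
    by rewrite e trmx_delta; have -> := esym (colE j (row i N)); rewrite !mxE.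
  rewrite E mulmxA mul_ad -[LHS]/(inner M (br X (delta_mx ord0 i)) (delta_mx ord0 j)).
  rewrite ip_br a_th// (linN _ (brl _)) innerNr opprK.
  by rewrite E /inner -(mul_ad X (delta_mx ord0 j)) trmx_mul !mulmxA.
- move=> _ _ [X /= Xa <-] [Y /= Ya <-].
  apply/row_matrixP => i; rewrite !rowE !mulmxA !mul_ad.
  by rewrite (jac _ _ Y) (a_ab Ya Xa) (lin0 (brl _)) add0r.
have ex i : exists al : dual, weight_space al (row i S).
  have r0 : row i S != 0.
    apply/eqP => h; have := row_free_inj; have := uS; rewrite -row_free_unit -kermx_eq0 => /eqP k0 _.
    have : ((delta_mx ord0 i : V) <= kermx S)%MS by apply/sub_kermxP; apply: (etrans (esym (rowE i S))).
    rewrite k0 submx0 => /eqP /matrixP /(_ ord0 i); rewrite !mxE !eqxx => /eqP.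
    by rewrite oner_eq0.
  have [j nj] : exists j, row i S ord0 j != 0.
    apply: contrapT => h; move/eqP: r0; apply; apply/rowP => j; rewrite [RHS]mxE.
    by apply/eqP; apply: contrapT => /negP h2; apply: h; exists j.
  pose f (Y : subvs_of a) : R^o := br (vsval Y) (row i S) ord0 j / row i S ord0 j.
  have fL : linear f.
    move=> k X Y; rewrite /f linearP brl mxE mxE mulrDl -mulrA; congr (_ + _).
  pose L := GRing.isLinear.Build _ _ _ _ f fL. pose fl : {linear _ -> _} := HB.pack f L.
  exists (linfun fl) => Y; rewrite lfunE /= /f.
  have [lam] := hS i (ad (vsval Y)) ltac:(by exists (vsval Y) => //=; exact: subvsP).
  by rewrite mul_ad => ->; rewrite mxE mulfK.
exists S; exists (fun i => xget 0 [set al | weight_space al (row i S)]) => // i.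
exact: (xgetPex 0 (ex i)).
Qed.

Variables (Pt : set dual) (X0 : subvs_of a).
Hypothesis Pt_pos : forall al, Pt al -> 0 < (al X0 : R).
Hypothesis Pt_vec : forall al, Pt al -> exists X, [/\ X != 0, weight_space al X & tau X = X].
Hypothesis Pt_or : forall al X, al != 0 -> X != 0 -> weight_space al X -> tau X = X -> Pt al \/ Pt (- al).
Variable c : R.
Hypothesis c0 : 0 < c.

(** Compared in the weight basis, the eigenvalues on X must be those of any basis vector occurring
    in X. There are thus finitely many weights, whence a measure for induction on roots. *)
Lemma weight_in_basis (S : 'M[R]_n) (w : 'I_n -> dual) al X :
  S \in unitmx -> (forall i, weight_space (w i) (row i S)) ->
  X != 0 -> weight_space al X -> exists i, al = w i.
Proof.
move=> uS hw nX hX.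
have fS : row_free S by rewrite row_free_unit.
have EX : X = (X *m invmx S) *m S by rewrite mulmxKV.
move: (X *m invmx S) EX => d EX.
have [i ni] : exists i, d ord0 i != 0.
  apply: contrapT => h; move/eqP: nX; apply; rewrite EX.
  have -> : d = 0; last by rewrite mul0mx.
  apply/rowP => i; rewrite [RHS]mxE; apply/eqP; apply: contrapT => /negP h2; apply: h; by exists i.
exists i; apply/lfunP => Y.
have h1 : br (vsval Y) X = \row_j ((w j Y : R) * d ord0 j) *m S.
  rewrite {1}EX !mulmx_sum_row.
  rewrite (_ : br (vsval Y) _ = \sum_j d ord0 j *: br (vsval Y) (row j S)).
    by apply: eq_bigr => j _; rewrite hw !mxE scalerA mulrC.
  elim/big_ind2 : _ => [|x y x' y' <- <-|j _].
  - exact: lin0.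
  - exact: linD.
  - exact: linZ.
have h2 : br (vsval Y) X = ((al Y : R) *: d) *m S by rewrite hX {1}EX scalemxAl.
have /(row_free_inj fS) /rowP /(_ i) : ((al Y : R) *: d) *m S = \row_j ((w j Y : R) * d ord0 j) *m S by rewrite -h1 -h2.
by rewrite !mxE => h; apply: (mulIf ni); exact: h.
Qed.

Local Notation Delta := (simple_roots Pt).

(** A positive root is a sum of simple ones, all nonnegative on X. Either all of them lie in I, and
    the root is in the span, or one is outside and alone contributes more than c. *)
Lemma root_dichotomy (I : set dual) (X : subvs_of a) : closed_chamber Pt X ->
  (forall al, (Delta `\` I) al -> c < (al X : R)) ->
  forall be, Pt be -> in_span I be \/ c < (be X : R).
Proof.
move=> hX hI be.
have [S [w uS hw]] := weight_basis.
(* Termination measure: the number of basis weights below [be] at the regular element [X0]. It drops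
   for a summand g of [be], since g is itself a basis weight, counted for [be] but not for g. *)
pose N (be : dual) := #|[pred i : 'I_n | (w i X0 : R) < be X0]|.
have [k] := ubnP (N be); elim: k be => // k IH be.
rewrite ltnS => Nk Pbe.
have [sb|nsb] := pselect (Delta be).
  have [Ib|nI] := pselect (I be); first by left => U; apply.
  by right; apply: hI.
have [g [d [Pg Pd E]]] : exists g d, [/\ Pt g, Pt d & be = g + d].
  apply: contrapT => h; apply: nsb; split => // -[g [d hgd]]; apply: h; by exists g, d.
have NN g' d' : Pt g' -> Pt d' -> be = g' + d' -> (N g' < N be)%N.
  move=> Pg' Pd' E'; apply: proper_card; apply/fintype.properP.
  have lt : (g' X0 : R) < be X0 by rewrite E' lfunE /= ltrDl; exact: Pt_pos.
  split.
    by apply/fintype.subsetP => i; rewrite !inE => /lt_trans; apply.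
  have [Y [nY hY _]] := Pt_vec Pg'; have [i Ei] := weight_in_basis uS hw nY hY.
  by exists i; rewrite !inE -Ei// ltxx.
have h1 := IH g (leq_trans (NN _ _ Pg Pd E) Nk) Pg.
have h2 := IH d (leq_trans (NN d g Pd Pg ltac:(by rewrite addrC)) Nk) Pd.
have p1 := hX _ Pg; have p2 := hX _ Pd.
have EX : (be X : R) = g X + d X by rewrite E lfunE.
case: h1 => h1; last by right; rewrite EX; apply: lt_le_trans h1 _; rewrite lerDl.
case: h2 => h2; last by right; rewrite EX; apply: lt_le_trans h2 _; rewrite lerDr.
by left => U hU; rewrite E rpredD// ?h1 ?h2.
Qed.

Definition levi_gen (I : set dual) : set V := [set X | tau X = X /\
  exists be, [/\ Pt be, in_span I be & weight_space be X \/ weight_space (- be) X]].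

Definition levi_alg (I : set dual) : set V := [set X | forall U : {vspace V},
  (forall X Y, X \in U -> Y \in U -> br X Y \in U) -> (forall Y, levi_gen I Y -> Y \in U) -> X \in U].

(* [T] stands for Ad(exp X); the bound [C] is uniform in [I] and [X]. *)
Definition good (Z : V) := exists C : R, forall (I : set dual) (X : subvs_of a) (T : V -> V),
  I `<=` Delta -> closed_chamber Pt X -> (forall al, (Delta `\` I) al -> c < (al X : R)) ->
  linear T -> (forall Y lam, br (vsval X) Y = lam *: Y -> T Y = expR lam *: Y) ->
  exists k m (y : subvs_of a) h,
  [/\ th k = k, levi_alg I m, (forall al, I al -> (al y : R) = 0), sg h = h &
  [/\ `|k| <= C, `|m| <= C, `|vsval y| <= C, `|h| <= C & `|T h| <= C /\ Z = k + m + vsval y + T h]].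

Lemma levi_alg0 I : levi_alg I 0. Proof. by move=> U _ _; rewrite mem0v. Qed.
Lemma levi_algD I X Y : levi_alg I X -> levi_alg I Y -> levi_alg I (X + Y).
Proof. by move=> h1 h2 U hU1 hU2; rewrite rpredD ?h1 ?h2. Qed.
Lemma levi_algZ I k X : levi_alg I X -> levi_alg I (k *: X).
Proof. by move=> h1 U hU1 hU2; rewrite rpredZ ?h1. Qed.

Lemma goodD Z1 Z2 : good Z1 -> good Z2 -> good (Z1 + Z2).
Proof.
move=> [C1 h1] [C2 h2]; exists (C1 + C2) => I X T I1 I2 I3 I4 I5.
have [k1 [m1 [y1 [l1 [a1 b1 d1 e1 [f1 g1 i1 j1 [n1 E1]]]]]]] := h1 I X T I1 I2 I3 I4 I5.
have [k2 [m2 [y2 [l2 [a2 b2 d2 e2 [f2 g2 i2 j2 [n2 E2]]]]]]] := h2 I X T I1 I2 I3 I4 I5.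
exists (k1 + k2), (m1 + m2), (y1 + y2), (l1 + l2); split.
- by rewrite linD// a1 a2.
- exact: levi_algD.
- by move=> al Ia; rewrite linearD /= d1// d2// addr0.
- by rewrite linD// e1 e2.
have tri (x y : V) : `|x| <= C1 -> `|y| <= C2 -> `|x + y| <= C1 + C2.
  by move=> hx hy; apply: le_trans (ler_normD _ _) _; exact: lerD.
split; [exact: tri|exact: tri|by rewrite linearD; exact: tri|exact: tri|].
rewrite linD//; split; first exact: tri.
rewrite linearD /=; move: (T l1) (T l2) E1 E2 => p q -> ->.
move: (vsval y1) (vsval y2) => v1 v2; apply/rowP => i; rewrite !mxE; ring.
Qed.

Lemma goodZ s Z : good Z -> good (s *: Z).
Proof.
move=> [C h]; exists (`|s| * C) => I X T I1 I2 I3 I4 I5.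
have [k1 [m1 [y1 [l1 [a1 b1 d1 e1 [f1 g1 i1 j1 [n1 E1]]]]]]] := h I X T I1 I2 I3 I4 I5.
exists (s *: k1), (s *: m1), (s *: y1), (s *: l1); split.
- by rewrite linZ// a1.
- exact: levi_algZ.
- by move=> al Ia; rewrite linearZ /= d1// scaler0.
- by rewrite linZ// e1.
have tri (x : V) : `|x| <= C -> `|s *: x| <= `|s| * C.
  by move=> hx; rewrite normrZ ler_wpM2l.
split; [exact: tri|exact: tri|by rewrite linearZ; exact: tri|exact: tri|].
rewrite linZ//; split; first exact: tri.
by rewrite E1 linearZ /= !scalerDr.
Qed.

Lemma good_th Z : th Z = Z -> good Z.
Proof.
move=> hZ; exists `|Z| => I X T _ _ _ TL _; exists Z, 0, 0, 0; split => //.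
- exact: levi_alg0.
- by move=> al _; rewrite linear0.
- exact: lin0.
by rewrite lin0// !linear0 !normr0; split => //; split => //; rewrite !addr0.
Qed.

Lemma good0 : good 0. Proof. by apply: good_th; exact: lin0. Qed.

Lemma good_sum (J : finType) (f : J -> V) : (forall i, good (f i)) -> good (\sum_i f i).
Proof. by move=> h; elim/big_ind : _ => [|x y|i _]; [exact: good0|exact: goodD|exact: h]. Qed.

(** An element centralising a is fixed by Ad(exp X), so it serves as its own h. *)
Lemma good_sg Z : sg Z = Z -> (forall Y, Y \in a -> br Y Z = 0) -> good Z.
Proof.
move=> hZ hc; exists `|Z| => I X T _ _ _ TL TE; exists 0, 0, 0, Z; split => //.
- exact: lin0.
- exact: levi_alg0.
- by move=> al _; rewrite linear0.
have -> : T Z = Z.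
  by rewrite (TE Z 0) ?expR0 ?scale1r// scale0r hc// subvsP.
by rewrite !linear0 !normr0; split => //; split => //; rewrite !add0r.
Qed.

(** [X, theta X] is odd under both involutions and centralises a, hence lies in a by maximality;
    invariance of the form shows that it is a nonzero multiple of the vector dual to [al]. *)
Lemma coroot al X : X != 0 -> weight_space al X -> tau X = X ->
  br X (th X) \in a /\ forall Y : subvs_of a,
     inner M (vsval Y) (br X (th X)) = - (al Y : R) * inner M X X.
Proof.
move=> nX hX tX.
have sX : sg X = th X by rewrite -{1}tX /tau sgK.
have sthX : sg (th X) = X by exact: tX.
split.
  apply: a_max.
  - by rewrite th_br thK brC.
  - by rewrite sg_br sX sthX brC.
  move=> Y Ya; have := hX (vsproj a Y); have := weight_th hX (vsproj a Y).
  rewrite /= => h1 h2; rewrite jac.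
  move: h1 h2; rewrite !(vsprojK Ya) => -> ->.
  by rewrite linZ// [br (_ *: _) _](linZ _ _ (brl _)) lfunE /= scaleNr subrr.
move=> Y; rewrite brC innerNr innerC// ip_br thK.
rewrite (brC X) hX innerNr innerZr; ring.
Qed.

(** Orthogonal splitting along the coroots of I: the component in their span lies in the Levi
    algebra, and the component orthogonal to them is annihilated by every root of I. *)
Lemma good_a Z : Z \in a -> good Z.
Proof.
move=> Za; have [k k0 hk] := posdef_lower_bound pM.
(* Uses that x^2 <= q implies x <= q + 1, which avoids a square root. *)
pose C := inner M Z Z / k + 1.
have Cb v : inner M v v <= inner M Z Z -> `|v| <= C.
  move=> h; have h2 := le_trans (hk v) h.
  have h3 : `|v| ^+ 2 <= inner M Z Z / k by rewrite ler_pdivlMr// mulrC.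
  have := normr_ge0 v; rewrite /C; set x := `|v| in h3 * => x0.
  have := sqr_ge0 (x - 1); nra.
exists C => I X T ID _ _ TL _.
(* Multiples of the vectors dual to the roots of I that are known to lie in both a and the Levi
   algebra. *)
pose B : set V := [set w | [/\ w \in a, levi_alg I w & exists2 al : dual, I al &
  exists2 k : R, k != 0 & forall Y : subvs_of a, inner M (vsval Y) w = k * (al Y : R)]].
have [d [N [Z1 [Z2 [hN EZ ZN [n1 n2] oZ]]]]] := orthogonal_split sM pM B Z.
have Z2P : Z2 \in a /\ levi_alg I Z2.
  have /submxP[e ->] := ZN; rewrite mulmx_sum_row; elim/big_ind : _ => [|x y [x1 x2] [y1 y2]|i _].
  - by split; [exact: mem0v|exact: levi_alg0].
  - by split; [exact: rpredD|exact: levi_algD].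
  - by have [b1 b2 _] := hN i; split; [exact: rpredZ|exact: levi_algZ].
have Z1a : Z1 \in a.
  have -> : Z1 = Z - Z2 by rewrite EZ addrK.
  by rewrite rpredB// Z2P.1.
have I1 al : I al -> (al (vsproj a Z1) : R) = 0.
  move=> Ial; have Pal := (ID _ Ial).1; have [W [nW hW tW]] := Pt_vec Pal.
  have [Ha HY] := coroot nW hW tW.
  have nn : - inner M W W != 0 by rewrite oppr_eq0 gt_eqF// pM.
  (* W and theta W are tau-fixed root vectors for [al] and [- al], both generators of the Levi
     algebra, so their bracket belongs to it. *)
  have BH : B (br W (th W)).
    split => //.
      have gW : levi_gen I W.
        by split => //; exists al; split => //; [move=> U; apply|left].
      have gtW : levi_gen I (th W).
        split; first by rewrite /tau -thsg; exact: (congr1 th tW).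
        by exists al; split => //; [move=> U; apply|right; exact: weight_th].
      by move=> U hU1 hU2; apply: hU1; apply: hU2.
    exists al => //; exists (- inner M W W) => // Y; rewrite HY; ring.
  have := oZ _ BH; have := HY (vsproj a Z1); rewrite (vsprojK Z1a) => -> /eqP.
  by rewrite mulf_eq0 oppr_eq0 [inner M W W == 0]gt_eqF ?pM// orbF => /eqP.
exists 0, Z2, (vsproj a Z1), 0; split => //.
- exact: lin0.
- exact: Z2P.2.
- exact: lin0.
rewrite lin0// (vsprojK Z1a) !normr0.
have C0 : 0 <= C by apply: le_trans (normr_ge0 Z2) (Cb _ n2).
by split => //; [exact: Cb|exact: Cb|split => //; rewrite add0r addr0 EZ addrC].
Qed.

(** The centraliser of a is stable under both involutions. The theta-even part goes to Lie K, the
    theta-odd sigma-even part to Lie H, and the doubly odd part falls into a by maximality. *)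
Lemma good_weight0 Z : (forall Y, Y \in a -> br Y Z = 0) -> good Z.
Proof.
move=> hZ.
have cth W : (forall Y, Y \in a -> br Y W = 0) -> forall Y, Y \in a -> br Y (th W) = 0.
  move=> h Y Ya; have E : Y = - th Y by rewrite a_th// opprK.
  by rewrite E (linN _ (brl _)) -th_br h// lin0// oppr0.
have csg W : (forall Y, Y \in a -> br Y W = 0) -> forall Y, Y \in a -> br Y (sg W) = 0.
  move=> h Y Ya; have E : Y = - sg Y by rewrite a_sg// opprK.
  by rewrite E (linN _ (brl _)) -sg_br h// lin0// oppr0.
have -> : Z = 2^-1 *: (Z + th Z) + 2^-1 *: (Z - th Z).
  by apply/rowP => i; rewrite !mxE; field.
apply: goodD; apply: goodZ; first by apply: good_th; rewrite linD// thK addrC.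
set W := Z - th Z.
have tW : th W = - W by rewrite /W linD// linN// thK opprB addrC.
have hW Y : Y \in a -> br Y W = 0 by move=> Ya; rewrite linD// linN// hZ// cth// subr0.
clearbody W.
have -> : W = 2^-1 *: (W + sg W) + 2^-1 *: (W - sg W).
  by apply/rowP => i; rewrite !mxE; field.
apply: goodD; apply: goodZ.
  apply: good_sg; first by rewrite linD// sgK addrC.
  by move=> Y Ya; rewrite linD// hW// csg// addr0.
apply: good_a; apply: a_max.
- by rewrite linD// (linN _ thL) thsg tW (linN _ sgL) opprK opprB addrC.
- by rewrite linD// linN// sgK opprB addrC.
- by move=> Y Ya; rewrite linD// linN// hW// csg// subr0.
Qed.

Lemma good_root al e Z : al != 0 -> weight_space al Z -> (e = 1 \/ e = -1) -> tau Z = e *: Z -> good Z.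
Proof.
move=> nal hZ he tZ.
have [->|nZ] := eqVneq Z 0; first exact: good0.
(* If |t| > c, then exp(-|t|) <= d exp(|t|), so |2 sinh t| is at least (1 - d) exp(|t|); hence the
   bound (1 - d)^-1. The extra 1 in K covers the cosh case and gives K >= 1. *)
pose d := expR (- (2 * c)).
have d1 : 0 < 1 - d by rewrite subr_gt0 /d -expR0 ltr_expR oppr_lt0 mulr_gt0.
pose K := (1 - d)^-1 + 1.
have K0 : 0 <= (1 - d)^-1 by rewrite invr_ge0 ltW.
exists (2 * K * (`|Z| + `|th Z|)) => I X T ID hX hI TL TE.
have nn : `|Z| <= 2 * K * (`|Z| + `|th Z|).
  have z0 := normr_ge0 Z; have t0 := normr_ge0 (th Z); rewrite /K; nra.
have n0 : 0 <= 2 * K * (`|Z| + `|th Z|) by apply: le_trans nn.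
have sZ : sg Z = e *: th Z.
  by rewrite -[Z in sg Z](thK Z) -thsg -linZ// -tZ /tau thsg.
(* Roots in the span of I are put into the Levi part before anything is divided by sinh. *)
have [[e1 [be [Pbe Ibe hbe]]]|nI] := pselect (e = 1 /\ exists be, [/\ Pt be, in_span I be & be = al \/ be = - al]).
  exists 0, Z, 0, 0; split.
  - exact: lin0.
  - move=> U _; apply; split; first by rewrite tZ e1 scale1r.
    by exists be; split => //; case: hbe => ->; [left|right; rewrite opprK].
  - by move=> b _; rewrite linear0.
  - exact: lin0.
  by rewrite lin0// !linear0 !normr0; split => //; split => //; rewrite add0r !addr0.
pose t : R := al X.
pose D := expR t - e * expR (- t).
have ep := expR_gt0 t; have em := expR_gt0 (- t).
have prod1 : expR t * expR (- t) = 1 by rewrite -expRD subrr expR0.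
(* [D = 2 sinh t] or [2 cosh t], bounded away from 0 relative to [expR |t|] *)
have bD : [/\ D != 0, `|D^-1| <= K, `|D^-1 * expR t| <= K & `|D^-1 * expR (- t)| <= K].
  (* Here p is the larger of the two exponentials; for t < 0 the roles are exchanged and the sign of
     the difference changes. *)
  have gen (p q : R) : 0 < p -> 0 < q -> p * q = 1 -> q <= d * p -> [/\ p - q != 0, `|(p - q)^-1| <= K,
     `|(p - q)^-1 * p| <= K & `|(p - q)^-1 * q| <= K].
    move=> p0 q0 pq qd.
    have d0 : 0 < d by exact: expR_gt0.
    have pq1 : q <= p by apply: le_trans qd _; rewrite ler_piMl ?(ltW p0)//; lra.
    have p1 : 1 <= p by rewrite leNgt; apply/negP => p1; nra.
    have dp : (1 - d) * p <= p - q by lra.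
    have pqp : 0 < p - q by apply: lt_le_trans dp; rewrite mulr_gt0.
    have i1 : (p - q)^-1 * p <= (1 - d)^-1.
      by rewrite mulrC ler_pdivrMr// mulrC ler_pdivlMr// mulrC.
    have iv : 0 < (p - q)^-1 by rewrite invr_gt0.
    have i2 : (p - q)^-1 <= (p - q)^-1 * p by rewrite ler_peMr// ltW.
    have i3 : (p - q)^-1 * q <= (p - q)^-1 * p by rewrite ler_wpM2l// ltW.
    split; first by rewrite gt_eqF.
    - by rewrite gtr0_norm// /K; lra.
    - by rewrite gtr0_norm ?mulr_gt0// /K; lra.
    - by rewrite gtr0_norm ?mulr_gt0// /K; lra.
  case: he => e1.
    have pm : Pt al \/ Pt (- al) by apply: Pt_or nZ hZ _ => //; rewrite tZ e1 scale1r.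
    have ct : c < t \/ c < - t.
      case: pm => Pal.
        case: (root_dichotomy hX hI Pal) => h; last by left.
        by exfalso; apply: nI; split => //; exists al; split => //; left.
      case: (root_dichotomy hX hI Pal) => h; last by right; move: h; rewrite lfunE.
      by exfalso; apply: nI; split => //; exists (- al); split => //; right.
    rewrite /D e1 mul1r; case: ct => ct.
      apply: gen => //; rewrite /d -expRD ler_expR; lra.
    have [||||g1 g2 g3 g4] := gen (expR (- t)) (expR t) => //.
    - by rewrite mulrC.
    - by rewrite /d -expRD ler_expR; lra.
    have -> : expR t - expR (- t) = - (expR (- t) - expR t) by rewrite opprB.
    by rewrite oppr_eq0 invrN !mulNr !normrN.
  (* Case e = -1: the chamber gives no information on this weight, and p + q >= 1 holds for every t
     because p q = 1. *)
  rewrite /D e1 mulN1r opprK; set p := expR t in ep prod1 *; set q := expR (- t) in em prod1 *.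
  have s0 : 0 < p + q by rewrite addr_gt0.
  have iv : 0 < (p + q)^-1 by rewrite invr_gt0.
  have bp : (p + q)^-1 * p <= 1 by rewrite mulrC ler_pdivrMr// mul1r lerDl ltW.
  have bq : (p + q)^-1 * q <= 1 by rewrite mulrC ler_pdivrMr// mul1r lerDr ltW.
  have b1 : (p + q)^-1 <= 1.
    rewrite invf_le1//; have := sqr_ge0 (p - q); nra.
  split; first by rewrite gt_eqF.
  - by rewrite gtr0_norm// /K; lra.
  - by rewrite gtr0_norm ?mulr_gt0// /K; lra.
  - by rewrite gtr0_norm ?mulr_gt0// /K; lra.
have [D0 k1 k2 k3] := bD.
(* Chosen so that u (Z + theta Z) + T h = Z: on theta Z the coefficients cancel, on Z they add up to
   s D = 1. *)
pose s := D^-1; pose u := - (e * (s * expR (- t))).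
have TZ : T Z = expR t *: Z by apply: TE; exact: hZ.
have TtZ : T (th Z) = expR (- t) *: th Z.
  by apply: TE; rewrite (weight_th hZ) lfunE.
pose h := s *: (Z + e *: th Z).
have Th : T h = (s * expR t) *: Z + (e * (s * expR (- t))) *: th Z.
  rewrite /h linZ// linD// linZ// TZ TtZ scalerDr !scalerA; congr (_ + _); congr (_ *: _); ring.
have ae : `|e| = 1 by case: he => ->; rewrite ?normrN normr1.
have z0 := normr_ge0 Z; have t0 := normr_ge0 (th Z).
have K1 : 1 <= K by rewrite /K; lra.
have comb (x y : R) : `|x| <= K -> `|y| <= K -> `|x *: Z + y *: th Z| <= 2 * K * (`|Z| + `|th Z|).
  move=> hx hy; apply: le_trans (ler_normD _ _) _; rewrite !normrZ.
  have h1 : `|x| * `|Z| <= K * `|Z| by rewrite ler_wpM2r.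
  have h2 : `|y| * `|th Z| <= K * `|th Z| by rewrite ler_wpM2r.
  have h3 : 0 <= K * (`|Z| + `|th Z|) by rewrite mulr_ge0 ?addr_ge0//; lra.
  lra.
exists (u *: (Z + th Z)), 0, 0, h; split.
- by rewrite linZ// linD// thK addrC.
- exact: levi_alg0.
- by move=> b _; rewrite linear0.
- rewrite /h linZ// linD// linZ// sZ; congr (_ *: _).
  have -> : sg (th Z) = e *: Z by exact: tZ.
  have ee : e * e = 1 by case: he => ->; rewrite ?mulrNN mulr1.
  by rewrite scalerA ee scale1r addrC.
have nu : `|u| <= K by rewrite /u normrN normrM ae mul1r.
rewrite !linear0 !normr0; split => //.
- by rewrite scalerDr; exact: comb.
- rewrite /h scalerDr scalerA; apply: comb => //.
  by rewrite normrM ae mulr1.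
split.
  by rewrite Th; apply: comb => //; rewrite normrM ae mul1r.
rewrite Th !addr0 scalerDr; apply/rowP => i; rewrite !mxE /u.
have -> : s * expR t = 1 + e * (s * expR (- t)).
  have : s * D = 1 by rewrite mulVf.
  rewrite /D; lra.
ring.
Qed.

Lemma good_all Z : good Z.
Proof.
have [S [w uS hw]] := weight_basis.
have -> : Z = (Z *m invmx S) *m S by rewrite mulmxKV.
rewrite mulmx_sum_row; apply: good_sum => i; apply: goodZ.
set r := row i S; have hr : weight_space (w i) r by exact: hw.
have [w0|nw] := eqVneq (w i) 0.
  apply: good_weight0 => Y Ya; have := hr (vsproj a Y).
  by rewrite (vsprojK Ya) w0 lfunE scale0r.
have -> : r = 2^-1 *: (r + tau r) + 2^-1 *: (r - tau r).
  by apply/rowP => j; rewrite !mxE; field.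
apply: goodD; apply: goodZ.
  apply: (good_root nw (e := 1)); [apply: weightD => //; exact: weight_tau|by left|].
  by rewrite scale1r linD// tauK addrC.
apply: (good_root nw (e := -1)); [apply: weightB => //; exact: weight_tau|by right|].
by rewrite scaleN1r linD// linN// tauK opprB addrC.
Qed.

(** Decomposing only the basis vectors and extending linearly gives a solution that is linear in w,
    so its bounds become Lipschitz bounds. The constants [C j] are chosen before I and X, the
    decompositions after them. *)
Lemma good_uniform : exists2 C : R, 0 < C & forall (I : set dual) (X : subvs_of a) (T : V -> V),
  I `<=` Delta -> closed_chamber Pt X -> (forall al, (Delta `\` I) al -> c < (al X : R)) ->
  linear T -> (forall Y lam, br (vsval X) Y = lam *: Y -> T Y = expR lam *: Y) ->
  exists N : 'I_4 -> 'M[R]_n, forall w : V,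
  [/\ th (w *m N 0) = w *m N 0, levi_alg I (w *m N 1),
     (exists2 y : subvs_of a, (forall al, I al -> (al y : R) = 0) & vsval y = w *m N 2),
     sg (w *m N 3) = w *m N 3 &
  [/\ forall i, `|w *m N i| <= C * `|w|, `|T (w *m N 3)| <= C * `|w| &
     w *m N 0 + w *m N 1 + w *m N 2 + T (w *m N 3) = w]].
Proof.
have [C hC] := choice (fun j : 'I_n => good_all (delta_mx 0 j)).
exists (\sum_j `|C j| + 1); first by rewrite ltr_wpDl// sumr_ge0.
move=> I X T I1 I2 I3 TL I5.
have D j : exists d : V * V * subvs_of a * V,
  [/\ th d.1.1.1 = d.1.1.1, levi_alg I d.1.1.2, (forall al, I al -> (al d.1.2 : R) = 0), sg d.2 = d.2 &
  [/\ `|d.1.1.1| <= C j, `|d.1.1.2| <= C j, `|vsval d.1.2| <= C j, `|d.2| <= C j &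
    `|T d.2| <= C j /\ delta_mx 0 j = d.1.1.1 + d.1.1.2 + vsval d.1.2 + T d.2]].
  by have [k [m [y [h H]]]] := hC j I X T I1 I2 I3 TL I5; exists (k, m, y, h).
have [d hd] := choice D.
pose f (i : 'I_4) j := nth 0 [:: (d j).1.1.1; (d j).1.1.2; vsval (d j).1.2; (d j).2] i.
exists (fun i => \matrix_j f i j) => w.
have E i : w *m (\matrix_j f i j) = \sum_j w ord0 j *: f i j.
  by rewrite mulmx_sum_row; apply: eq_bigr => j _; rewrite rowK.
have bnd (g : 'I_n -> V) : (forall j, `|g j| <= C j) -> `|\sum_j w ord0 j *: g j| <= (\sum_j `|C j| + 1) * `|w|.
  move=> hg; apply: le_trans (ler_norm_sum _ _ _) _.
  apply: (@le_trans _ _ (\sum_j `|C j| * `|w|)).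
    apply: ler_sum => j _; rewrite normrZ mulrC.
    by apply: ler_pM => //; [exact: le_trans (hg j) (ler_norm _)|exact: coord_le_norm].
  by rewrite -mulr_suml ler_wpM2r// lerDl.
have sum_lin (F : V -> V) (g : 'I_n -> V) : linear F -> F (\sum_j w ord0 j *: g j) = \sum_j w ord0 j *: F (g j).
  move=> FL; elim/big_ind2 : _ => [|x x' y y' <- <-|j _]; [exact: lin0|by rewrite linD|by rewrite linZ].
rewrite !E; split.
- by rewrite sum_lin//; apply: eq_bigr => j _; have [-> _ _ _ _] := hd j.
- elim/big_ind : _ => [|x y|j _]; [exact: levi_alg0|exact: levi_algD|].
  by apply: levi_algZ; have [] := hd j.
- exists (\sum_j w ord0 j *: (d j).1.2); last by rewrite linear_sum; apply: eq_bigr => j _; rewrite linearZ.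
  move=> al Ial; rewrite linear_sum /= big1// => j _; rewrite linearZ /=.
  by have [_ _ -> //] := hd j; rewrite scaler0.
- by rewrite sum_lin//; apply: eq_bigr => j _; have [_ _ _ -> _] := hd j.
split.
- move=> i; rewrite E; apply: bnd => j; have [_ _ _ _ [h1 h2 h3 h4 _]] := hd j.
  by case: i => [[|[|[|[|//]]]] hi].
- rewrite sum_lin//; apply: bnd => j; have [_ _ _ _ [_ _ _ _ []]] := hd j; exact.
rewrite (sum_lin T)// -!big_split /=; transitivity (\sum_j w ord0 j *: (delta_mx 0 j : V)).
  apply: eq_bigr => j _; rewrite -!scalerDr; have [_ _ _ _ [_ _ _ _ [_ ->]]] := hd j.
  by [].
by rewrite -row_sum_delta.
Qed.

End RootDecomposition.

(** * Riemannian balls in coordinates *)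

Section InnerSum.
Context {R : realType} {n : nat}.
Implicit Types (N : 'M[R]_n) (v w : 'rV[R]_n).

Lemma inner_sum N v w : inner N v w = \sum_i \sum_j v ord0 i * w ord0 j * N i j.
Proof.
rewrite /inner mxE exchange_big; apply: eq_bigr => j _.
rewrite mxE mulr_suml; apply: eq_bigr => i _; rewrite mxE; ring.
Qed.

Lemma inner_bound N (e : R) v w : (forall i j, `|N i j| <= e) ->
  `|inner N v w| <= n%:R ^+ 2 * e * (`|v| * `|w|).
Proof.
move=> h; rewrite inner_sum; apply: le_trans (ler_norm_sum _ _ _) _.
have -> : n%:R ^+ 2 * e * (`|v| * `|w|) = \sum_(i < n) \sum_(j < n) `|v| * `|w| * e.
  by rewrite !sumr_const !card_ord -[RHS]mulr_natl -[X in _ = _ * X]mulr_natl; ring.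
apply: ler_sum => i _; apply: le_trans (ler_norm_sum _ _ _) _.
apply: ler_sum => j _; rewrite !normrM.
by apply: ler_pM; rewrite ?mulr_ge0// ler_pM ?coord_le_norm.
Qed.

Lemma innerBg N1 N2 v w : inner (N1 - N2) v w = inner N1 v w - inner N2 v w.
Proof. by rewrite /inner mulmxBr mulmxBl !mxE. Qed.
End InnerSum.

Section Riemannian.
Context {R : realType} {n : nat} (G : lieGroup R n) (m : riemannian_metric G).
Let V := 'rV[R]_n.
Local Notation phi := (@chart1 R n G).
Local Notation lg := (@lg R n G).
Local Notation pt := (@pt R n G).
Local Notation base := (base G).

Definition transition (p q : G) : V -> V := coord (chart_at q) \o point (chart_at p).

(** [gram m x] refers to the chart attached to x; the transition map brings it back to the fixed
    chart at p, where it varies continuously with the point. *)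
Definition metric_in_chart (p : G) (u v w : V) : R :=
  let x := point (chart_at p) u in
  inner (gram m x) ('d (transition p x) u v) ('d (transition p x) u w).

Lemma transition_diff (p q x : G) : chart_dom (chart_at p) x -> chart_dom (chart_at q) x ->
  differentiable (transition p q) (coord (chart_at p) x).
Proof.
move=> px qx; have [h _] := @chart_compat _ _ G p q 1%N.
by apply: h; exists x.
Qed.

Lemma near_chart_dom (p x : G) : chart_dom (chart_at p) x -> nbhs x (chart_dom (chart_at p)).
Proof. by move=> h; apply: open_nbhs_nbhs; split => //; exact: open_chart_dom. Qed.

Lemma near_is_derive (W : normedModType R) (f g : R -> W) (t : R) v :
  (\forall s \near t, f s = g s) -> is_derive t (1 : R) g v -> is_derive t (1 : R) f v.
Proof.
move=> fg; apply: near_eq_is_derive; by apply: filterS fg => s.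
Qed.

Lemma derivable_chart (p q : G) (c : R -> G) (t : R) : {for t, continuous c} ->
  chart_dom (chart_at p) (c t) -> chart_dom (chart_at q) (c t) ->
  derivable (coord (chart_at p) \o c) t 1 ->
  is_derive t (1 : R) (coord (chart_at q) \o c)
    ('d (transition p q) (coord (chart_at p) (c t)) (derive1 (coord (chart_at p) \o c) t)).
Proof.
move=> cc pc qc dc.
have d1 : is_derive t (1 : R) (coord (chart_at p) \o c) (derive1 (coord (chart_at p) \o c) t).
  by apply: DeriveDef; [exact: dc|rewrite derive1E].
have := is_derive_comp_diff d1 (transition_diff pc qc).
apply: near_is_derive.
have hn : \forall s \near t, chart_dom (chart_at p) (c s) := cc _ (near_chart_dom pc).
apply: filterS hn => s hs.
by rewrite /transition /= coordK.
Qed.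

(** The speed is defined in a chart that moves along the curve; here it is computed in one fixed
    chart. *)
Lemma speedE (p : G) (c : R -> G) (t : R) : {for t, continuous c} ->
  chart_dom (chart_at p) (c t) -> derivable (coord (chart_at (c t)) \o c) t 1 ->
  derivable (coord (chart_at p) \o c) t 1 /\
  speed m c t = Num.sqrt (metric_in_chart p (coord (chart_at p) (c t))
     (derive1 (coord (chart_at p) \o c) t) (derive1 (coord (chart_at p) \o c) t)).
Proof.
move=> cc pc dc; have qc := mem_chart_at (c t).
have dp := derivable_chart cc qc pc dc.
have dpd : derivable (coord (chart_at p) \o c) t 1 by exact: (@ex_derive _ _ _ _ _ _ _ dp).
split => //.
have dq := derivable_chart cc pc qc dpd.
rewrite /speed /metric_in_chart coordK//; congr (Num.sqrt (inner _ _ _)).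
  by rewrite derive1E (@derive_val _ _ _ _ _ _ _ dq).
by rewrite derive1E (@derive_val _ _ _ _ _ _ _ dq).
Qed.

Definition gram_in_chart (p : G) (u : V) : 'M[R]_n :=
  \matrix_(i, j) metric_in_chart p u (delta_mx ord0 i) (delta_mx ord0 j).

Lemma metric_gram p u v w : metric_in_chart p u v w = inner (gram_in_chart p u) v w.
Proof.
rewrite /metric_in_chart; set T := 'd _ _.
rewrite [v in LHS]row_sum_delta [w in LHS]row_sum_delta !linear_sum /=.
have -> : \sum_i T (v ord0 i *: 'e_i) = \sum_i v ord0 i *: T (delta_mx ord0 i).
  by apply: eq_bigr => i _; rewrite linearZ.
have -> : \sum_i T (w ord0 i *: 'e_i) = \sum_i w ord0 i *: T (delta_mx ord0 i).
  by apply: eq_bigr => i _; rewrite linearZ.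
set N := gram m _.
have sl (f : 'I_n -> V) z : inner N (\sum_i f i) z = \sum_i inner N (f i) z.
  by elim/big_ind2 : _ => [|x x' y y' <- <-|//]; [rewrite /inner !mul0mx mxE|rewrite innerDl].
have sr (f : 'I_n -> V) z : inner N z (\sum_i f i) = \sum_i inner N z (f i).
  by elim/big_ind2 : _ => [|x x' y y' <- <-|//]; [rewrite /inner trmx0 mulmx0 mxE|rewrite innerDr].
rewrite sl [RHS]inner_sum; apply: eq_bigr => i _.
rewrite innerZl sr mulr_sumr; apply: eq_bigr => j _.
by rewrite innerZr [gram_in_chart p u i j]mxE mulrA.
Qed.

Lemma gram_continuous p u i j : chart_img (chart_at p) u ->
  {for u, continuous (fun u => gram_in_chart p u i j)}.
Proof.
move=> iu; have h := gram_smooth m p (delta_mx ord0 i) (delta_mx ord0 j) 0%N u iu.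
have -> : (fun u => gram_in_chart p u i j) = (fun u => metric_in_chart p u (delta_mx ord0 i) (delta_mx ord0 j)).
  by apply/funext => z; rewrite mxE.
exact: h.
Qed.

Lemma near_forall2 (u : V) (P : 'I_n -> 'I_n -> V -> Prop) :
  (forall i j, \forall x \near u, P i j x) -> \forall x \near u, forall i j, P i j x.
Proof.
move=> h; apply: (@filter_forall _ _ (fun i x => forall j, P i j x) (nbhs u) (nbhs_filter u)) => i.
by apply: (@filter_forall _ _ (fun j x => P i j x) (nbhs u) (nbhs_filter u)) => j; exact: h.
Qed.

Lemma gram_near p u e : chart_img (chart_at p) u -> 0 < e ->
  \forall x \near u, forall i j, `|(gram_in_chart p x - gram_in_chart p u) i j| <= e.
Proof.
move=> iu e0; apply: near_forall2 => i j.
have /cvgrPdist_le /(_ e e0) := @gram_continuous p u i j iu.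
apply: filterS => x hx.
have -> : (gram_in_chart p x - gram_in_chart p u) i j = gram_in_chart p x i j - gram_in_chart p u i j.
  by rewrite mxE [X in _ + X]mxE.
by rewrite distrC.
Qed.

Lemma metric_continuous p (u v : R -> V) (D : set R) (t : R) : chart_img (chart_at p) (u t) ->
  u s @[s --> within D (nbhs t)] --> u t -> v s @[s --> within D (nbhs t)] --> v t ->
  metric_in_chart p (u s) (v s) (v s) @[s --> within D (nbhs t)] --> metric_in_chart p (u t) (v t) (v t).
Proof.
move=> iu cu cv.
have cc (f : R -> V) i : f s @[s --> within D (nbhs t)] --> f t ->
    f s ord0 i @[s --> within D (nbhs t)] --> f t ord0 i.
  by move=> cf; apply: (cvg_comp f (fun N : V => N ord0 i) cf); exact: matrix_normedtype.coord_continuous.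
have E s : metric_in_chart p (u s) (v s) (v s) =
  \sum_i \sum_j v s ord0 i * v s ord0 j * gram_in_chart p (u s) i j.
  by rewrite metric_gram inner_sum.
under eq_fun do rewrite E.
rewrite E; apply: cvg_big => [|i _]; first exact: add_continuous.
apply: cvg_big => [|j _]; first exact: add_continuous.
apply: cvgM; first by apply: cvgM; exact: cc.
exact: (cvg_comp u (fun x => gram_in_chart p x i j) cu (@gram_continuous p (u t) i j iu)).
Qed.

(** Near t the chart at [c t] suffices, by [speedE]. The aim is measurability of the integrand of
    the length. *)
Lemma speed_continuous (c : R -> G) : C1_curve c -> {within `[0, 1], continuous (speed m c)}.
Proof.
move=> hc; apply/subspace_continuousP => t t01.
have t01' : 0 <= t <= 1 by move: t01; rewrite /= in_itv.
have [cc dc d1c] := hc t t01'.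
set f := coord (chart_at (c t)) \o c in dc d1c *.
have E s : 0 <= s <= 1 -> chart_dom (chart_at (c t)) (c s) ->
    speed m c s = Num.sqrt (metric_in_chart (c t) (f s) (derive1 f s) (derive1 f s)).
  move=> s01 hs; have [cs ds _] := hc s s01.
  by have [_ ->] := speedE cs hs (nbhs_singleton ds).
have hn : \forall s \near t, chart_dom (chart_at (c t)) (c s) :=
  cc _ (near_chart_dom (mem_chart_at (c t))).
apply: (@cvg_trans _ (Num.sqrt (metric_in_chart (c t) (f s) (derive1 f s) (derive1 f s)) @[s --> within `[0, 1] (nbhs t)])).
  apply: near_eq_cvg; apply: filterS hn => s hs; rewrite /= in_itv => s01.
  by rewrite -E.
have Et := E t t01' (mem_chart_at (c t)).
rewrite /from_subspace Et.
apply: (cvg_comp _ Num.sqrt); last exact: sqrt_continuous.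
apply: metric_continuous.
- by exists (c t) => //; exact: mem_chart_at.
- apply: cvg_within_filter; apply: (cvg_comp c (coord (chart_at (c t))) cc).
  exact: (coord_continuous (mem_chart_at (c t))).
- exact: cvg_within_filter.
Qed.

Lemma speed_ge0 (c : R -> G) t : 0 <= speed m c t.
Proof. exact: sqrtr_ge0. Qed.

Lemma measurable_speed (c : R -> G) : C1_curve c ->
  measurable_fun (`[(0 : R), 1]%classic : set R) (speed m c).
Proof. by move=> hc; apply: subspace_continuous_measurable_fun => //; exact: speed_continuous. Qed.

(** Fundamental theorem of calculus for a function whose derivative is dominated by the speed. *)
Lemma length_ge (c : R -> G) (f : R -> R) (s t : R) : C1_curve c -> 0 <= s -> s <= t -> t <= 1 ->
  (forall u, s <= u <= t -> derivable f u 1) -> {within `[s, t], continuous (derive1 f)} ->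
  (forall u, s <= u <= t -> `|derive1 f u| <= speed m c u) ->
  (`|f t - f s|%:E <= \int[lebesgue_measure]_(u in `[s, t]) (speed m c u)%:E)%E.
Proof.
move=> hc s0 st t1 df cf' fle.
have [<-|ts] := eqVneq s t.
  by rewrite subrr normr0 integral_ge0// => u _; rewrite lee_fin speed_ge0.
have slt : s < t by rewrite lt_neqAle ts.
have oo : derivable_oo_LRcontinuous f s t.
  split.
  - by move=> u; rewrite in_itv /= => /andP[h1 h2]; apply: df; rewrite !ltW.
  - apply: cvg_at_right_filter; apply: differentiable_continuous.
    by apply/derivable1_diffP; apply: df; rewrite lexx st.
  - apply: cvg_at_left_filter; apply: differentiable_continuous.
    by apply/derivable1_diffP; apply: df; rewrite lexx st.
have := @continuous_FTC2 R (derive1 f) f s t slt cf' oo (fun u _ => erefl).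
have ms : measurable (`[s, t]%classic : set R) by [].
have ii : lebesgue_measure.-integrable `[s, t] (EFin \o derive1 f).
  by apply: continuous_compact_integrable => //; exact: segment_compact.
move=> e; have -> : (`|f t - f s|%:E = `|(f t)%:E - (f s)%:E|)%E by [].
rewrite -e; apply: le_trans (le_abse_integral _ _ _) _ => //.
  exact: measurable_int ii.
apply: ge0_le_integral => //.
- exact: measurableT_comp (measurable_int _ ii).
- apply/measurable_EFinP; apply: measurable_funS (measurable_speed hc) => //.
  by apply: subset_itv; rewrite bnd_simp.
Qed.

End Riemannian.

(** Continuous induction: the supremum of the initial segments on which Q holds belongs to them by
    the closed step, and must be 1 by the open step. It serves to follow a curve that is only
    measurable in the chart until it leaves it. *)
Lemma real_induction (R : realType) (Q : R -> Prop) : Q 0 ->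
  (forall t, 0 <= t < 1 -> (forall u, 0 <= u <= t -> Q u) ->
    exists2 d : R, 0 < d & forall u, t <= u <= t + d -> u <= 1 -> Q u) ->
  (forall t, 0 < t <= 1 -> (forall u, 0 <= u < t -> Q u) -> Q t) ->
  forall t, 0 <= t <= 1 -> Q t.
Proof.
move=> Q0 Qo Qc.
pose E := [set t : R | 0 <= t <= 1 /\ forall u, 0 <= u <= t -> Q u].
have E0 : E 0.
  split=> [|u]; first by rewrite lexx ler01.
  by rewrite -eq_le => /eqP <-.
have hs : has_sup E by split; [exists 0|exists 1 => t [/andP[]]].
have T0 : 0 <= sup E by apply: ub_le_sup => //; case: hs.
have T1 : sup E <= 1 by apply: ge_sup; [exists 0|move=> t [/andP[]]].
have lt_Q u : 0 <= u < sup E -> Q u.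
  move=> /andP[u0 uT]; have d0 : 0 < sup E - u by rewrite subr_gt0.
  have [t [t01 ht]] := sup_adherent d0 hs; rewrite opprB addrC subrK => ut.
  by apply: ht; rewrite u0 ltW.
have QT : Q (sup E).
  have [->//|sn0] := eqVneq (sup E) 0.
  by apply: Qc => //; rewrite T1 lt_neqAle eq_sym sn0 T0.
have ET : E (sup E).
  split; first by rewrite T0 T1.
  move=> u /andP[u0]; rewrite le_eqVlt => /orP[/eqP->//|uT].
  by apply: lt_Q; rewrite u0.
have TE : sup E = 1.
  apply/eqP; rewrite eq_le T1 leNgt; apply/negP => T_lt1.
  have [d d0 hd] := Qo (sup E) ltac:(by rewrite T0) ET.2.
  pose t := Num.min (sup E + d) 1.
  have sT : sup E < t by rewrite /t lt_min T_lt1 ltrDl d0.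
  have : t <= sup E.
    apply: ub_le_sup; first by case: hs.
    split; first by rewrite (le_trans T0 (ltW sT)) /t ge_min lexx orbT.
    move=> u /andP[u0 ut]; have [uT|Tu] := leP u (sup E).
      by apply: ET.2; rewrite u0.
    move: ut; rewrite /t le_min => /andP[h1 h2]; apply: hd => //.
    by rewrite (ltW Tu).
  by rewrite leNgt sT.
by move=> t; rewrite -TE; exact: ET.2.
Qed.

Section Riemannian.
Context {R : realType} {n : nat} (G : lieGroup R n) (m : riemannian_metric G).
Let V := 'rV[R]_n.
Local Notation phi := (@chart1 R n G).
Local Notation lg := (@lg R n G).
Local Notation pt := (@pt R n G).
Local Notation base := (base G).

(** At 1 the transition map is the identity, so the form is the positive definite Gram form of the
    metric, and continuity of its entries preserves half of its lower bound nearby. *)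
Lemma metric_bounds : exists r k K : R, [/\ 0 < r, 0 < k, 0 < K &
  forall u : V, `|u - base| <= r -> chart_img phi u /\
    forall v, k * `|v| <= Num.sqrt (metric_in_chart m 1%g u v v) <= K * `|v|].
Proof.
set N := gram_in_chart m 1%g base.
have Npos v : v != 0 -> 0 < inner N v v.
  move=> v0; rewrite -metric_gram /metric_in_chart.
  have e1 : point phi base = 1%g := point_base G.
  rewrite /metric_in_chart -/phi.
  have := @tangent_map_id R n G => hid.
  have e2 : 'd (transition 1%g (point phi base)) base = idfun :> (V -> V).
    by rewrite e1; exact: hid.
  by rewrite e2 /=; exact: gram_pos.
have [k0 k00 hk] := posdef_lower_bound Npos.
have n0 : 0 <= n%:R ^+ 2 :> R by exact: sqr_ge0.
(* Entries perturbed by this amount change the form by at most [k0 / 2 * |v|^2], since n^2 entries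
   contribute. *)
have e0 : 0 < k0 / 2 / (n%:R ^+ 2 + 1) by rewrite !divr_gt0// ltr_wpDl.
have := near_and (gram_near (p := 1%g) (u := base) m (img_base G) e0) (near_img (1%g : G)).
move=> /nbhs_normE[r r0 hr].
exists (r / 2), (Num.sqrt (k0 / 2)), (Num.sqrt (n%:R ^+ 2 * `|N| + k0 / 2)).
have K0 : 0 < n%:R ^+ 2 * `|N| + k0 / 2 by rewrite ltr_wpDl ?mulr_ge0// divr_gt0.
split; [by rewrite divr_gt0|by rewrite sqrtr_gt0 divr_gt0|by rewrite sqrtr_gt0|].
move=> u hu; have [h1 h2] := hr u ltac:(by apply: le_lt_trans hu _; lra); split => // v.
have sq a : 0 <= a -> Num.sqrt a * `|v| = Num.sqrt (a * `|v| ^+ 2).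
  by move=> a0; rewrite sqrtrM// sqrtr_sqr normr_id.
have k2 : 0 <= k0 / 2 by rewrite divr_ge0// ltW.
rewrite (sq _ k2) (sq _ (ltW K0)).
rewrite (metric_gram m 1%g u v v).
have := inner_bound v v h1; rewrite innerBg -/N.
clear h1; move: (gram_in_chart m 1%g u) => N'.
have -> : n%:R ^+ 2 * (k0 / 2 / (n%:R ^+ 2 + 1)) * (`|v| * `|v|) =
    n%:R ^+ 2 / (n%:R ^+ 2 + 1) * (k0 / 2 * `|v| ^+ 2).
  rewrite expr2; ring.
have hv : 0 <= k0 / 2 * `|v| ^+ 2 by rewrite mulr_ge0// ?divr_ge0 ?ltW.
have h3 : n%:R ^+ 2 / (n%:R ^+ 2 + 1) * (k0 / 2 * `|v| ^+ 2) <= k0 / 2 * `|v| ^+ 2.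
  by rewrite ler_piMl// ler_pdivrMr ?ltr_wpDl// mul1r lerDl.
move=> /le_trans/(_ h3); rewrite ler_norml => /andP[h4 h5].
have h6 := hk v.
have : `|inner N v v| <= n%:R ^+ 2 * `|N| * (`|v| * `|v|).
  by apply: inner_bound => i j; exact: coord_le_norm.
rewrite ler_norml => /andP[_ h7].
apply/andP; split; apply: ler_wsqrtr.
  lra.
rewrite expr2 in h4 h5 h6 *; lra.
Qed.

(** C^1 regularity is given in the chart at each point of the curve and is carried over to one
    chart. The moving velocity is expanded in the basis, since the differential of the transition
    map is continuous in the point for a fixed vector. *)
Lemma derive1_chart_continuous (p : G) (c : R -> G) (A : set R) : C1_curve c ->
  (forall t, A t -> 0 <= t <= 1) -> (forall t, A t -> chart_dom (chart_at p) (c t)) ->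
  {within A, continuous (derive1 (coord (chart_at p) \o c))}.
Proof.
move=> hc A01 Ap; apply/subspace_continuousP => t At.
have [cc dc d1c] := hc t (A01 t At).
set q := c t; set f := coord (chart_at q) \o c in dc d1c.
set T := transition q p.
have qt : chart_dom (chart_at q) (c t) := mem_chart_at (c t).
have E s : A s -> chart_dom (chart_at q) (c s) -> derivable f s 1 ->
    derive1 (coord (chart_at p) \o c) s = \sum_i derive1 f s ord0 i *: 'd T (f s) (delta_mx ord0 i).
  move=> As qs ds; have [cs _ _] := hc s (A01 s As).
  have d := derivable_chart cs qs (Ap s As) ds.
  rewrite derive1E (@derive_val _ _ _ _ _ _ _ d) -/T -/f [X in 'd T _ X]row_sum_delta linear_sum.
  by apply: eq_bigr => i _; rewrite linearZ.
have hn : \forall s \near t, chart_dom (chart_at q) (c s) := cc _ (near_chart_dom qt).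
apply: (@cvg_trans _ ((\sum_i derive1 f s ord0 i *: 'd T (f s) (delta_mx ord0 i)) @[s --> within A (nbhs t)])).
  apply: near_eq_cvg; have := near_and hn dc; apply: filterS => s [h1 h2] As /=.
  by symmetry; exact: E.
have Et := E t At qt (nbhs_singleton dc).
rewrite /from_subspace Et; apply: cvg_big => [|i _]; first exact: add_continuous.
have cf : f s @[s --> within A (nbhs t)] --> f t.
  apply: cvg_within_filter; apply: (cvg_comp c (coord (chart_at q)) cc).
  exact: (coord_continuous qt).
apply: cvgZ.
  apply: (cvg_comp (derive1 f) (fun N : V => N ord0 i)); last exact: matrix_normedtype.coord_continuous.
  exact: cvg_within_filter.
apply: (cvg_comp f (fun x => 'd T x (delta_mx ord0 i)) cf).
have [_ h] := @chart_compat _ _ G q p 1%N.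
by apply: h; exists (c t) => //; split => //; exact: Ap.
Qed.

Lemma is_derive_scaled_coord (f : R -> V) (t k : R) i (v : V) : is_derive t (1 : R) f v ->
  is_derive t (1 : R) (fun s => k * f s ord0 i) (k * v ord0 i).
Proof.
move=> /(is_derive_coord ord0 i) df.
exact: (@is_deriveZ _ _ _ (fun s => f s ord0 i) k t 1 _ df).
Qed.

Section Bounds.
Variables (r k : R).
Hypotheses (r0 : 0 < r) (k0 : 0 < k).
Hypothesis bound : forall u : V, `|u - base| <= r -> forall v, k * `|v| <= Num.sqrt (metric_in_chart m 1%g u v v).

(** The sup norm allows one coordinate to be treated at a time: k times its derivative is at most
    the speed, and [length_ge] applies. *)
Lemma curve_bound (c : R -> G) (s t : R) : C1_curve c -> 0 <= s -> s <= t -> t <= 1 ->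
  (forall u, s <= u <= t -> chart_dom phi (c u) /\ `|lg (c u)| <= r) ->
  ((k * `|lg (c t) - lg (c s)|)%:E <= \int[lebesgue_measure]_(u in `[s, t]) (speed m c u)%:E)%E.
Proof.
move=> hc s0 st t1 hU; set L := (\int[_]_(u in _) _)%E.
have u01 u : s <= u <= t -> 0 <= u <= 1.
  by move=> /andP[h1 h2]; rewrite (le_trans s0 h1) (le_trans h2 t1).
have D u : s <= u <= t -> derivable (coord phi \o c) u 1 /\
    k * `|derive1 (coord phi \o c) u| <= speed m c u.
  move=> stu; have [cu du _] := hc u (u01 u stu); have [h1 h2] := hU u stu.
  have [h3 ->] := speedE m (p := 1%g) cu h1 (nbhs_singleton du).
  by split => //; apply: bound.
have ci i : (`|k * (lg (c t) - lg (c s)) ord0 i|%:E <= L)%E.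
  have Di u : s <= u <= t -> is_derive u (1 : R) (fun z => k * coord phi (c z) ord0 i)
      (k * derive1 (coord phi \o c) u ord0 i).
    move=> stu; have [h _] := D u stu.
    apply: (is_derive_scaled_coord (f := coord phi \o c)).
    by apply: DeriveDef; [exact: h|rewrite derive1E].
  have e : k * (lg (c t) - lg (c s)) ord0 i = k * coord phi (c t) ord0 i - k * coord phi (c s) ord0 i.
    have lgE x : lg x = coord phi x - base by [].
    rewrite !lgE; move: base (coord phi (c t)) (coord phi (c s)) => b x y.
    by rewrite !mxE; ring.
  have d1 u : s <= u <= t -> derive1 (fun z => k * coord phi (c z) ord0 i) u = k * derive1 (coord phi \o c) u ord0 i.
    by move=> stu; rewrite derive1E; have h := Di u stu; exact: (@derive_val _ _ _ _ _ _ _ h).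
  rewrite e; apply: (@length_ge _ _ _ m c (fun z => k * coord phi (c z) ord0 i)) => //.
  - by move=> u /Di h; exact: (@ex_derive _ _ _ _ _ _ _ h).
  - apply/subspace_continuousP => u; rewrite /= in_itv /= => stu.
    apply: (@cvg_trans _ ((k * derive1 (coord phi \o c) x ord0 i) @[x --> within `[s, t] (nbhs u)])).
      apply: near_eq_cvg; apply: (@filterE _ (nbhs u) _ _) => x; rewrite /= in_itv /= => h.
      by symmetry; exact: d1.
    rewrite /from_subspace (d1 u stu); apply: cvgM; first exact: cvg_cst.
    apply: (cvg_comp (derive1 (coord phi \o c)) (fun N : V => N ord0 i)); last exact: matrix_normedtype.coord_continuous.
    have := @derive1_chart_continuous 1%g c `[s, t] hc.
    move=> /(_ (fun x => ltac:(rewrite /= in_itv; exact: u01))).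
    move=> /(_ (fun x => ltac:(rewrite /= in_itv => /hU[]//))) /subspace_continuousP; apply.
    by rewrite /= in_itv.
  - move=> u stu; rewrite d1// normrM gtr0_norm//; have [_] := D u stu.
    by apply: le_trans; rewrite ler_pM2l// coord_le_norm.
have L0 : (0 <= L)%E by apply: integral_ge0 => u _; rewrite lee_fin speed_ge0.
move: L0 ci; case: L => [l|_ _|//]; last by rewrite leey.
rewrite lee_fin => l0 ci; rewrite lee_fin -ler_pdivlMl//.
apply: mx_norm_le; first by rewrite mulr_ge0// invr_ge0 ltW.
move=> i0 i; rewrite (ord1 i0) ler_pdivlMl//.
by have := ci i; rewrite lee_fin normrM gtr0_norm.
Qed.
End Bounds.

End Riemannian.

Lemma shift_cvg (K : numFieldType) (W : normedModType K) (x y : W) : x + z @[z --> y] --> x + y.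
Proof. by apply: cvgD; [exact: cvg_cst|exact: cvg_id]. Qed.

Lemma line_cvg (R : realType) (W : normedModType R) (x w : W) (t : R) : x + s *: w @[s --> t] --> x + t *: w.
Proof.
have h : {for t, continuous (fun s : R => x + s *: w)} by exact: differentiable_continuous.
exact: h.
Qed.

Lemma straight_near (K : realType) (W : normedModType K) (w : W) (r t : K) : 0 < r -> `|w| < r -> 0 <= t <= 1 ->
  \forall s \near t, `|s *: w| < r.
Proof.
move=> r0 wr /andP[t0 t1].
have tw : `|t *: w| < r.
  by rewrite normrZ ger0_norm//; apply: le_lt_trans wr; rewrite ler_piMl.
have c1 : {for t, continuous (fun s : K => `|s *: w|)}.
  apply: (cvg_comp (fun s : K => s *: w) Num.norm); last exact: norm_continuous.
  by have := @line_cvg K W 0 w t; rewrite add0r; under eq_fun do rewrite add0r.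
have : nbhs `|t *: w| [set x | x < r] by apply: open_nbhs_nbhs; split => //; exact: open_lt.
exact: c1.
Qed.

Section Riemannian.
Context {R : realType} {n : nat} (G : lieGroup R n) (m : riemannian_metric G).
Let V := 'rV[R]_n.
Local Notation phi := (@chart1 R n G).
Local Notation lg := (@lg R n G).
Local Notation pt := (@pt R n G).
Local Notation base := (base G).

Section Bounds.
Variables (r k : R).
Hypotheses (r0 : 0 < r) (k0 : 0 < k).
Hypothesis img : forall u : V, `|u - base| <= r -> chart_img phi u.
Hypothesis bound : forall u : V, `|u - base| <= r -> forall v, k * `|v| <= Num.sqrt (metric_in_chart m 1%g u v v).

Lemma pt_in_chart (v : V) : `|v| <= r -> chart_dom phi (pt v) /\ lg (pt v) = v.
Proof.
move=> vr; have i : chart_img phi (base + v) by apply: img; rewrite addrC addKr.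
have [h1 h2] := coord_point i; split => //.
by rewrite /(lg _) /(pt _) h2 addrC addKr.
Qed.

(** Compact image in a Hausdorff space. Without it a curve could converge to a point outside the
    chart while its coordinates stay bounded. *)
Lemma chart_ball_closed (rho : R) : rho <= r -> closed (pt @` [set v : V | `|v| <= rho]).
Proof.
move=> rr; apply: compact_closed; first exact: lie_hausdorff.
apply: continuous_compact.
  apply: continuous_in_subspaceT => v; rewrite inE /= => hv.
  have i : chart_img phi (base + v) by apply: img; rewrite addrC addKr (le_trans hv).
  have h : base + w @[w --> (v : V)] --> base + v.
    exact: shift_cvg.
  exact: (cvg_comp _ (point phi) h (@point_continuous _ _ _ phi _ i)).
apply: bounded_closed_compact.
  exists rho; split; first exact: num_real.
  by move=> x x1 v /= v1; apply: le_trans v1 (ltW x1).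
have -> : [set v : V | `|v| <= rho] = (fun v : V => `|v|) @^-1` [set x | x <= rho] by [].
apply: preimage_closed; last exact: closed_le.
by move=> v _; exact: norm_continuous.
Qed.

Lemma curve_length_ge0 c : (0 <= curve_length m c)%E.
Proof. by apply: integral_ge0 => u _; rewrite lee_fin speed_ge0. Qed.

(** A curve too short to reach norm r cannot leave the chart. The invariant is the bound [rho < r]:
    the margin lets [curve_bound] be used slightly beyond t, and its conclusion restores [rho]. *)
Lemma curve_length_bound (c : R -> G) : C1_curve c -> chart_dom phi (c 0) ->
  ((k * `|lg (c 0)|)%:E + curve_length m c < (k * r)%:E)%E ->
  chart_dom phi (c 1) /\ ((k * `|lg (c 1%R)|)%:E <= (k * `|lg (c 0%R)|)%:E + curve_length m c)%E.
Proof.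
move=> hc d0; have := curve_length_ge0 c.
case E : (curve_length m c) => [L||//]; rewrite ?lee_fin => L0; last by rewrite addey.
rewrite -EFinD lte_fin => hL.
set rho := `|lg (c 0)| + L / k.
have krho : k * rho = k * `|lg (c 0)| + L by rewrite /rho mulrDr [k * (L / k)]mulrC divfK ?gt_eqF.
have rhor : rho < r by rewrite -(ltr_pM2l k0) krho.
have part t : 0 <= t <= 1 -> (forall u, 0 <= u <= t -> chart_dom phi (c u) /\ `|lg (c u)| <= r) ->
    `|lg (c t)| <= rho.
  move=> /andP[t0 t1] hu.
  have h1 := curve_bound k0 bound hc (lexx 0) t0 t1 hu.
  have h2 : ((k * `|lg (c t) - lg (c 0)|)%:E <= L%:E)%E.
    apply: le_trans h1 _; rewrite -E; apply: ge0_subset_integral => //.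
    - by apply/measurable_EFinP; exact: measurable_speed.
    - by move=> u _; rewrite lee_fin speed_ge0.
    - by apply: subset_itv; rewrite bnd_simp.
  rewrite lee_fin in h2; rewrite -(ler_pM2l k0) krho.
  have h3 : `|lg (c t)| <= `|lg (c 0)| + `|lg (c t) - lg (c 0)|.
    by rewrite -[X in `|X| <= _](subrK (lg (c 0))) addrC ler_normD.
  rewrite -(ler_pM2l k0) mulrDr in h3; lra.
have Q t : 0 <= t <= 1 -> chart_dom phi (c t) /\ `|lg (c t)| <= rho.
  move: t; apply: (@real_induction _ (fun t => chart_dom phi (c t) /\ `|lg (c t)| <= rho)).
  - by split => //; rewrite /rho lerDl divr_ge0// ltW.
  - move=> t /andP[t0 t1] hQ.
    have [ct _ _] := hc t ltac:(by rewrite t0 ltW).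
    have [dt ht] := hQ t ltac:(by rewrite t0 lexx).
    have hn : \forall s \near t, chart_dom phi (c s) := ct _ (near_chart_dom dt).
    have hn2 : \forall s \near t, `|lg (c s) - lg (c t)| < r - rho.
      have cl : {for c t, continuous lg}.
        by apply: cvgB; [exact: (coord_continuous dt)|exact: cvg_cst].
      have e0 : 0 < r - rho by rewrite subr_gt0.
      have := cvg_comp c lg ct cl.
      move=> /cvgrPdist_lt /(_ _ e0); apply: filterS => s.
      by rewrite distrC.
    have := near_and hn hn2.
    move=> /nbhs_normE[d dp hd]; exists (d / 2); first by rewrite divr_gt0.
    move=> u /andP[tu ud] u1.
    have hz z : 0 <= z <= u -> chart_dom phi (c z) /\ `|lg (c z)| <= r.
      move=> /andP[z0 zu]; have [zt|tz] := leP z t.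
        have [h1 h2] := hQ z ltac:(by rewrite z0 zt); split => //.
        exact: le_trans h2 (ltW rhor).
      have [h1 h2] := hd z ltac:(by rewrite gtr0_norm ?subr_gt0//; lra).
      split => //; rewrite -[X in `|X|](subrK (lg (c t))).
      apply: le_trans (ler_normD _ _) _; lra.
    have u0 : 0 <= u by exact: le_trans t0 tu.
    split; first by have [] := hz u ltac:(by rewrite u0 lexx).
    by apply: part => //; rewrite u0.
  (* Closed step: if [c t] were outside the closed chart ball, so would be nearby earlier points,
     against the induction hypothesis. *)
  - move=> t /andP[t0 t1] hQ.
    have [ct _ _] := hc t ltac:(by rewrite ltW).
    suff : (pt @` [set v : V | `|v| <= rho]) (c t).
      move=> [v vr <-]; have [h1 ->] := pt_in_chart (le_trans vr (ltW rhor)).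
      by [].
    apply: contrapT => nK.
    have oK : open (~` (pt @` [set v : V | `|v| <= rho])).
      by apply: closed_openC; apply: chart_ball_closed; exact: ltW.
    have hn : \forall s \near t, (~` (pt @` [set v : V | `|v| <= rho])) (c s).
      by apply: ct; exact: open_nbhs_nbhs.
    move: hn => /nbhs_normE[d dp hd].
    pose u := Num.max 0 (t - d / 2).
    have u0 : 0 <= u by rewrite /u le_max lexx.
    have ut : u < t by rewrite /u gt_max t0; lra.
    have [h1 h2] := hQ u ltac:(by rewrite u0).
    have hu : `|u - t| < d.
      rewrite ltr0_norm ?subr_lt0// opprB.
      have : t - d / 2 <= u by rewrite /u le_max lexx orbT.
      lra.
    by apply: (hd u hu); exists (lg (c u)) => //; rewrite lgK.
have [h1 h2] := Q 1 ltac:(by rewrite ler01 lexx).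
by split => //; rewrite -krho ler_pM2l.
Qed.

Lemma path_length_bound x y L : piecewise_C1_path m x y L -> chart_dom phi x ->
  ((k * `|lg x|)%:E + L < (k * r)%:E)%E ->
  chart_dom phi y /\ ((k * `|lg y|)%:E <= (k * `|lg x|)%:E + L)%E.
Proof.
elim=> {x y L} [x dx _|c y L hc hp IH d0 hL].
  by split => //; rewrite adde0.
have L0 : (0 <= L)%E.
  elim: hp => [//|c' y' L' _ _ h]; apply: adde_ge0 => //; exact: curve_length_ge0.
have h0 : ((k * `|lg (c 0)|)%:E + curve_length m c < (k * r)%:E)%E.
  by apply: le_lt_trans hL; apply: leeD2l; apply: leeDl.
have [d1 h1] := curve_length_bound hc d0 h0.
have h2 : ((k * `|lg (c 1%R)|)%:E + L <= (k * `|lg (c 0%R)|)%:E + (curve_length m c + L))%E.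
  by rewrite (addeA _ (curve_length m c) L); apply: leeD2r.
have [dy hy] := IH d1 (le_lt_trans h2 hL).
split => //; exact: le_trans hy h2.
Qed.
End Bounds.

Lemma ball1_coord_bound : exists2 C : R, 0 < C & exists2 e0 : R, 0 < e0 &
  forall e x, e < e0 -> ball1 m e x -> chart_dom phi x /\ `|lg x| <= C * e.
Proof.
have [r [k [K [r0 k0 K0 h]]]] := metric_bounds m.
exists k^-1; first by rewrite invr_gt0.
exists (k * r); first by rewrite mulr_gt0.
move=> e x ee /ereal_inf_lt [L hp Le].
have img u : `|u - base| <= r -> chart_img phi u by move=> /h[].
have bd u : `|u - base| <= r -> forall v, k * `|v| <= Num.sqrt (metric_in_chart m 1%g u v v).
  by move=> /h[_ h'] v; have /andP[] := h' v.
have [|dx hx] := path_length_bound k0 img bd hp (dom1 G).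
  by rewrite lg1 normr0 mulr0 add0e (lt_trans Le)// lte_fin.
split => //; rewrite -ler_pdivrMl ?invr_gt0// invrK -lee_fin.
by move: hx; rewrite lg1 normr0 mulr0 add0e => /le_trans; apply; exact: ltW.
Qed.

Lemma straight_C1 (w : V) r : (forall u : V, `|u - base| <= r -> chart_img phi u) -> 0 < r -> `|w| < r ->
  C1_curve (fun t : R => pt (t *: w)).
Proof.
move=> img r0 wr; set c := (fun t : R => pt (t *: w)).
have imc t : `|t *: w| <= r -> chart_img phi (base + t *: w) by move=> h; apply: img; rewrite addrC addKr.
have cc t : `|t *: w| <= r -> {for t, continuous c}.
  move=> /imc i.
  have h : base + s *: w @[s --> t] --> base + t *: w.
    exact: line_cvg.
  exact: (cvg_comp _ (point phi) h (@point_continuous _ _ _ phi _ i)).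
have near_r (t : R) : 0 <= t <= 1 -> \forall s \near t, `|s *: w| < r by exact: straight_near.
move=> t t01 f.
have tr : `|t *: w| <= r by apply/ltW/(nbhs_singleton (near_r t t01)).
set q := c t in f *.
have qt : chart_dom (chart_at q) (c t) := mem_chart_at (c t).
have hq : \forall s \near t, chart_dom (chart_at q) (c s) := cc t tr _ (near_chart_dom qt).
set T := transition 1%g q.
have Df s : `|s *: w| < r -> chart_dom (chart_at q) (c s) -> (\forall z \near s, `|z *: w| < r) ->
    is_derive s (1 : R) f ('d T (base + s *: w) w).
  move=> sr qs hs; have [h1 h2] := coord_point (imc s (ltW sr)).
  have d1 : is_derive s (1 : R) (coord phi \o c) w.
    apply: near_is_derive (is_derive_line base w s).
    apply: filterS hs => z zr.
    by have [_] := coord_point (imc z (ltW zr)).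
  have dd : derivable (coord phi \o c) s 1 by exact: (@ex_derive _ _ _ _ _ _ _ d1).
  have := derivable_chart (p := 1%g) (q := q) (cc s (ltW sr)) h1 qs dd.
  have -> : derive1 (coord (chart_at 1%g) \o c) s = w.
    by rewrite derive1E; exact: (@derive_val _ _ _ _ _ _ _ d1).
  by rewrite -/T; have -> : coord (chart_at 1%g) (c s) = base + s *: w.
have nr := near_r t t01.
have nn := near_and (near_and nr hq) (near_join nr).
split.
- exact: cc.
- apply: filterS nn => s [[h1 h2] h3].
  have d := Df s h1 h2 h3; exact: (@ex_derive _ _ _ _ _ _ _ d).
- have E s : `|s *: w| < r -> chart_dom (chart_at q) (c s) -> (\forall z \near s, `|z *: w| < r) ->
      derive1 f s = 'd T (base + s *: w) w.
    by move=> h1 h2 h3; have d := Df s h1 h2 h3; rewrite derive1E; exact: (@derive_val _ _ _ _ _ _ _ d).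
  apply: (@cvg_trans _ ('d T (base + s *: w) w @[s --> t])).
    apply: near_eq_cvg; apply: filterS nn => s [[h1 h2] h3].
    by symmetry; exact: E.
  have [[h1 h2] h3] := nbhs_singleton nn.
  rewrite (E t h1 h2 h3).
  have [_ hC] := @chart_compat _ _ G 1%g q 1%N.
  have i := imc t tr; have [i1 i2] := coord_point i.
  have cT : {for base + t *: w, continuous (fun x => 'd T x w)}.
    by apply: hC; exists (c t).
  have Z := cvg_comp (fun s : R => base + s *: w) (fun x => 'd T x w) (@line_cvg _ _ base w t) cT. exact: Z.
Qed.

(** The straight segment in the chart is a competitor of length at most K e; [K + 1] makes the
    inequality strict. *)
Lemma ball1_contains : exists2 C : R, 0 < C & exists2 d : R, 0 < d &
  forall e x, 0 < e -> e < d -> chart_dom phi x -> `|lg x| <= e -> ball1 m (C * e) x.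
Proof.
have [r [k [K [r0 k0 K0 h]]]] := metric_bounds m.
have img u : `|u - base| <= r -> chart_img phi u by move=> /h[].
exists (K + 1); first by rewrite addr_gt0.
exists r => // e x e0 er dx xe.
set w := lg x in xe; have wr : `|w| < r by exact: le_lt_trans er.
set c := fun t : R => pt (t *: w).
have hc : C1_curve c by exact: straight_C1 img r0 wr.
have c0 : c 0 = 1%g by rewrite /c scale0r pt0.
have c1 : c 1 = x by rewrite /c scale1r /w lgK.
have hp := path_cons (c := c) (m := m) hc (path_nil m (c 1)).
rewrite c0 c1 in hp.
suff hL : (curve_length m c <= (K * e)%:E)%E.
  apply: (@le_lt_trans _ _ (curve_length m c + 0)%E); first exact: ereal_inf_lbound.
  by rewrite adde0 (le_lt_trans hL)// lte_fin ltr_pM2r// ltrDl.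
have -> : (K * e)%:E = (\int[lebesgue_measure]_(t in `[0%R, 1%R]) (K * e)%:E)%E.
  by rewrite integral_cst//= lebesgue_measure_itv/= lte_fin ltr01 sube0 mule1.
apply: ge0_le_integral => //.
- by move=> t _; rewrite lee_fin speed_ge0.
- by apply/measurable_EFinP; exact: measurable_speed.
move=> t; rewrite /= in_itv /= => t01; rewrite lee_fin.
have [ct dt _] := hc t t01.
have tr : `|t *: w| <= r.
  move: t01 => /andP[t0 t1].
  by rewrite normrZ ger0_norm//; apply/ltW/le_lt_trans/wr; rewrite ler_piMl.
have br : `|base + t *: w - base| <= r by rewrite addrC addKr.
have [i hb] := h _ br; have [i1 i2] := coord_point i.
have [dp ->] := speedE m (p := 1%g) ct i1 (nbhs_singleton dt).
have -> : coord (chart_at 1%g) (c t) = base + t *: w by [].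
have -> : derive1 (coord (chart_at 1%g) \o c) t = w.
  rewrite derive1E.
  have d1 : is_derive t (1 : R) (coord phi \o c) w.
    apply: near_is_derive (is_derive_line base w t).
    have hn : \forall s \near t, chart_dom phi (c s) := ct _ (near_chart_dom i1).
    apply: filterS (straight_near r0 wr t01) => z zr.
    have iz : chart_img phi (base + z *: w) by apply: img; rewrite addrC addKr ltW.
    by have [_] := coord_point iz.
  exact: (@derive_val _ _ _ _ _ _ _ d1).
have /andP[_ h2] := hb w; apply: le_trans h2 _.
by rewrite ler_pM2l.
Qed.

End Riemannian.

(** * The nonlinear equation *)

Section ProductSolve.
Context {R : realType} {n : nat} (G : lieGroup R n).
Let V := 'rV[R]_n.
Local Notation pt := (@pt R n G).
Local Notation lmul := (@lmul R n G).
Context {rho A : R} {E : V -> V} (L : local_exp G rho A E).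
Local Notation lexp := (@lexp R n G E).
Let rho0 : 0 < rho := le_rho L.
Let A0 : 0 < A := le_A L.

(** F is a nonlinear map with model f, and the Lipschitz constant of F - f is O(M) on the ball of
    radius M. The constants do not refer to f, so the estimates stay uniform in b, on which f
    depends. *)
Definition approx (c K r : R) (F f : V -> V) :=
  [/\ F 0 = 0, f 0 = 0, forall w w', `|f w - f w'| <= c * `|w - w'|,
      forall w, `|w| <= r -> `|F w| <= 2 * rho &
      forall M w w', `|w| <= M -> `|w'| <= M -> M <= r ->
        `|F w - F w' - (f w - f w')| <= K * M * `|w - w'|].

Lemma approx_exp (c : R) : 0 < c -> exists K r, [/\ 0 < K, 0 < r, c * r <= rho &
  forall f : V -> V, f 0 = 0 -> (forall w w', `|f w - f w'| <= c * `|w - w'|) ->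
    approx c K r (E \o f) f].
Proof.
move=> c0; exists (2 * A * c * c), (rho / c); split.
- by rewrite !mulr_gt0.
- by rewrite divr_gt0.
- by rewrite mulrC divfK// gt_eqF.
move=> f f0 fl.
have fb w M : `|w| <= M -> `|f w| <= c * M.
  move=> wM; have := fl w 0; rewrite f0 !subr0 => /le_trans; apply.
  by rewrite ler_pM2l.
have cr (M : R) : M <= rho / c -> c * M <= rho.
  by move=> h; rewrite mulrC -ler_pdivlMr.
split => //=; first by rewrite f0 (E0 L).
  move=> w wr; have h := fb w _ wr; have h' := cr _ (lexx _).
  have := E_norm L (le_trans h h'); move: h h'; lra.
move=> M w w' wM wM' Mr.
have [_ ni] := le_near_id L.
apply: le_trans (ni _ _ (c * M) (fb _ _ wM) (fb _ _ wM') (cr _ Mr)) _.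
have M0 : 0 <= M by apply: le_trans wM.
have -> : 2 * A * c * c * M * `|w - w'| = 2 * A * (c * M) * (c * `|w - w'|) by ring.
by rewrite ler_wpM2l// !mulr_ge0// ltW.
Qed.

(** Multiplying maps adds their models: the deviation of the group law from addition, controlled by
    [le_strict], enters as one more term of the same order. *)
Lemma approx_mul (c1 K1 r1 c2 K2 r2 : R) : 0 < c1 -> 0 < K1 -> 0 < r1 -> 0 < c2 -> 0 < K2 -> 0 < r2 ->
  exists c K r, [/\ 0 < c, 0 < K, 0 < r, r <= r1 & forall F f F' f',
    approx c1 K1 r1 F f -> approx c2 K2 r2 F' f' ->
    approx c K r (fun w => lmul (F w) (F' w)) (fun w => f w + f' w) /\
    forall w, `|w| <= r -> pt (lmul (F w) (F' w)) = (pt (F w) * pt (F' w))%g].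
Proof.
move=> c10 K10 r10 c20 K20 r20.
(* A common Lipschitz constant of both factors on balls of radius at most 1. In [r] below, the
   bounds by [2 * rho] keep the factors and their product in the chart. *)
pose S := c1 + c2 + K1 + K2; have S0 : 0 < S by rewrite !addr_gt0.
pose c := c1 + c2; have c0 : 0 < c by rewrite addr_gt0.
pose K := K1 + K2 + A * S * S; have K0 : 0 < K by rewrite !addr_gt0 ?mulr_gt0.
pose r := Num.min (Num.min r1 r2) (Num.min 1 (Num.min (2 * rho / S) (2 * rho / (c + K)))).
have r0 : 0 < r by rewrite !lt_min r10 r20 ltr01 !divr_gt0 ?addr_gt0 ?mulr_gt0.
have rr1 : r <= r1 by rewrite !ge_min lexx.
have rr2 : r <= r2 by rewrite !ge_min lexx !orbT.
have rl1 : r <= 1 by rewrite !ge_min lexx !orbT.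
have rS : r * S <= 2 * rho by rewrite -ler_pdivlMr// !ge_min lexx !orbT.
have cK : 0 < c + K by rewrite addr_gt0.
have rK : r * (c + K) <= 2 * rho by rewrite -(ler_pdivlMr _ _ cK) !ge_min lexx !orbT.
exists c, K, r; split => //.
move=> F f F' f' [F0 f0 fl Fs Fe] [F'0 f'0 f'l F's F'e].
have lip (H h : V -> V) (d k q : R) : 0 < k -> d + k <= S -> r <= q ->
    (forall w w', `|h w - h w'| <= d * `|w - w'|) ->
    (forall M w w', `|w| <= M -> `|w'| <= M -> M <= q ->
        `|H w - H w' - (h w - h w')| <= k * M * `|w - w'|) ->
    forall w w', `|w| <= r -> `|w'| <= r -> `|H w - H w'| <= S * `|w - w'|.
  move=> k0 dk rq hl He w w' wr wr'.
  have h1 := He r w w' wr wr' rq; have h2 := hl w w'.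
  have h3 : `|H w - H w'| <= `|H w - H w' - (h w - h w')| + `|h w - h w'|.
    by rewrite -[X in `|X| <= _](subrK (h w - h w')) ler_normD.
  have h4 : k * r * `|w - w'| <= k * `|w - w'|.
    by rewrite ler_wpM2r// ler_piMr// ltW.
  have h5 : (d + k) * `|w - w'| <= S * `|w - w'| by rewrite ler_wpM2r.
  rewrite mulrDl in h5; lra.
have lF := lip F f c1 K1 r1 K10 ltac:(rewrite /S; lra) rr1 fl Fe.
have lF' := lip F' f' c2 K2 r2 K20 ltac:(rewrite /S; lra) rr2 f'l F'e.
have bd (H : V -> V) : H 0 = 0 -> (forall w w', `|w| <= r -> `|w'| <= r -> `|H w - H w'| <= S * `|w - w'|) ->
    forall w M, `|w| <= M -> M <= r -> `|H w| <= S * M.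
  move=> H0 l w M wM Mr; have := l w 0 (le_trans wM Mr); rewrite normr0 H0 !subr0.
  by move=> /(_ (ltW r0)) /le_trans; apply; rewrite ler_pM2l.
have bF := bd F F0 lF; have bF' := bd F' F'0 lF'.
have err M w w' : `|w| <= M -> `|w'| <= M -> M <= r ->
    `|lmul (F w) (F' w) - lmul (F w') (F' w') - (f w + f' w - (f w' + f' w'))| <= K * M * `|w - w'|.
  move=> wM wM' Mr.
  have M0 : 0 <= M by apply: le_trans wM.
  have SM : S * M <= 2 * rho.
    by apply: le_trans rS; rewrite mulrC ler_wpM2r// ltW.
  have h1 := le_strict L (bF w M wM Mr) (bF' w M wM Mr) (bF w' M wM' Mr) (bF' w' M wM' Mr) SM
    (lF w w' (le_trans wM Mr) (le_trans wM' Mr)) (lF' w w' (le_trans wM Mr) (le_trans wM' Mr)).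
  have h2 := Fe M w w' wM wM' (le_trans Mr rr1).
  have h3 := F'e M w w' wM wM' (le_trans Mr rr2).
  move: h1 h2 h3; set x := F w; set x' := F w'; set y := F' w; set y' := F' w'.
  move: (lmul x y) (lmul x' y') => p p'.
  move=> h1 h2 h3.
  have -> : p - p' - (f w + f' w - (f w' + f' w')) =
      (p - p' - (x + y - (x' + y'))) + ((x - x' - (f w - f w')) + (y - y' - (f' w - f' w'))).
    move: (f w) (f w') (f' w) (f' w') => a a' b b'; clearbody x x' y y'.
    by apply/rowP => j; rewrite !mxE; ring.
  apply: le_trans (ler_normD _ _) _.
  have h4 := ler_normD (x - x' - (f w - f w')) (y - y' - (f' w - f' w')).
  have -> : K * M * `|w - w'| = A * (S * M) * (S * `|w - w'|) + (K1 * M * `|w - w'| + K2 * M * `|w - w'|).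
    by rewrite /K; ring.
  by apply: lerD h1 _; apply: le_trans h4 _; apply: lerD.
split; last first.
  move=> w wr; apply: (le_mul L).
    by apply: Fs; exact: le_trans wr rr1.
  by apply: F's; exact: le_trans wr rr2.
have FF0 : lmul (F 0) (F' 0) = 0 by rewrite F0 F'0 lmul00.
have ff0 : f 0 + f' 0 = 0 by rewrite f0 f'0 addr0.
have ffl w w' : `|f w + f' w - (f w' + f' w')| <= c * `|w - w'|.
  have -> : f w + f' w - (f w' + f' w') = (f w - f w') + (f' w - f' w').
    by rewrite opprD addrACA.
  by apply: le_trans (ler_normD _ _) _; rewrite mulrDl lerD.
split => //.
move=> w wr.
have := err r w 0 wr; rewrite normr0 => /(_ (ltW r0) (lexx r)).
have := ffl w 0; rewrite FF0 ff0 !subr0 => h1 h2.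
have h3 : `|lmul (F w) (F' w)| <= `|lmul (F w) (F' w) - (f w + f' w)| + `|f w + f' w|.
  by rewrite -[X in `|X| <= _](subrK (f w + f' w)) ler_normD.
apply: le_trans h3 _; apply: le_trans (lerD h2 h1) _; apply: le_trans rK.
have h4 : K * r * `|w| <= K * r.
  by rewrite ler_piMr ?mulr_ge0 ?(ltW K0) ?(ltW r0)//; exact: le_trans wr rl1.
have h5 : c * `|w| <= c * r by rewrite ler_pM2l.
rewrite mulrDr [r * c]mulrC [r * K]mulrC; lra.
Qed.

(** The models [f i] add up to the identity, so the product of the four exponentials, read in the
    chart, is close to the identity and [near_id_surj] solves the equation. *)
Lemma product_solve (C : R) : 0 < C -> exists2 r : R, 0 < r & C * r <= rho /\
  forall f : 'I_4 -> V -> V, (forall i, f i 0 = 0) ->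
    (forall i w w', `|f i w - f i w'| <= C * `|w - w'|) -> (forall w, f 0 w + f 1 w + f 2 w + f 3 w = w) ->
  forall z, 2 * `|z| <= r -> exists2 w, `|w| <= 2 * `|z| &
    (lexp (f 0%R w) * lexp (f 1%R w) * lexp (f 2%R w) * lexp (f 3%R w))%g = pt z.
Proof.
move=> C0; have [K1 [r1 [K10 r10 Cr H1]]] := approx_exp C0.
have [c2 [K2 [r2 [c20 K20 r20 r21 H2]]]] := approx_mul C0 K10 r10 C0 K10 r10.
have [c3 [K3 [r3 [c30 K30 r30 r32 H3]]]] := approx_mul c20 K20 r20 C0 K10 r10.
have [c4 [K4 [r4 [c40 K40 r40 r43 H4]]]] := approx_mul c30 K30 r30 C0 K10 r10.
(* Makes K4 r <= 1/2, the contraction ratio required by [near_id_surj]. *)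
pose r := Num.min r4 (2^-1 / K4).
have r0 : 0 < r by rewrite lt_min r40 divr_gt0.
have rr4 : r <= r4 by rewrite ge_min lexx.
exists r => //; split.
  apply: le_trans Cr; rewrite ler_pM2l//.
  exact: le_trans rr4 (le_trans r43 (le_trans r32 r21)).
move=> f f0 fl fs z zr.
have a i := H1 (f i) (f0 i) (fl i).
have [a2 p2] := H2 _ _ _ _ (a 0) (a 1).
have [a3 p3] := H3 _ _ _ _ a2 (a 2).
have [a4 p4] := H4 _ _ _ _ a3 (a 3).
move: a4 p4; set g := (fun w => lmul _ _) => [[g0 _ _ _ ge]] p4.
have [w wz gw] : exists2 w, `|w| <= 2 * `|z| & g w = z.
  apply: (near_id_surj (r := r)) => // x y xr yr.
  have := ge r x y xr yr rr4; rewrite !fs => h; apply: le_trans h _.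
  rewrite ler_wpM2r// mulrC -ler_pdivlMr//.
  by rewrite ge_min lexx orbT.
exists w => //; have wr : `|w| <= r4 by exact: le_trans wz (le_trans zr rr4).
have wr3 := le_trans wr r43; have wr2 := le_trans wr3 r32.
by rewrite -gw p4// p3// p2.
Qed.
End ProductSolve.

Lemma bilinear_gram (R : realType) n (b : 'rV[R]_n -> 'rV[R]_n -> R) :
  (forall X Y Z, b (X + Y) Z = b X Z + b Y Z) -> (forall k X Z, b (k *: X) Z = k * b X Z) ->
  (forall X Y Z, b Z (X + Y) = b Z X + b Z Y) -> (forall k X Z, b Z (k *: X) = k * b Z X) ->
  forall X Y, inner (\matrix_(i, j) b (delta_mx 0 i) (delta_mx 0 j)) X Y = b X Y.
Proof.
move=> Dl Zl Dr Zr X Y; rewrite inner_sum.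
have b0l Z : b 0 Z = 0 by rewrite -(scale0r (0 : 'rV_n)) Zl mul0r.
have b0r Z : b Z 0 = 0 by rewrite -(scale0r (0 : 'rV_n)) Zr mul0r.
have sl (f : 'I_n -> 'rV_n) Z : b (\sum_i f i) Z = \sum_i b (f i) Z.
  by elim/big_ind2 : _ => // x x' y y' <- <-.
have sr (f : 'I_n -> 'rV_n) Z : b Z (\sum_i f i) = \sum_i b Z (f i).
  by elim/big_ind2 : _ => // x x' y y' <- <-.
rewrite [in RHS](row_sum_delta X) sl; apply: eq_bigr => i _.
rewrite Zl [in RHS](row_sum_delta Y) sr mulr_sumr; apply: eq_bigr => j _.
by rewrite mxE Zr mulrA.
Qed.

(** * The Cartan form and the decomposition for the group *)

Section Group.
Context {R : realType} {n : nat} (G : lieGroup R n).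
Let V := 'rV[R]_n.
Local Notation "'[Lie' X , Y ]" := (bracket (G := G) X Y).
Local Notation Kf := (killing (G := G)).

Lemma involution_at1 (f : G -> G) : lie_involution f ->
  [/\ diff1 f, {morph f : x y / (x * y)%g}, linear (tangent_map f : V -> V) & involutive (tangent_map f : V -> V)].
Proof.
move=> [fs fM fK].
have f1 : f 1%g = 1%g by apply: (mulgI (f 1%g)); rewrite -fM !mulg1.
have df := smooth_diff1 fs f1; split => //; first exact: tangent_map_linear.
move=> X; have [_ h] := tangent_map_comp df df.
have e : f \o f = id by apply/funext => x /=; rewrite fK.
have := congr1 (fun F : V -> V => F X) h; rewrite e tangent_map_id /= => {2}->.
by [].
Qed.

Section Decomposition.
Variables (sigma theta : G -> G).
Hypothesis sigma_involution : lie_involution sigma.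
Hypothesis theta_cartan : cartan_involution theta.
Hypothesis sigma_theta_commute : forall x, sigma (theta x) = theta (sigma x).
Let sg := tangent_map sigma : V -> V.
Let th := tangent_map theta : V -> V.
Let tau := sigma \o theta.
Let theta_involution : lie_involution theta := theta_cartan.1.

Lemma sg_th X : sg (th X) = th (sg X).
Proof.
have [d1 _ _ _] := involution_at1 sigma_involution.
have [d2 _ _ _] := involution_at1 theta_involution.
have [_ h1] := tangent_map_comp d1 d2; have [_ h2] := tangent_map_comp d2 d1.
have e : sigma \o theta = theta \o sigma by apply/funext => x; exact: sigma_theta_commute.
have e1 := congr1 (fun F : V -> V => F X) h1; have e2 := congr1 (fun F : V -> V => F X) h2.
by rewrite /= in e1 e2; rewrite /sg /th -e1 -e2 e.
Qed.

Lemma tau_fixed X : lie_algebra_of (fixed_points tau) X <-> sg (th X) = X.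
Proof.
have [d1 m1 _ _] := involution_at1 sigma_involution.
have [d2 m2 _ _] := involution_at1 theta_involution.
have [d3 h1] := tangent_map_comp d1 d2.
have m3 : {morph tau : x y / (x * y)%g} by move=> x y; rewrite /tau /= m2 m1.
have h := lie_algebra_of_fixed X d3 m3.
by have e1 := congr1 (fun F : V -> V => F X) h1; rewrite e1 in h.
Qed.

Definition cartan_gram : 'M[R]_n := \matrix_(i, j) (- Kf (delta_mx 0 i) (th (delta_mx 0 j))).

Lemma inner_cartan X Y : inner cartan_gram X Y = - Kf X (th Y).
Proof.
have [_ _ thL _] := involution_at1 theta_involution.
apply: (bilinear_gram (b := fun X Y => - Kf X (th Y))).
- by move=> A B C; rewrite killingDl opprD.
- by move=> k A B; rewrite killingZl mulrN.
- by move=> A B C; rewrite linD// killingDr opprD.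
- by move=> k A B; rewrite linZ// killingZr mulrN.
Qed.

Lemma killing_th X Y : Kf (th X) (th Y) = Kf X Y.
Proof.
have [d m thL thK] := involution_at1 theta_involution.
by apply: (killing_aut X Y thL thL thK thK) => A B; exact: tangent_map_bracket.
Qed.

Lemma cartan_sym : cartan_gram^T = cartan_gram.
Proof.
have [_ _ _ thK] := involution_at1 theta_involution.
apply/matrixP => i j; rewrite !mxE killingC -killing_th; congr (- Kf _ _).
by rewrite /th thK.
Qed.

Lemma cartan_pos v : v != 0 -> 0 < inner cartan_gram v v.
Proof. by move=> v0; rewrite inner_cartan; exact: theta_cartan.2. Qed.

Lemma cartan_br X Y Z : inner cartan_gram ([Lie Z, X]) Y = - inner cartan_gram X ([Lie th Z, Y]).
Proof.
have [d m _ thK] := involution_at1 theta_involution.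
have e : th ([Lie th Z, Y]) = [Lie Z, th Y].
  by rewrite /th (tangent_map_bracket d m) thK.
by rewrite (inner_cartan ([Lie Z, X]) Y) (inner_cartan X ([Lie th Z, Y])) e (killing_ad G Z X (th Y)).
Qed.

Variables (a : {vspace V}) (P : set 'Hom(subvs_of a, R^o)) (c : R).
Hypothesis a_maximal : maximal_abelian_in (G := G) (eigen_minus theta `&` eigen_minus sigma) a.
Hypothesis P_positive : positive_system G P.
Hypothesis c_gt0 : 0 < c.
Let Pt := P `&` fixed_roots a tau.
Let Delta := simple_roots Pt.

(** Adjoining the line of Z to a gives an abelian subspace of the same kind, which equals a by
    maximality. *)
Lemma a_maximal_element Z : th Z = - Z -> sg Z = - Z -> (forall Y, Y \in a -> [Lie Y, Z] = 0) -> Z \in a.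
Proof.
move=> hth hsg hbr.
have [_ _ thL _] := involution_at1 theta_involution.
have [_ _ sgL _] := involution_at1 sigma_involution.
have [ [aS aab] amax] := a_maximal.
have e : (a + <[Z]>)%VS = a.
  apply: amax; last exact: addvSl.
  have dec X : X \in (a + <[Z]>)%VS -> exists2 Y, Y \in a & exists k : R, X = Y + k *: Z.
    by move=> /memv_addP[Y Ya [W /vlineP[k ->] ->] ]; exists Y => //; exists k.
  split.
    move=> X /dec[Y Ya [k ->] ]; have [h1 h2] := aS Y Ya.
    have h1' : th Y = - Y := h1; have h2' : sg Y = - Y := h2.
    split; rewrite /eigen_minus /=.
      by rewrite -/th (linD _ _ (thL : linear th)) (linZ _ _ (thL : linear th)) hth h1' scalerN opprD.
    by rewrite -/sg (linD _ _ (sgL : linear sg)) (linZ _ _ (sgL : linear sg)) hsg h2' scalerN opprD.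
  move=> X X' /dec[Y Ya [k ->] ] /dec[Y' Ya' [k' ->] ].
  rewrite bracketDl !bracketDr !bracketZl !bracketZr aab// hbr// bracketXX.
  by rewrite (bracketC G Z Y') hbr// oppr0 !scaler0 !addr0.
by rewrite -e; apply: (subvP (addvSr _ _)); exact: memv_line.
Qed.

Lemma uniform_decomposition : exists2 C : R, 0 < C &
  forall (I : set 'Hom(subvs_of a, R^o)) (X : subvs_of a), I `<=` Delta -> closed_chamber Pt X ->
  (forall al, (Delta `\` I) al -> c < (al X : R)) ->
  exists N : 'I_4 -> 'M[R]_n, forall w : V,
  [/\ th (w *m N 0) = w *m N 0,
     generated_subalgebra (G := G) [set X | lie_algebra_of (fixed_points tau) X /\
       exists beta, [/\ Pt beta, in_span I beta & root_space G beta X \/ root_space G (- beta) X] ] (w *m N 1),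
     (exists2 y : subvs_of a, (forall al, I al -> (al y : R) = 0) & vsval y = w *m N 2),
     sg (w *m N 3) = w *m N 3 &
  [/\ forall i, `|w *m N i| <= C * `|w|, `|Ad (expG (vsval X) : G) (w *m N 3)| <= C * `|w| &
     w *m N 0 + w *m N 1 + w *m N 2 + Ad (expG (vsval X) : G) (w *m N 3) = w] ].
Proof.
have [d1 m1 sgL sgK] := involution_at1 sigma_involution.
have [d2 m2 thL thK] := involution_at1 theta_involution.
have [ [aS aab] amax] := a_maximal.
have [X0 X0reg PE] := P_positive.
have th_br Y Z : th ([Lie Y, Z]) = [Lie th Y, th Z] by exact: tangent_map_bracket.
have sg_br Y Z : sg ([Lie Y, Z]) = [Lie sg Y, sg Z] by exact: tangent_map_bracket.
have a_th Y : Y \in a -> th Y = - Y by move=> /aS[h _]; exact: h.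
have a_sg Y : Y \in a -> sg Y = - Y by move=> /aS[_ h]; exact: h.
have Pt_pos al : Pt al -> 0 < (al X0 : R) by rewrite /Pt PE => -[ [] ].
have Pt_vec al : Pt al -> exists X, [/\ X != 0, weight_space (bracket (G := G)) al X & sg (th X) = X].
  by move=> [_ [_ [X [h1 /tau_fixed h2 h3] ] ] ]; exists X; split; [exact: h3|exact: h1|exact: h2].
have Pt_or (al : 'Hom(subvs_of a, R^o)) X : al != 0 -> X != 0 -> weight_space (bracket (G := G)) al X -> sg (th X) = X ->
    Pt al \/ Pt (- al).
  move=> al0 x0 h1 h2.
  have ra : roots G a al by split => //; exists X.
  have h1' : weight_space (bracket (G := G)) (- al) (th X).
    exact: (weight_th (@bracket_linl _ _ G) thL th_br a_th h1).
  have x0' : th X != 0.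
    apply: contraNneq x0 => e; have E : tangent_map theta X = 0 := e.
    by rewrite -(thK X) E lin0.
  have h2' : sg (th (th X)) = th X := etrans (sg_th (th X)) (congr1 th h2).
  have ra' : roots G a (- al) by split; [rewrite oppr_eq0|exists (th X)].
  (* X0 is regular, so [al] is nonzero there. If it is negative, theta X is a tau-fixed vector of
     weight [- al] and puts that root into [Pt]. *)
  have [al_pos|al_neg|al_0] := ltgtP 0 (al X0 : R).
  - left; split; first by rewrite PE.
    by split; [exact: ra|exists X; split; [exact: h1|apply/tau_fixed; exact: h2|exact: x0] ].
  - right; split; first by rewrite PE; split => //=; rewrite lfunE /= oppr_gt0.
    by split; [exact: ra'|exists (th X); split; [exact: h1'|apply/tau_fixed; exact: h2'|exact: x0'] ].
  - by have := X0reg al ra; rewrite -al_0 eqxx.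
have [C C0 hC] := good_uniform (@bracket_linl _ _ G) (@bracket_linr _ _ G) (@bracketC _ _ G) (@jacobi _ _ G)
  thL sgL thK sgK (fun X => esym (sg_th X)) th_br sg_br cartan_sym cartan_pos cartan_br a_th a_sg aab
  a_maximal_element Pt_pos Pt_vec Pt_or c_gt0.
exists C => // I X I1 I2 I3.
have [|N hN] := hC I X (Ad (expG (vsval X) : G)) I1 I2 I3 (Ad_linear _).
  by move=> Y lam; exact: Ad_expG_eigen.
exists N => w; have [h1 h2 h3 h4 h5] := hN w; split => //.
move=> U hU hB; apply: h2 => // Y [k1 [be [k2 k3 k4] ] ].
by apply: hB; split; [apply/tau_fixed|exists be].
Qed.
End Decomposition.
End Group.

(** * The factorisation in the group *)

Section Assembly.
Context {R : realType} {n : nat} (G : lieGroup R n).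
Let V := 'rV[R]_n.

(** The one-parameter subgroup is a connected set of fixed points through 1, so it lies in the
    identity component, which H shares. *)
Lemma exp_component (f : G -> G) (H : set G) (Y : V) : lie_involution f ->
  connected_component H 1%g = connected_component (fixed_points f) 1%g ->
  tangent_map f Y = Y -> H (expG Y).
Proof.
move=> hf hH hY; have [df fM _ _] := involution_at1 hf.
apply: (@connected_component_sub _ H 1%g); rewrite hH.
set Z := (fun t : R => expG (t *: Y) : G) @` [set: R].
have Zs : Z `<=` connected_component (fixed_points f) 1%g.
  apply: connected_component_max.
  - by exists 0 => //; rewrite scale0r expG0.
  - by move=> _ [t _ <-]; rewrite /fixed_points /= (expG_hom _ df fM) tangent_mapZ hY.
  - apply: connected_continuous_connected.
      by apply/connected_intervalP => x y _ _ z _.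
    by apply: continuous_subspaceT; exact: expG_continuous.
by apply: Zs; exists 1 => //; rewrite scale1r.
Qed.

Lemma Ad_compact_bound (theta : G -> G) : cartan_involution theta ->
  exists2 B : R, 1 <= B & forall k v, fixed_points theta k -> `|Ad k v| <= B * `|v|.
Proof.
move=> ht; have [d m thL thK] := involution_at1 ht.1.
have [k0 k00 hk] := posdef_lower_bound (cartan_pos ht).
set N := cartan_gram theta in hk *.
pose Q := n%:R ^+ 2 * `|N| / k0.
have Q0 : 0 <= Q by rewrite divr_ge0 ?mulr_ge0 ?sqr_ge0// ltW.
have s0 : 0 <= Num.sqrt Q := sqrtr_ge0 Q.
exists (Num.sqrt Q + 1); first by rewrite lerDr.
move=> k v kK.
have e : inner N (Ad k v) (Ad k v) = inner N v v.
  rewrite /N !inner_cartan// (tangent_map_Ad d m).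
  by have -> : theta k = k := kK; rewrite killing_Ad.
have h1 := hk (Ad k v); rewrite e in h1.
have h2 : `|inner N v v| <= n%:R ^+ 2 * `|N| * (`|v| * `|v|).
  by apply: inner_bound => i j; exact: coord_le_norm.
have h3 : `|Ad k v| ^+ 2 <= Q * `|v| ^+ 2.
  rewrite -(ler_pM2l k00); apply: le_trans h1 _; apply: le_trans (ler_norm _) _.
  apply: le_trans h2 _; rewrite -expr2 /Q.
  have -> : k0 * (n%:R ^+ 2 * `|N| / k0 * `|v| ^+ 2) = n%:R ^+ 2 * `|N| * `|v| ^+ 2 * (k0 / k0) by ring.
  by rewrite divff ?mulr1// gt_eqF.
have h4 : `|Ad k v| <= Num.sqrt Q * `|v|.
  rewrite -(ler_pXn2r (n := 2)) ?nnegrE ?mulr_ge0//.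
  by rewrite exprMn sqr_sqrtr.
by apply: le_trans h4 _; rewrite ler_wpM2r// lerDl.
Qed.

Lemma conj_fixed (f : G -> G) (k x : G) : diff1 f -> {morph f : x y / (x * y)%g} ->
  f k = k -> f x = x -> f (k * x * k^-1)%g = (k * x * k^-1)%g.
Proof. by move=> d m hk hx; rewrite !m (morphV d m) hk hx. Qed.

End Assembly.

Theorem theorem4p2 (R : realType) (n : nat) (G : lieGroup R n)
    (metric : riemannian_metric G)
    (G_connected : connected [set: G])
    (G_noncompact : ~ compact [set: G])
    (G_semisimple : semisimple G)
    (G_finite_center : finite_set (group_center G))
    (sigma : G -> G) (sigma_involution : lie_involution sigma)
    (H : set G) (H_subgroup : is_subgroup H) (H_closed : closed H)
    (H_component : connected_component H 1%g =
                   connected_component (fixed_points sigma) 1%g)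
    (theta : G -> G) (theta_cartan : cartan_involution theta)
    (sigma_theta_commute : forall x, sigma (theta x) = theta (sigma x))
    (a : {vspace 'rV[R]_n})
    (a_maximal : maximal_abelian_in (G := G)
                   (eigen_minus theta `&` eigen_minus sigma) a)
    (P : set 'Hom(subvs_of a, R^o)) (P_positive : positive_system G P)
    (c : R) (c_gt0 : 0 < c) :
  let K := fixed_points theta in
  let O := ball1 metric in
  let tau := sigma \o theta in
  let Pt := P `&` fixed_roots a tau in
  let Delta := simple_roots Pt in
  exists l eps0 : R, [/\ 1 < l, 0 < eps0 &
    forall I : set 'Hom(subvs_of a, R^o), I `<=` Delta ->
    forall (k : G) (X : subvs_of a) (h : G) (eps : R),
      K k -> closed_chamber Pt X -> H h ->
      (forall alpha, (Delta `\` I) alpha -> c < (alpha X : R)) ->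
      0 < eps -> eps < eps0 ->
      let b := expG (vsval X) in
      O eps ** [set (k * b * h)%g] `<=`
        (K `&` O (l * eps)) ** [set k]
        ** (M_sub tau Pt I `&` O (l * eps))
        ** ((A_sub G I `&` O (l * eps)) ** [set b])
        ** ((H `&` O (l * eps)) ** [set h])].
Proof.
move=> K O tau Pt Delta.
have [rho [A [E L]]] := exists_local_exp G.
have rho0 := le_rho L.
have [C1 C10 [e1 e10 ball_coord]] := ball1_coord_bound metric.
have [C2 C20 [d2 d20 coord_ball]] := ball1_contains metric.
have [C C0 decomp] := uniform_decomposition sigma_involution theta_cartan
  sigma_theta_commute a_maximal P_positive c_gt0.
have [B B1 AdK] := Ad_compact_bound theta_cartan.
have [r r0 [Cr solve]] := product_solve L C0.
have B0 : 0 < B by exact: lt_le_trans B1.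
have [dth mth thL thK] := involution_at1 theta_cartan.1.
(* [q] bounds w: a factor 2 for the logarithm Z of x, B for Ad(k^-1), 2 for [E], and 2 for the
   solution w. [p] bounds the exponents: C for the linear solution, B for conjugating the K-factor
   back by k. *)
pose q := 8 * B * C1; have q0 : 0 < q by rewrite !mulr_gt0.
pose p := B * C * q; have p0 : 0 < p by rewrite !mulr_gt0.
(* The term 2p bounds [E v]; the term C2^-1 makes l = C2 kap = 2 C2 p + 1 exceed 1. *)
pose kap := 2 * p + C2^-1; have kap0 : 0 < kap by rewrite addr_gt0 ?mulr_gt0 ?invr_gt0.
pose Q := q + p + kap; have Q0 : 0 < Q := addr_gt0 (addr_gt0 q0 p0) kap0.
(* One threshold for the exponential chart, the fixed point argument and the passage from
   coordinates to balls. *)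
pose mu := Num.min rho (Num.min r d2).
have mu0 : 0 < mu by rewrite !lt_min rho0 r0 d20.
exists (C2 * kap), (Num.min e1 (mu / Q)); split.
- by rewrite /kap mulrDr mulfV ?gt_eqF// ltrDr !mulr_gt0.
- by rewrite lt_min e10 divr_gt0.
move=> I I_Delta k X h eps kK X_chamber hH X_far eps0; rewrite lt_min => /andP[eps_e1 eps_mu] b.
have Qeps : Q * eps < mu by rewrite mulrC -ltr_pdivlMr.
have Q_le s : 0 <= s -> s <= Q -> s * eps < mu.
  by move=> s0 sQ; apply: le_lt_trans Qeps; rewrite ler_pM2r.
have mu_rho : mu <= rho by rewrite ge_min lexx.
have mu_r : mu <= r by rewrite !ge_min lexx orbT.
have mu_d2 : mu <= d2 by rewrite !ge_min lexx !orbT.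
have q_mu : q * eps < mu by apply: Q_le; rewrite /Q; lra.
have p_mu : p * eps < mu by apply: Q_le; rewrite /Q; lra.
have kap_mu : kap * eps < mu by apply: Q_le; rewrite /Q; lra.
have small v : `|v| <= p * eps -> O (C2 * kap * eps) (expG v).
  move=> vp; have vrho : `|v| <= rho by lra.
  rewrite (expG_expo L) (expo_lexp L vrho).
  have [d e] := lexp_dom L vrho.
  rewrite -mulrA; apply: coord_ball => //; [by rewrite mulr_gt0|lra|].
  rewrite e; apply: le_trans (E_norm L vrho) _.
  have : kap * eps = 2 * (p * eps) + C2^-1 * eps by rewrite /kap; ring.
  have : 0 < C2^-1 * eps by rewrite mulr_gt0 ?invr_gt0.
  lra.
move=> _ [x Ox [_ -> <-]].
have [dx lx] := ball_coord eps x eps_e1 Ox.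
have C1q : 8 * (C1 * eps) <= q * eps.
  have -> : q * eps = B * (8 * (C1 * eps)) by rewrite /q; ring.
  by rewrite ler_peMl// !mulr_ge0// ltW.
have lx0 : 0 <= `|lg x| := normr_ge0 _.
have [Z Zx xE] := lexp_surj L dx ltac:(lra).
have Zrho : `|Z| <= rho by lra.
set Z' := Ad k^-1%g Z.
have kVK : fixed_points theta k^-1%g.
  by rewrite /fixed_points /= (morphV dth mth); have -> : theta k = k := kK.
have Z'q : 4 * `|Z'| <= q * eps.
  have h1 := AdK _ Z kVK; rewrite -/Z' in h1.
  have h2 : B * `|Z| <= B * (2 * (C1 * eps)) by rewrite ler_pM2l//; lra.
  have : q * eps = 4 * (B * (2 * (C1 * eps))) by rewrite /q; ring.
  lra.
have Z'0 : 0 <= `|Z'| := normr_ge0 _.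
have Z'rho : `|Z'| <= rho by lra.
have conj_x : (k^-1 * x * k)%g = pt G (E Z').
  have := conj_expG k^-1%g Z; rewrite invgK -/Z' !(expG_expo L) (expo_lexp L Zrho) xE.
  by rewrite (expo_lexp L Z'rho).
have [N hN] := decomp I X I_Delta X_chamber X_far.
pose T v := Ad (expG (vsval X) : G) v.
(* The last factor is Ad(b) h' rather than h', so that b exp(h') b^-1 is a single exponential with
   exponent bounded independently of b. *)
pose f (i : 'I_4) (w : 'rV[R]_n) := if i == 3 then T (w *m N 3) else w *m N i.
have TL : linear T := Ad_linear _.
have fL i : linear (f i).
  move=> s u v; rewrite /f; case: ifP => _; first by rewrite mulmxDl -scalemxAl TL.
  by rewrite mulmxDl -scalemxAl.
have f_le i w : `|f i w| <= C * `|w|.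
  have [_ _ _ _ [h1 h2 _]] := hN w; rewrite /f; case: ifP => _; [exact: h2|exact: h1].
have zb : 2 * `|E Z'| <= q * eps by have := E_norm L Z'rho; lra.
have [w wz wE] : exists2 w, `|w| <= 2 * `|E Z'| &
    (@lexp R n G E (f 0%R w) * @lexp R n G E (f 1%R w) * @lexp R n G E (f 2%R w) * @lexp R n G E (f 3%R w))%g = pt G (E Z').
  apply: solve; last by lra.
  - by move=> i; exact: lin0.
  - move=> i u v; have -> : f i u - f i v = f i (u - v) by rewrite (linD _ _ (fL i)) (linN _ (fL i)).
    exact: f_le.
  - by move=> u; have [_ _ _ _ [_ _]] := hN u.
have Cw : C * `|w| <= rho.
  by apply: le_trans Cr; rewrite ler_pM2l//; lra.
have exp_f i : @lexp R n G E (f i w) = expG (f i w).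
  by rewrite (expG_expo L) (expo_lexp L)//; exact: le_trans (f_le i w) Cw.
have Cwp : B * (C * `|w|) <= p * eps.
  have -> : p * eps = B * (C * (q * eps)) by rewrite /p; ring.
  by rewrite !ler_pM2l//; lra.
have Cwp1 : C * `|w| <= p * eps.
  by apply: le_trans Cwp; rewrite ler_peMl// mulr_ge0// ltW.
have [Nk Nm [y yI yE] Nh [N_le _ _]] := hN w.
have kE : (k * expG (w *m N 0%R) * k^-1)%g = expG (Ad k (w *m N 0%R)) by exact: conj_expG.
have bE : (b * expG (w *m N 3%R) * b^-1)%g = expG (f 3%R w) by exact: conj_expG.
(* Written as k (k^-1 x k) b h, the element x g absorbs the factorisation of k^-1 x k: the b^-1 of
   the last factor cancels b, and k exp(k') becomes (k exp(k') k^-1) k, with K-part on the left. *)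
have main : (x * (k * b * h))%g =
  (k * expG (w *m N 0%R) * k^-1 * k * expG (w *m N 1%R) * (expG (w *m N 2%R) * b) * (expG (w *m N 3%R) * h))%g.
  have -> : x = (k * (k^-1 * x * k) * k^-1)%g by rewrite !mulgA mulgV mul1g mulgK.
  rewrite conj_x -wE !exp_f -bE.
  by rewrite !mulgA !mulgVK.
rewrite main.
exists (k * expG (w *m N 0%R) * k^-1 * k * expG (w *m N 1%R) * (expG (w *m N 2%R) * b))%g; last first.
  exists (expG (w *m N 3%R) * h)%g => //.
  exists (expG (w *m N 3%R)); last by exists h.
  split; first exact: exp_component sigma_involution H_component Nh.
  by apply: small; exact: le_trans (N_le _) Cwp1.
exists (k * expG (w *m N 0%R) * k^-1 * k * expG (w *m N 1%R))%g; last first.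
  exists (expG (w *m N 2%R) * b)%g => //.
  exists (expG (w *m N 2%R)); last by exists b.
  split; first by exists y => //; rewrite yE.
  by apply: small; exact: le_trans (N_le _) Cwp1.
exists (k * expG (w *m N 0%R) * k^-1 * k)%g; last first.
  exists (expG (w *m N 1%R)) => //; split; last by apply: small; exact: le_trans (N_le _) Cwp1.
  by move=> S _; apply; exists (w *m N 1).
exists (k * expG (w *m N 0%R) * k^-1)%g; last by exists k.
split.
  apply: conj_fixed => //.
  by rewrite (expG_hom _ dth mth) Nk.
rewrite kE; apply: small; apply: le_trans (AdK _ _ kK) _; apply: le_trans Cwp.
by rewrite ler_pM2l.
Qed.
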